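(* Suppose that $\lambda_n\to\lambda\in[0,1]$ and $\rho_n\to\rho\in[0,1]$. If $\rho<1$ set $\gamma=0$; if $\rho=1$ assume in addition that $\gamma_n\to\gamma\in[0,1]$. Then: (1) $N^I_{d_n^*}/n\to 1-2\lambda+\lambda^{2-\gamma}$ in probability, and the proportion of vertices $v\in\{1,\dots,n\}$ with $\mathsf d_{G^{(1)}_n}(1,v)=\mathsf d_{G^{(2)}_n}(1,v)$ converges in probability to $1-2\lambda+2\lambda^{2-\gamma}$. (2) In probability, \[\tilde R_n\to\begin{cases}1 & \text{if } 0<\lambda<1,\ \gamma=1,\\[2pt] \dfrac{1-2\lambda+\lambda^{2-\gamma}}{1-\lambda}\,\lambda^{2-\gamma}+f(\lambda,\gamma) & \text{if } 0<\lambda<1,\ 0<\gamma<1,\\[2pt] \rho(1-\lambda)\lambda^2 & \text{if } 0<\lambda<1,\ \gamma=0,\\[2pt] \gamma & \text{if }\lambda\in\{0,1\},\end{cases}\] where $f(\lambda,\gamma)=g\big((1-\gamma)\log(1/\lambda),\gamma\log(1/\lambda)\big)(1-\lambda^\gamma)$ and, for $a,b>0$, $g(a,b)=\mathbb E\big[\tfrac{Z}{\max(X_1,X_2)+Z}\,\big|\,Z>0\big]$ with $X_1,X_2\sim\mathrm{Poisson}(a)$, $Z\sim\mathrm{Poisson}(b)$ independent.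
   Context: Let $(\alpha_n)$ be a sequence in $(0,\infty)$ with $0<\liminf\alpha_n\le\limsup\alpha_n<\infty$, $q_n=\alpha_n\log n/n$, and $(\rho_n)$ a sequence in $(0,1)$. Let $G^{(1)}_n\sim\mathcal G(n,q_n)$ on $\{1,\dots,n\}$, and obtain $G^{(2)}_n$ by independently, for each unordered pair of distinct vertices, with probability $1-\rho_n$ resampling its adjacency as a fresh Bernoulli$(q_n)$ (otherwise keeping it); so $G^{(2)}_n$ is also $\mathcal G(n,q_n)$. Let $d_n^*=\min\{d\in\mathbb Z:(nq_n)^d\ge n/(\log\log n)^2\}$, $\lambda_n\in(0,1)$ defined by $\log(1/\lambda_n)=(nq_n)^{d_n^*}/n$, and $\gamma_n=\rho_n^{d_n^*}$. $\mathsf d_G(1,v)$ is graph distance. $N^I_d$ is the number of vertices at distance exactly $d$ from vertex $1$ in both $G^{(1)}_n$ and $G^{(2)}_n$. For a graph $G$ and vertex $v\neq1$ reachable from $1$, the parent set $\mathsf{par}_G(v)$ is the set of neighbours $u$ of $v$ with $\mathsf d_G(1,u)+1=\mathsf d_G(1,v)$ (empty if $v$ is unreachable). Shortest path trees from $1$ are rooted at $1$ with edges directed away from the root; a uniformly random shortest path tree picks for each reachable $v\ne1$ a parent uniformly from $\mathsf{par}_G(v)$ independently. $\tilde R_n$ is the maximum over couplings $\Pi$ of the uniform measures on shortest path trees of $G^{(1)}_n$ and $G^{(2)}_n$ of $\frac1n\mathbb E_\Pi[\#\text{common directed edges}]$; explicitly \[\tilde R_n=\frac1n\sum_{v\neq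 1}\frac{|\mathsf{par}_{G^{(1)}_n}(v)\cap\mathsf{par}_{G^{(2)}_n}(v)|}{\max(|\mathsf{par}_{G^{(1)}_n}(v)|,|\mathsf{par}_{G^{(2)}_n}(v)|)},\] where a summand is $0$ if the numerator is $0$. *)

(* Defs.v *)
From HB Require Import structures.
From mathcomp Require Import all_boot all_order all_algebra.
From mathcomp Require Import all_classical all_reals all_analysis.

Set Implicit Arguments.
Unset Strict Implicit.
Unset Printing Implicit Defensive.

Import Order.TTheory GRing.Theory Num.Theory.
Import numFieldNormedType.Exports.

Local Open Scope classical_set_scope.
Local Open Scope ring_scope.

Section graph_distance.
Context {V : finType}.
Implicit Types (e : rel V) (r u v : V).

Definition has_walk e u v (k : nat) : bool :=
  [exists p : k.-tuple V, path e u p && (last u p == v)].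

(* None stands for an infinite distance. *)
Definition gdist e u v : option nat :=
  if pselect (exists k, has_walk e u v k) is left h then Some (ex_minn h)
  else None.

Definition at_dist e r (d : int) v : bool :=
  if gdist e r v is Some k then k%:Z == d else false.

(* Empty when v is r or is not reachable from r. *)
Definition par e r v : {set V} :=
  [set u | e u v &&
     (if (gdist e r u, gdist e r v) is (Some k, Some m) then k.+1 == m
      else false)].

(* A tree is encoded by its parent map: t v = Some u iff u -> v is an edge. *)
Definition tree := {ffun V -> option V}.

Definition parent_choices e r v : {set option V} :=
  if par e r v == finset.set0 then [set None]%SET
  else [set Some u | u in par e r v]%SET.

Definition shortest_path_trees e r : {set tree} :=
  [set t : tree | [forall v, t v \in parent_choices e r v]]%SET.

Definition common_edges (t1 t2 : tree) : nat :=
  #|[set v | (t1 v != None) && (t1 v == t2 v)]%SET|.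

End graph_distance.

Definition tree_unif {R : realType} (V : finType) (e : rel V) (r : V)
    (t : @tree V) : R :=
  (t \in shortest_path_trees e r)%:R / #|shortest_path_trees e r|%:R.

Definition tree_coupling {R : realType} (V : finType) (e1 e2 : rel V) (r : V)
    (Pi : @tree V -> @tree V -> R) : Prop :=
  [/\ forall t1 t2, 0 <= Pi t1 t2,
      forall t1, \sum_t2 Pi t1 t2 = tree_unif e1 r t1
    & forall t2, \sum_t1 Pi t1 t2 = tree_unif e2 r t2].

(* The supremum is a maximum, with the closed form tildeR_formula: see the
   lemmas tildeRE and tildeR_attained. *)
Definition tildeR {R : realType} (V : finType) (e1 e2 : rel V) (r : V) : R :=
  sup [set x : R | exists2 Pi, tree_coupling e1 e2 r Pi &
    x = #|V|%:R^-1 *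
        \sum_t1 \sum_t2 Pi t1 t2 * (common_edges t1 t2)%:R].

Definition tildeR_formula {R : realType} (V : finType) (e1 e2 : rel V) (r : V)
    : R :=
  #|V|%:R^-1 * \sum_(v | v != r)
    #|par e1 r v :&: par e2 r v|%:R /
    (maxn #|par e1 r v| #|par e2 r v|)%:R.

Section tildeR_closed_form.
Context {R : realType} {V : finType}.
Implicit Types (e : rel V) (r u v : V).

Let choice_unif e r v (x : option V) : R :=
  (x \in parent_choices e r v)%:R / #|parent_choices e r v|%:R.

Let card_parent_choices_gt0 e r v : (0 < #|parent_choices e r v|)%N.
Proof.
rewrite /parent_choices; case: ifPn => [_|]; first by rewrite cards1.
by rewrite card_imset -?card_gt0 //; exact: Some_inj.
Qed.

Let choice_unif_ge0 e r v x : 0 <= choice_unif e r v x.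
Proof. by rewrite /choice_unif divr_ge0. Qed.

Let sum_choice_unif e r v : \sum_x choice_unif e r v x = 1.
Proof.
rewrite -mulr_suml -natr_sum (_ : (\sum_x _)%N = #|parent_choices e r v|).
  by rewrite divff // pnatr_eq0 -lt0n card_parent_choices_gt0.
by rewrite -sum1_card [RHS]big_mkcond /=; apply: eq_bigr => x _; case: ifP.
Qed.

Let choice_unif_Some e r v u :
  choice_unif e r v (Some u) = (u \in par e r v)%:R / #|par e r v|%:R.
Proof.
rewrite /choice_unif /parent_choices; case: ifPn => [/eqP ->|_].
  by rewrite !inE !mul0r.
by rewrite card_imset ?mem_imset //; exact: Some_inj.
Qed.

Let tree_unifE e r (t : @tree V) :
  tree_unif e r t = \prod_v choice_unif e r v (t v) :> R.
Proof.
rewrite /tree_unif; have -> : #|shortest_path_trees e r| =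
    (\prod_v #|parent_choices e r v|)%N.
  under eq_bigr do rewrite -sum1_card.
  rewrite bigA_distr_big_dep -sum1_card.
  apply: eq_big => [t'|t' _]; last by rewrite big1.
  by rewrite inE; apply/forallP/familyP.
rewrite big_split /= natr_prod prodfV; congr (_ / _).
rewrite inE -natr_prod; congr (_%:R).
case: (boolP [forall v, _]) => [/forallP h|].
  by rewrite big1 // => v _; rewrite h.
by rewrite negb_forall => /existsP [v /negPf h]; rewrite (bigD1 v) //= h.
Qed.

Let sum_tree2 (F : V -> option V -> option V -> R) :
  \sum_(t1 : @tree V) \sum_(t2 : @tree V) \prod_v F v (t1 v) (t2 v) =
  \prod_v \sum_x \sum_y F v x y.
Proof.
rewrite bigA_distr_bigA; apply: eq_bigr => t1 _.
by rewrite bigA_distr_bigA.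
Qed.

Let marginal e r v x :
  \sum_(t : @tree V | t v == x) tree_unif e r t = choice_unif e r v x.
Proof.
pose F w y := choice_unif e r w y * ((w == v) ==> (y == x))%:R.
transitivity (\sum_(t : @tree V) \prod_w F w (t w)).
  rewrite big_mkcond; apply: eq_bigr => t _; rewrite /F big_split /=.
  rewrite -tree_unifE (bigD1 v) //= eqxx implyTb big1 ?mulr1; last first.
    by move=> w /negPf ->.
  by case: (t v == x); rewrite ?mulr1 ?mulr0.
rewrite -(bigA_distr_bigA F) (bigD1 v) //= [X in _ * X]big1 ?mulr1; last first.
  move=> w /negPf wv; rewrite -[RHS](sum_choice_unif e r w).
  by apply: eq_bigr => y _; rewrite /F wv mulr1.
rewrite (bigD1 x) //= /F !eqxx mulr1 big1 ?addr0 // => y /negPf yx.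
by rewrite /= yx mulr0.
Qed.

Let overlap e1 e2 r v (x : option V) : R :=
  Num.min (choice_unif e1 r v x) (choice_unif e2 r v x).

Let sum_overlap e1 e2 r v :
  \sum_u overlap e1 e2 r v (Some u) =
  #|par e1 r v :&: par e2 r v|%:R / (maxn #|par e1 r v| #|par e2 r v|)%:R.
Proof.
rewrite -sum1_card natr_sum mulr_suml [RHS]big_mkcond /=.
apply: eq_bigr => u _; rewrite /overlap !choice_unif_Some finset.in_setI.
case: (boolP (u \in par e1 r v)) => u1; last first.
  by rewrite mul0r; apply/min_idPl; rewrite divr_ge0.
case: (boolP (u \in par e2 r v)) => u2; last first.
  by rewrite mul0r; apply/min_idPr; rewrite divr_ge0.
have c1 : (0 < #|par e1 r v|)%N by apply/card_gt0P; exists u.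
have c2 : (0 < #|par e2 r v|)%N by apply/card_gt0P; exists u.
rewrite /= !mul1r; case: (leqP #|par e1 r v| #|par e2 r v|) => h.
  by apply/min_idPr; rewrite lef_pV2 ?posrE ?ltr0n // ler_nat.
by apply/min_idPl; rewrite lef_pV2 ?posrE ?ltr0n // ler_nat ltnW.
Qed.

Let par_root e r : par e r r = finset.set0.
Proof.
have h0 : has_walk e r r 0.
  by apply/existsP; exists [tuple]; rewrite /= eqxx.
have gr : gdist e r r = Some 0%N.
  rewrite /gdist; case: pselect => [h|[]]; last by exists 0%N.
  by case: ex_minnP => m _ /(_ _ h0); rewrite leqn0 => /eqP ->.
apply/finset.setP => u; rewrite !inE gr; case: (gdist e r u) => [k|];
  by rewrite andbF.
Qed.

Let tildeR_formulaE e1 e2 r : tildeR_formula e1 e2 r =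
  #|V|%:R^-1 * \sum_v \sum_u overlap e1 e2 r v (Some u).
Proof.
congr (_ * _); under [RHS]eq_bigr do rewrite sum_overlap.
by rewrite [RHS](bigD1 r) //= par_root finset.set0I cards0 mul0r add0r.
Qed.

Let common_edgesE (t1 t2 : @tree V) : (common_edges t1 t2)%:R =
  \sum_v \sum_u ((t1 v == Some u) && (t2 v == Some u))%:R :> R.
Proof.
rewrite /common_edges -sum1_card natr_sum big_mkcond /=.
apply: eq_bigr => v _; rewrite inE; case: (t1 v) => [u|] /=; last first.
  by rewrite big1.
rewrite (bigD1 u) //= eqxx big1 ?addr0; first by rewrite eq_sym; case: ifP.
by move=> w; rewrite eq_sym => wu; rewrite (negPf (_ : Some u != Some w)).
Qed.

Let expected_common (Pi : @tree V -> @tree V -> R) :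
  \sum_t1 \sum_t2 Pi t1 t2 * (common_edges t1 t2)%:R =
  \sum_v \sum_u \sum_t1 \sum_t2
    Pi t1 t2 * ((t1 v == Some u) && (t2 v == Some u))%:R.
Proof.
under eq_bigr do under eq_bigr do rewrite common_edgesE mulr_sumr.
under eq_bigr do under eq_bigr do under eq_bigr do rewrite mulr_sumr.
under eq_bigr do rewrite exchange_big /=.
rewrite exchange_big; apply: eq_bigr => v _ /=.
under eq_bigr do rewrite exchange_big /=.
by rewrite exchange_big.
Qed.

Lemma tildeR_le e1 e2 r (Pi : @tree V -> @tree V -> R) :
  tree_coupling e1 e2 r Pi ->
  #|V|%:R^-1 * \sum_t1 \sum_t2 Pi t1 t2 * (common_edges t1 t2)%:R <=
  tildeR_formula e1 e2 r.
Proof.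
move=> [Pi0 Pi1 Pi2]; rewrite tildeR_formulaE ler_wpM2l ?invr_ge0 //.
rewrite expected_common; apply: ler_sum => v _; apply: ler_sum => u _.
rewrite /overlap le_min -!marginal; apply/andP; split.
  rewrite [leRHS]big_mkcond; apply: ler_sum => t1 _; rewrite -Pi1.
  case: (t1 v == Some u) => /=; last by rewrite big1 // => ? _; rewrite mulr0.
  by apply: ler_sum => t2 _; case: (t2 v == _); rewrite ?mulr1 ?mulr0.
rewrite exchange_big [leRHS]big_mkcond; apply: ler_sum => t2 _; rewrite -Pi2.
case: (t2 v == Some u) => /=.
  by apply: ler_sum => t1 _; case: (t1 v == _); rewrite ?mulr1 ?mulr0.
by rewrite big1 // => ? _; rewrite andbF mulr0.
Qed.

(* The maximal coupling of the parents of one vertex. *)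
Let kappa e1 e2 r v (x y : option V) : R :=
  let m := overlap e1 e2 r v in
  (x == y)%:R * m x +
  (choice_unif e1 r v x - m x) * (choice_unif e2 r v y - m y)
    / (1 - \sum_z m z).

Let overlap_le1 e1 e2 r v x : overlap e1 e2 r v x <= choice_unif e1 r v x.
Proof. by rewrite ge_min lexx. Qed.

Let overlap_le2 e1 e2 r v x : overlap e1 e2 r v x <= choice_unif e2 r v x.
Proof. by rewrite ge_min lexx orbT. Qed.

Let sum_overlap_le1 e1 e2 r v : \sum_z overlap e1 e2 r v z <= 1.
Proof. by rewrite -(sum_choice_unif e1 r v); apply: ler_sum. Qed.

Let kappa_ge0 e1 e2 r v x y : 0 <= kappa e1 e2 r v x y.
Proof.
rewrite addr_ge0 ?mulr_ge0 ?invr_ge0 ?subr_ge0 //.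
by rewrite le_min !choice_unif_ge0.
Qed.

Let overlap_eq e r v (m : option V -> R) x :
  (forall z, m z <= choice_unif e r v z) -> \sum_z m z = 1 ->
  m x = choice_unif e r v x.
Proof.
move=> mle m1; apply/eqP; rewrite eq_sym -subr_eq0; apply/eqP.
have /psumr_eq0P -> // : \sum_z (choice_unif e r v z - m z) = 0.
  by rewrite sumrB sum_choice_unif m1 subrr.
by move=> z _; rewrite subr_ge0.
Qed.

Let sum_kappa1 e1 e2 r v x :
  \sum_y kappa e1 e2 r v x y = choice_unif e1 r v x.
Proof.
rewrite big_split /= (bigD1 x) //= eqxx mul1r big1 ?addr0; last first.
  by move=> y; rewrite eq_sym => /negPf ->; rewrite mul0r.
rewrite -mulr_suml -mulr_sumr sumrB sum_choice_unif.
have [h|h] := eqVneq (\sum_z overlap e1 e2 r v z) 1.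
  by rewrite h subrr mulr0 mul0r addr0; exact: overlap_eq h.
by rewrite mulfK ?subr_eq0 1?eq_sym // addrC subrK.
Qed.

Let sum_kappa2 e1 e2 r v y :
  \sum_x kappa e1 e2 r v x y = choice_unif e2 r v y.
Proof.
rewrite big_split /= (bigD1 y) //= eqxx mul1r big1 ?addr0; last first.
  by move=> x /negPf ->; rewrite mul0r.
rewrite -mulr_suml -mulr_suml sumrB sum_choice_unif.
have [h|h] := eqVneq (\sum_z overlap e1 e2 r v z) 1.
  by rewrite h subrr mul0r mul0r addr0; exact: overlap_eq h.
by rewrite mulrAC mulfV ?mul1r ?subr_eq0 1?eq_sym // addrC subrK.
Qed.

Let kappa_diag e1 e2 r v x : overlap e1 e2 r v x <= kappa e1 e2 r v x x.
Proof.
by rewrite /kappa eqxx mul1r lerDl ?mulr_ge0 ?invr_ge0 ?subr_ge0.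
Qed.

Let max_coupling e1 e2 r (t1 t2 : @tree V) : R :=
  \prod_v kappa e1 e2 r v (t1 v) (t2 v).

Let max_coupling_coupling e1 e2 r :
  tree_coupling e1 e2 r (max_coupling e1 e2 r).
Proof.
split=> [t1 t2|t1|t2]; first by rewrite prodr_ge0.
- rewrite tree_unifE -(bigA_distr_bigA (fun v => kappa e1 e2 r v (t1 v))).
  by apply: eq_bigr => v _; rewrite sum_kappa1.
- rewrite tree_unifE.
  rewrite -(bigA_distr_bigA (fun v x => kappa e1 e2 r v x (t2 v))).
  by apply: eq_bigr => v _; rewrite sum_kappa2.
Qed.

Let tildeR_ge e1 e2 r : tildeR_formula e1 e2 r <= #|V|%:R^-1 *
  \sum_t1 \sum_t2 max_coupling e1 e2 r t1 t2 * (common_edges t1 t2)%:R.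
Proof.
rewrite tildeR_formulaE ler_wpM2l ?invr_ge0 // expected_common.
apply: ler_sum => v _; apply: ler_sum => u _.
pose F w x y := kappa e1 e2 r w x y *
  ((w == v) ==> (x == Some u) && (y == Some u))%:R.
have -> : \sum_t1 \sum_t2 max_coupling e1 e2 r t1 t2 *
    ((t1 v == Some u) && (t2 v == Some u))%:R =
  \sum_(t1 : @tree V) \sum_(t2 : @tree V) \prod_w F w (t1 w) (t2 w).
  apply: eq_bigr => t1 _; apply: eq_bigr => t2 _.
  rewrite big_split /= [X in _ = _ * X](bigD1 v) //= eqxx.
  by rewrite [X in _ * (_ * X)]big1 ?mulr1 // => w /negPf ->.
rewrite sum_tree2 (bigD1 v) //= [X in _ * X]big1 ?mulr1; last first.
  move=> w /negPf wv; rewrite -[RHS](sum_choice_unif e1 r w).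
  apply: eq_bigr => x _; rewrite -(sum_kappa1 e1 e2 r w x).
  by apply: eq_bigr => y _; rewrite /F wv mulr1.
have F0 x y : 0 <= F v x y by rewrite mulr_ge0.
rewrite (bigD1 (Some u)) //= (bigD1 (Some u)) //= -addrA.
apply: (le_trans (kappa_diag e1 e2 r v (Some u))).
rewrite {1}/F !eqxx mulr1 lerDl addr_ge0 ?sumr_ge0 // => x _.
by rewrite sumr_ge0.
Qed.

Lemma tildeR_attained e1 e2 r : exists2 Pi, tree_coupling e1 e2 r Pi &
  tildeR_formula e1 e2 r = #|V|%:R^-1 *
    \sum_t1 \sum_t2 Pi t1 t2 * (common_edges t1 t2)%:R :> R.
Proof.
exists (max_coupling e1 e2 r); first exact: max_coupling_coupling.
apply/le_anti; rewrite tildeR_ge /=.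
by apply: tildeR_le; exact: max_coupling_coupling.
Qed.

Lemma tildeRE e1 e2 r : tildeR e1 e2 r = tildeR_formula e1 e2 r :> R.
Proof.
rewrite /tildeR; set S := [set x | _].
have ubS : ubound S (tildeR_formula e1 e2 r).
  by move=> _ [Pi cPi ->]; exact: tildeR_le.
have Sf : S (tildeR_formula e1 e2 r) by exact: tildeR_attained.
apply/le_anti; apply/andP; split.
  by apply: ge_sup => //; eexists; exact: Sf.
by apply: sup_upper_bound => //; split; eexists; [exact: Sf|exact: ubS].
Qed.

End tildeR_closed_form.

Section correlated_graphs.
Context {R : realType}.
Implicit Types (n : nat) (q rho : R).

(* {1, ..., n} for n > 0, with 1 encoded as ord0; the value at n = 0 is
   irrelevant. *)
Definition vertex n := 'I_n.-1.+1.

Definition origin n : vertex n := ord0.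

Definition edge n := {s : {set vertex n} | #|s| == 2%N}.

(* For each pair: its adjacency in the first graph, whether it is kept, and
   the fresh adjacency used when it is not. *)
Definition sample n := {ffun edge n -> bool * bool * bool}.

Definition weight n q rho (w : sample n) : R :=
  \prod_s (bernoulli_pmf q (w s).1.1 * bernoulli_pmf rho (w s).1.2 *
           bernoulli_pmf q (w s).2).

Definition Pr n q rho (A : pred (sample n)) : R :=
  \sum_(w | A w) weight q rho w.

Definition adj n (x : edge n -> bool) : rel (vertex n) :=
  fun u v => [exists s : edge n, (val s == [set u; v]%SET) && x s].

Definition G1 n (w : sample n) : rel (vertex n) :=
  adj (fun s => (w s).1.1).

Definition G2 n (w : sample n) : rel (vertex n) :=
  adj (fun s => if (w s).1.2 then (w s).1.1 else (w s).2).

(* The weights form a probability only when q n is in [0, 1]; for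
   q n = alpha n * ln n / n this excludes finitely many n. *)
Definition cvg_in_prob (q rho : nat -> R) (X : forall n, sample n -> R)
    (l : R) : Prop :=
  forall eps : R, 0 < eps ->
    Pr (q n) (rho n) [pred w : sample n | eps < `|X n w - l|]
      @[n --> \oo] --> (0 : R).

Definition NI n (d : int) (w : sample n) : nat :=
  #|[set v | at_dist (G1 w) (origin n) d v && at_dist (G2 w) (origin n) d v]%SET|.

Definition Nsame n (w : sample n) : nat :=
  #|[set v | gdist (G1 w) (origin n) v == gdist (G2 w) (origin n) v]%SET|.

Definition edge_prob (alpha : nat -> R) n : R := alpha n * ln n%:R / n%:R.

(* The minimum exists as soon as n * q n > 1, hence for all large n. *)
Definition dstar (q : nat -> R) n : int :=
  let S := [set d : int |
    n%:R / ln (ln n%:R) ^+ 2 <= (n%:R * q n) ^ d] in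
  xget 0 [set d | S d /\ (forall d', S d' -> d <= d')].

(* The solution of log (1 / lambda_n) = (n q_n) ^ d_n / n. *)
Definition lambda_seq (q : nat -> R) n : R :=
  expR (- ((n%:R * q n) ^ dstar q n / n%:R)).

Definition gamma_seq (q rho : nat -> R) n : R := rho n ^ dstar q n.

(* The second argument of poisson_prob is not used by its definition. *)
Definition poisson3 (a b : R) : {measure set (nat * nat * nat) -> \bar R} :=
  ((poisson_prob a 0%N \x poisson_prob a 0%N) \x poisson_prob b 0%N)%E.

Definition gPoisson (a b : R) : R :=
  fine (\int[poisson3 a b]_(w in [set w | (0 < w.2)%N])
          (w.2%:R / (maxn w.1.1 w.1.2 + w.2)%N%:R)%:E)%E
  / fine (poisson3 a b [set w | (0 < w.2)%N]).

Definition fPoisson (lambda gamma : R) : R :=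
  gPoisson ((1 - gamma) * ln lambda^-1) (gamma * ln lambda^-1)
  * (1 - lambda `^ gamma).

End correlated_graphs.

(* Main.v *)
(**
  Write N = n q_n and K = d_n^* - 1. All convergences are proved in L^1, with
  bounds for balls in the subgraph induced on an arbitrary set U of vertices:
  revealing the edges at v last makes the number of neighbours of v in the ball
  of radius k of the graph without v a binomial variable given that ball.

  Moments of order one and two, by induction on k and uniformly in U, show that
  a ball of radius k with N^k = o(n) has size N^k (1 + o(1)), and that the two
  balls have (rho_n^k + o(1)) N^k common vertices. By Le Cam's inequality the
  numbers of neighbours of v in the ball of radius K of G1 only, of G2 only and
  of both are nearly independent Poisson variables with parameters
  (1 - gamma_n) L, (1 - gamma_n) L and gamma_n L, where L = log (1 / lambda_n).
  Since removing one vertex seldom changes a ball, these events decorrelate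
  for distinct vertices, and averages over v concentrate.

  A vertex misses the ball of radius K + 1 of G1 (resp. of both graphs) with
  limiting frequency lambda (resp. lambda^(2 - gamma)), while almost no vertex
  lies in a ball of radius K or misses one of radius K + 2; this gives (1).
  For (2), the vertices at distance K + 1 in both graphs contribute the Poisson
  ratio. For the vertices at distance K + 2 in both graphs the parent sets are
  large, so they overlap in the proportion rho (1 - 2 lambda + lambda^(2 - gamma))
  / (1 - lambda), the density of common vertices of the two balls of radius
  K + 1 times the probability to keep an edge. A vertex at distances K + 1 and
  K + 2 contributes nothing, as one of its parent sets is much larger than the
  other one.
*)

Require Import Defs.
From mathcomp Require Import all_boot all_order all_algebra.
From mathcomp Require Import all_classical all_reals all_analysis.
From mathcomp Require Import ring lra zify.

Set Implicit Arguments.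
Unset Strict Implicit.
Unset Printing Implicit Defensive.

Import Order.TTheory GRing.Theory Num.Theory.
Import numFieldNormedType.Exports.

Local Open Scope classical_set_scope.
Local Open Scope ring_scope.

(** * Product measures on finite sets *)

(** A breadth-first exploration would require conditioning on a growing family of edges, in two
    graphs at once. Conditioning is replaced by resampling: redrawing the edges at a vertex [v]
    ([Ex_mix]) leaves every ball of the graph without [v] unchanged. The deletion of [v] takes the
    induction out of the full graph, which forces bounds over all vertex sets; only the number of
    deleted vertices enters them. Deletions are harmless on average for one reason: a vertex within
    distance [k] is lost for at most [k] deletions, all on one shortest path. The estimates are
    explicit for fixed [n], and limits are taken only at the end. Two constraints shape that end. As
    [log (1 / lambda_n)] may diverge, exponentials have to be compared uniformly in it. And parent
    ratios concentrate only at a level where a typical vertex has many neighbours in the ball: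
    radius [K] when [lambda = 0], radius [K + 1] otherwise. These cases share one argument with a
    free radius and a free normalisation. *)

Section product_expectation.
Context {R : realType} {E T : finType} (mu : T -> R).
Hypothesis mu_ge0 : forall t, 0 <= mu t.
Hypothesis mu_sum1 : \sum_t mu t = 1.
Implicit Types (f g : {ffun E -> T} -> R) (w : {ffun E -> T}) (A : pred E).

Definition pweight w : R := \prod_s mu (w s).

Definition Ex f : R := \sum_w pweight w * f w.

Definition expect1 (h : T -> R) : R := \sum_t mu t * h t.

Lemma pweight_ge0 w : 0 <= pweight w.
Proof. exact: prodr_ge0. Qed.

Lemma eq_Ex f g : f =1 g -> Ex f = Ex g.
Proof. by move=> fg; apply: eq_bigr => w _; rewrite fg. Qed.

Lemma ExD f g : Ex (fun w => f w + g w) = Ex f + Ex g.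
Proof. by rewrite -big_split; apply: eq_bigr => w _; rewrite mulrDr. Qed.

Lemma ExZ c f : Ex (fun w => c * f w) = c * Ex f.
Proof. by rewrite mulr_sumr; apply: eq_bigr => w _; rewrite mulrCA. Qed.

Lemma ExN f : Ex (fun w => - f w) = - Ex f.
Proof. by rewrite -sumrN; apply: eq_bigr => w _; rewrite mulrN. Qed.

Lemma ExB f g : Ex (fun w => f w - g w) = Ex f - Ex g.
Proof. by rewrite ExD ExN. Qed.

Lemma Ex_sum (I : Type) (r : seq I) (P : pred I) (F : I -> {ffun E -> T} -> R) :
  Ex (fun w => \sum_(i <- r | P i) F i w) = \sum_(i <- r | P i) Ex (F i).
Proof.
rewrite exchange_big /=; apply: eq_bigr => w _.
by rewrite mulr_sumr.
Qed.

Lemma ler_Ex f g : (forall w, f w <= g w) -> Ex f <= Ex g.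
Proof. by move=> fg; apply: ler_sum => w _; rewrite ler_wpM2l ?pweight_ge0. Qed.

Lemma Ex_ge0 f : (forall w, 0 <= f w) -> 0 <= Ex f.
Proof. by move=> f0; apply: sumr_ge0 => w _; rewrite mulr_ge0 ?pweight_ge0. Qed.

Lemma pweight_sum1 : \sum_w pweight w = 1.
Proof.
by rewrite /pweight -(bigA_distr_bigA (fun=> mu)) big1.
Qed.

Lemma Ex_cst c : Ex (fun=> c) = c.
Proof. by rewrite /Ex -mulr_suml pweight_sum1 mul1r. Qed.

Lemma Ex_coord (s : E) (h : T -> R) : Ex (fun w => h (w s)) = expect1 h.
Proof.
pose F s' t := mu t * (if s' == s then h t else 1).
transitivity (\sum_(w : {ffun E -> T}) \prod_s' F s' (w s')).
  apply: eq_bigr => w _; rewrite /F big_split /=; congr (_ * _).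
  rewrite (bigD1 s) //= eqxx big1 ?mulr1 // => s' /negPf -> //.
rewrite -(bigA_distr_bigA F) (bigD1 s) //= [X in _ * X]big1 ?mulr1.
  by apply: eq_bigr => t _; rewrite /F eqxx.
by move=> s' /negPf h'; rewrite /F h' -[RHS]mu_sum1; apply: eq_bigr => t _; rewrite mulr1.
Qed.

Definition mix A w w' : {ffun E -> T} := [ffun s => if A s then w' s else w s].

(* (w, w') -> (mix A w w', mix A w' w) is an involution preserving the product
   weight. *)
Lemma Ex_mix A f : Ex f = Ex (fun w => Ex (fun w' => f (mix A w w'))).
Proof.
have fst : Ex f = Ex (fun w => Ex (fun w' => f w)).
  by apply: eq_Ex => w; rewrite Ex_cst.
rewrite fst.
transitivity (\sum_(x : {ffun E -> T} * {ffun E -> T})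
   pweight x.1 * pweight x.2 * f x.1).
  rewrite -(pair_big xpredT xpredT (fun w w' => pweight w * pweight w' * f w)) /=.
  by apply: eq_bigr => w _; rewrite mulr_sumr; apply: eq_bigr => w' _; rewrite mulrA.
transitivity (\sum_(x : {ffun E -> T} * {ffun E -> T})
   pweight x.1 * pweight x.2 * f (mix A x.1 x.2)); last first.
  rewrite -(pair_big xpredT xpredT
    (fun w w' => pweight w * pweight w' * f (mix A w w'))) /=.
  by apply: eq_bigr => w _; rewrite mulr_sumr; apply: eq_bigr => w' _; rewrite mulrA.
pose h (x : {ffun E -> T} * {ffun E -> T}) := (mix A x.1 x.2, mix A x.2 x.1).
have hK : involutive h.
  by move=> [w w']; rewrite /h /=; congr pair; apply/ffunP => s; rewrite !ffunE;
    case: (A s).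
rewrite (reindex_inj (inv_inj hK)) /=; apply: eq_bigr => -[w w'] _ /=.
congr (_ * _); rewrite /pweight -!big_split /=; apply: eq_bigr => s _.
by rewrite !ffunE; case: (A s) => //; rewrite mulrC.
Qed.

(** Plays the role of conditioning: [f] is determined by the coordinates outside [A], and the inner
    expectation is the conditional mean of [g] given them. *)
Lemma Ex_mixM A f g : (forall w w', f (mix A w w') = f w) ->
  Ex (fun w => f w * g w) = Ex (fun w => f w * Ex (fun w' => g (mix A w w'))).
Proof.
move=> fA; rewrite (Ex_mix A); apply: eq_Ex => w; rewrite -ExZ.
by apply: eq_Ex => w'; rewrite fA.
Qed.

(** Fubini for one coordinate: [f t] ignores the value of its argument at [s], so that value can be
    integrated separately. *)
Lemma Ex_split_coord (s : E) (f : T -> {ffun E -> T} -> R) :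
  (forall t w w', (forall s', s' != s -> w s' = w' s') -> f t w = f t w') ->
  Ex (fun w => f (w s) w) = expect1 (fun t => Ex (f t)).
Proof.
move=> fs; rewrite (Ex_mix (pred1 s)).
transitivity (Ex (fun w => expect1 (fun t => f t w))).
  apply: eq_Ex => w; rewrite -(Ex_coord s (fun t => f t w)); apply: eq_Ex => w'.
  rewrite ffunE /= eqxx; apply: fs => s' /negPf ss'.
  by rewrite ffunE /= ss'.
rewrite Ex_sum; apply: eq_bigr => t _; exact: ExZ.
Qed.

(** By independence only equal coordinates contribute a covariance. The offsets [x] and [y] make the
    induction close, since fixing the head coordinate moves its contribution into them; later they
    serve to centre the variables. *)
Lemma Ex_cov (es : seq E) (A B : E -> T -> R) (x y : R) : uniq es ->
  Ex (fun w => (\sum_(s <- es) A s (w s) + x) * (\sum_(s <- es) B s (w s) + y)) =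
  (\sum_(s <- es) expect1 (A s) + x) * (\sum_(s <- es) expect1 (B s) + y) +
  \sum_(s <- es) (expect1 (fun t => A s t * B s t) - expect1 (A s) * expect1 (B s)).
Proof.
elim: es x y => [|s es IH] x y /=.
  move=> _; rewrite !big_nil !add0r addr0 -[RHS]Ex_cst.
  by apply: eq_Ex => w; rewrite !big_nil !add0r.
case/andP=> ses ues; rewrite !big_cons.
pose f t (w : {ffun E -> T}) := (\sum_(s <- es) A s (w s) + (A s t + x)) *
  (\sum_(s <- es) B s (w s) + (B s t + y)).
transitivity (Ex (fun w => f (w s) w)).
  by apply: eq_Ex => w; rewrite !big_cons /f; congr (_ * _); ring.
rewrite Ex_split_coord; last first.
  move=> t w w' ww'; rewrite /f; congr ((_ + _) * (_ + _));
    by rewrite !big_seq; apply: eq_bigr => s' s'es; rewrite ww' //;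
      apply: contraNneq ses => <-.
rewrite [LHS]/expect1.
under [LHS]eq_bigr => t _ do rewrite (IH (A s t + x) (B s t + y) ues).
set a := \sum_(j <- es) _; set b := \sum_(j <- es) _; set c := \sum_(j <- es) _.
have -> : \sum_t mu t * ((a + (A s t + x)) * (b + (B s t + y)) + c) =
   ((a + x) * (b + y) + c) * \sum_t mu t + (b + y) * (\sum_t mu t * A s t) +
   (a + x) * (\sum_t mu t * B s t) + \sum_t mu t * (A s t * B s t).
  by rewrite !mulr_sumr -!big_split /=; apply: eq_bigr => t _; ring.
by rewrite mu_sum1 /expect1; ring.
Qed.

Lemma Ex_sumE (es : seq E) (A : E -> T -> R) :
  Ex (fun w => \sum_(s <- es) A s (w s)) = \sum_(s <- es) expect1 (A s).
Proof. by rewrite Ex_sum; apply: eq_bigr => s _; rewrite Ex_coord. Qed.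

End product_expectation.

(** * Balls in induced subgraphs *)

Section balls.
Local Open Scope nat_scope.
Local Open Scope set_scope.
Context {V : finType}.
Implicit Types (e : rel V) (r u v x : V) (U : {set V}).

(* The root is included even when it does not lie in U. *)
Fixpoint gball_rec e r U (k : nat) : {set V} :=
  if k is k'.+1 then
    gball_rec e r U k' :|: [set v in U | [exists u in gball_rec e r U k', e u v]]
  else [set r].

(** Balls are locked so that simplification never unfolds them at a successor radius. *)
Fact gball_key : unit. Proof. by []. Qed.
Definition gball := locked_with gball_key gball_rec.

Lemma gballS e r U k v : (v \in gball e r U k.+1) =
  (v \in gball e r U k) || (v \in U) && [exists u in gball e r U k, e u v].
Proof. by rewrite /gball !locked_withE /= !inE. Qed.

Lemma gball0 e r U : gball e r U 0 = [set r].
Proof. by rewrite /gball locked_withE. Qed.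

Lemma gball_subS e r U k : gball e r U k \subset gball e r U k.+1.
Proof. by apply/fintype.subsetP => v; rewrite gballS => ->. Qed.

Lemma mem_ballS e r U k u v :
  u \in gball e r U k -> v \in U -> e u v -> v \in gball e r U k.+1.
Proof.
move=> uB vU euv; rewrite gballS vU orbC; apply/orP; left.
by apply/existsP; exists u; rewrite uB.
Qed.

Lemma root_ball e r U k : r \in gball e r U k.
Proof. by elim: k => [|k IH]; rewrite ?gballS ?IH // gball0 inE. Qed.

Lemma gball_leq e r U k l : k <= l -> gball e r U k \subset gball e r U l.
Proof.
move=> /subnK <-; elim: (l - k) => [|m IH]; first exact: subxx.
by rewrite addSn; apply: fintype.subset_trans IH (gball_subS _ _ _ _).
Qed.

Lemma gball_sub e e' r U U' k : (forall u v, e u v -> e' u v) ->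
  U \subset U' -> gball e r U k \subset gball e' r U' k.
Proof.
move=> ee' UU'; elim: k => [|k /fintype.subsetP IH]; first by rewrite !gball0.
apply/fintype.subsetP => v; rewrite !gballS => /orP[/IH -> //|/andP[vU /existsP[u /andP[uB euv]]]].
rewrite (fintype.subsetP UU') //=; apply/orP; right; apply/existsP; exists u.
by rewrite IH //= ee'.
Qed.

Lemma gball_subU e r U k : gball e r U k \subset r |: U.
Proof.
elim: k => [|k /fintype.subsetP IH]; apply/fintype.subsetP => v; first by rewrite gball0 !inE => ->.
by rewrite gballS => /orP[/IH //|/andP[vU _]]; rewrite !inE vU orbT.
Qed.

(** Paths counted by a ball inside [U] avoid a vertex [x] outside [U] that is not the root, so the
    edges at [x] may be altered at will. *)
Lemma eq_ball e e' r U k x : x != r -> x \notin U ->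
  (forall u v, u != x -> v != x -> e u v = e' u v) ->
  gball e r U k = gball e' r U k.
Proof.
move=> xr xU ee'; elim: k => [|k IH]; first by rewrite !gball0.
apply/finset.setP => v; rewrite !gballS IH.
case: (boolP (v \in U)) => //= vU; congr (_ || _); apply: eq_existsb => u.
case: (boolP (u \in gball e' r U k)) => //= uB; apply: ee'.
  have := fintype.subsetP (gball_subU e' r U k) _ uB; rewrite !inE => /orP[/eqP ->|uU].
    by rewrite eq_sym.
  by apply: contraNneq xU => <-.
by apply: contraNneq xU => <-.
Qed.

Lemma gball_removed e r U k x : x != r -> x \notin gball e r U k ->
  gball e r U k = gball e r (U :\ x) k.
Proof.
move=> xr; elim: k => [|k IH] xB; first by rewrite !gball0.
have xBk : x \notin gball e r U k by apply: contra xB; exact: (fintype.subsetP (gball_subS _ _ _ _)).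
apply/finset.setP => v; rewrite !gballS -(IH xBk) !inE.
case: eqVneq => [->|//] /=.
by move: xB; rewrite gballS (negPf xBk) /= => /negPf ->.
Qed.

(** A shortest path to [x] meets [x] only at its end, so its last but one vertex is already reached
    without [x]. Membership of [x] thus depends on the edges at [x] and on a ball that these edges
    do not influence; the probabilistic computations on balls rest on this. *)
Lemma in_ballS e r U k x : x != r -> x \in U ->
  (x \in gball e r U k.+1) = [exists u in gball e r (U :\ x) k, e u x].
Proof.
move=> xr xU; apply/idP/idP; last first.
  case/existsP => u /andP[uB eux]; apply: mem_ballS eux => //.
  by apply: (fintype.subsetP _ _ uB); apply: gball_sub => //; exact: subD1set.
elim: k => [|k IH].
  rewrite gballS !gball0 inE (negPf xr) /= xU => /existsP[u /andP[uB eux]].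
  by apply/existsP; exists u; rewrite uB.
case: (boolP (x \in gball e r U k.+1)) => [xB _|xB].
  have /existsP[u /andP[uB eux]] := IH xB.
  by apply/existsP; exists u; rewrite eux (fintype.subsetP (gball_subS _ _ _ _)).
(* Here [x] is still outside the ball of radius [k + 1], so deleting it does not change that
   ball. *)
rewrite gballS (negPf xB) xU orFb andTb => /existsP[u /andP[uB eux]].
by apply/existsP; exists u; rewrite eux andbT -gball_removed.
Qed.

(* The vertices whose removal destroys the distance bound all lie on one
   shortest path. *)
Lemma card_cut e r U k u : u \in gball e r U k ->
  #|[set x | (x != r) && (u \notin gball e r (U :\ x) k)]| <= k.
Proof.
elim: k u => [|k IH] u.
  rewrite gball0 inE => /eqP ->; rewrite leqn0 cards_eq0; apply/eqP/finset.setP => x.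
  by rewrite !inE gball0 inE eqxx andbF.
rewrite gballS => /orP[uB|/andP[uU /existsP[u' /andP[u'B eu']]]].
  apply: leqW; apply: leq_trans (IH _ uB); apply: subset_leq_card.
  apply/fintype.subsetP => x; rewrite !inE => /andP[->]; rewrite andTb; apply: contra.
  exact: (fintype.subsetP (gball_subS _ _ _ _)).
apply: (@leq_trans #|u |: [set x | (x != r) && (u' \notin gball e r (U :\ x) k)]|).
  apply: subset_leq_card; apply/fintype.subsetP => x; rewrite 3!inE.
  case/andP => xr uN; rewrite !inE xr /=; case: eqVneq => //= xu.
  apply: contra uN => u'B'; apply: mem_ballS u'B' _ eu'.
  by rewrite !inE eq_sym xu uU.
rewrite cardsU1; have := IH _ u'B; by case: (_ \notin _) => /=; lia.
Qed.

Lemma has_walkS e r v k :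
  has_walk e r v k.+1 = [exists u, has_walk e r u k && e u v].
Proof.
apply/existsP/existsP.
  case=> p /andP[pp /eqP lp]; case: p pp lp => p; case/lastP: p => [//|p x] sp.
  rewrite /= rcons_path last_rcons => /andP[pp lpx] xv.
  exists (last r p); rewrite -xv lpx andbT.
  have sp' : size p == k by rewrite size_rcons in sp.
  by apply/existsP; exists (Tuple sp'); rewrite /= pp eqxx.
case=> u /andP[/existsP[p /andP[pp /eqP lp]] euv].
have sp : size (rcons p v) == k.+1 by rewrite size_rcons size_tuple.
by exists (Tuple sp); rewrite /= rcons_path pp lp euv last_rcons eqxx.
Qed.

Lemma gball_walkP e r k v :
  reflect (exists2 j, j <= k & has_walk e r v j) (v \in gball e r [set: V] k).
Proof.
elim: k v => [|k IH] v.
  rewrite gball0 inE; apply: (iffP eqP) => [->|[j]].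
    by exists 0 => //; apply/existsP; exists [tuple]; rewrite /= eqxx.
  rewrite leqn0 => /eqP -> /existsP[p]; rewrite tuple0 /= => /eqP //.
rewrite gballS inE /=; apply: (iffP orP).
  case=> [/IH[j jk wj]|/existsP[u /andP[/IH[j jk wj] euv]]].
    by exists j => //; exact: leqW.
  by exists j.+1 => //; rewrite has_walkS; apply/existsP; exists u; rewrite wj.
case=> -[|j] jk wj; first by left; apply/IH; exists 0.
move: wj; rewrite has_walkS => /existsP[u /andP[wu euv]]; right.
by apply/existsP; exists u; rewrite euv andbT; apply/IH; exists j.
Qed.

Lemma gball_gdistP e r k v :
  (v \in gball e r [set: V] k) = (if gdist e r v is Some m then m <= k else false).
Proof.
rewrite /gdist; case: pselect => [h|h].
  case: ex_minnP => m wm mmin; apply/gball_walkP/idP => [[j jk wj]|mk].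
    exact: leq_trans (mmin _ wj) jk.
  by exists m.
by apply/gball_walkP => -[j _ wj]; apply: h; exists j.
Qed.

Lemma gdist_ball e r k v : v \in gball e r [set: V] k.+1 -> v \notin gball e r [set: V] k ->
  gdist e r v = Some k.+1.
Proof.
rewrite !gball_gdistP; case: gdist => [m|//]; rewrite -ltnNge => mk km.
by congr Some; apply/eqP; rewrite eqn_leq mk km.
Qed.

(** For a vertex first reached at radius [k + 1], a neighbour within distance [k] is at distance
    exactly [k], as a closer one would bring the vertex within [k]. The ball can be computed without
    [v] because [v] lies outside it. *)
Lemma par_ball e r k v : v != r ->
  v \in gball e r [set: V] k.+1 -> v \notin gball e r [set: V] k ->
  par e r v = [set u in gball e r ([set: V] :\ v) k | e u v].
Proof.
move=> vr vB vN; have gv := gdist_ball vB vN.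
apply/finset.setP => u; rewrite !inE gv -(gball_removed vr vN) gball_gdistP.
rewrite andbC; case: (boolP (e u v)) => [euv|]; rewrite ?andbF ?andbT //.
case gu: gdist => [m|//]; rewrite eqSS eqn_leq; case: (leqP m k) => //= mk.
rewrite leqNgt; apply: contra vN => mk'.
case: k mk' {vB gv mk} => [//|k] mk'; apply: mem_ballS euv; last by rewrite inE.
by rewrite gball_gdistP gu.
Qed.

End balls.

(** * Edges at a vertex *)

Section edges.
Local Open Scope nat_scope.
Local Open Scope set_scope.
Context {n : nat}.
Notation V := (vertex n).
Implicit Types (x y : edge n -> bool) (u v : V) (S : {set V}) (s : edge n).

Lemma adjP x u v : reflect (exists2 s, val s = [set u; v] & x s) (adj x u v).
Proof.
apply: (iffP existsP) => [[s /andP[/eqP sE xs]]|[s sE xs]]; first by exists s.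
by exists s; rewrite sE eqxx.
Qed.

Lemma eq_adj x y u v : (forall s, val s = [set u; v] -> x s = y s) ->
  adj x u v = adj y u v.
Proof. by move=> xy; apply/adjP/adjP => -[s sE]; [rewrite xy|rewrite -xy] => // ?; exists s. Qed.

Lemma adj_andb x y u v : adj (fun s => x s && y s) u v = adj x u v && adj y u v.
Proof.
apply/adjP/andP => [[s sE /andP[xs ys]]|[/adjP[s sE xs] /adjP[s' s'E ys]]].
  by split; apply/adjP; exists s.
by exists s => //; rewrite xs; have -> : s = s' by apply/val_inj; rewrite sE s'E.
Qed.

Lemma adj_T u v : adj (fun=> true) u v = (u != v).
Proof.
apply/adjP/idP => [[s sE _]|uv].
  by apply: contraTneq (valP s) => uv; rewrite sE uv finset.setUid cards1.
have h : #|[set u; v]| == 2 by rewrite cards2 uv.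
by exists (exist (fun s : {set V} => #|s| == 2 : Prop) _ h).
Qed.

Definition incident S v s : bool := [exists u in S, val s == [set u; v]].

Lemma set2_inj u u' v : u != v -> [set u; v] = [set u'; v] -> u = u'.
Proof.
move=> uv /finset.setP /(_ u); rewrite !inE eqxx (negPf uv) orbF /=.
by case: eqVneq.
Qed.

Lemma sum_edge_pair u v s0 (F : edge n -> nat) : val s0 = [set u; v] ->
  \sum_s (val s == [set u; v]) * F s = F s0.
Proof.
move=> h; rewrite (bigD1 s0) //= h eqxx mul1n big1 ?addn0 // => s ss0.
have -> : (val s == [set u; v]) = false; last by rewrite mul0n.
by apply: contraNF ss0 => /eqP sE; apply/eqP/val_inj; rewrite sE h.
Qed.

(** The count becomes a sum over edges, hence of functions of distinct independent coordinates. As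
    [v] is not in [S], an edge at [v] has at most one end in [S]. *)
Lemma card_nbr x v S : v \notin S ->
  #|[set u in S | adj x u v]| = \sum_s incident S v s && x s.
Proof.
move=> vS; transitivity (\sum_(u in S) \sum_s (val s == [set u; v]) * x s).
  rewrite -sum1_card big_mkcond [RHS]big_mkcond /=; apply: eq_bigr => u _.
  rewrite inE; case: (boolP (u \in S)) => //= uS.
  case: ifP => [/adjP[s sE xs]|N]; first by rewrite (sum_edge_pair _ sE) xs.
  rewrite big1 // => s _; case: eqVneq => //= sE; rewrite mul1n.
  by case xs: (x s) => //; move/adjP: N => []; exists s.
rewrite exchange_big /=; apply: eq_bigr => s _.
rewrite -big_distrl /= -mulnb; congr (_ * _)%N.
case: (boolP (incident S v s)) => [/existsP[u /andP[uS /eqP sE]]|].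
  rewrite (bigD1 u) //= sE eqxx big1 // => u' /andP[u'S u'u].
  case: eqVneq => // E; case/negP: u'u; apply/eqP; symmetry; apply: set2_inj E.
  by apply: contraNneq vS => <-.
rewrite negb_exists => /forallP h; rewrite big1 // => u uS.
by have := h u; rewrite uS /= => /negPf ->.
Qed.

Lemma incidentI S S' v s : v \notin S -> 
  incident S v s && incident S' v s = incident (S :&: S') v s.
Proof.
move=> vS; apply/andP/existsP => [[]|].
  case/existsP => u /andP[uS /eqP sE] /existsP[u' /andP[uS' /eqP sE']].
  exists u; rewrite inE uS sE eqxx andbT /=.
  rewrite sE in sE'; have -> // : u = u'; apply: set2_inj sE'.
  by apply: contraNneq vS => <-.
case=> u; rewrite inE => /andP[/andP[uS uS'] sE].
by split; apply/existsP; exists u; rewrite sE ?uS ?uS'.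
Qed.

Lemma sum_incident v S : v \notin S -> (\sum_s incident S v s)%N = #|S|.
Proof.
move=> vS; transitivity #|[set u in S | adj (fun=> true) u v]|.
  by rewrite card_nbr //; apply: eq_bigr => s _; rewrite andbT.
apply: eq_card => u; rewrite inE adj_T; case: (boolP (u \in S)) => //= uS.
by apply: contraNneq vS => <-.
Qed.

End edges.

(** * Moments of the number of neighbours of a vertex in a fixed set *)

Section star_moments.
Context {R : realType} {n : nat} {T : finType} (mu : T -> R).
Hypothesis mu_sum1 : \sum_t mu t = 1.
Notation V := (vertex n).
Notation Ex := (@Ex R (edge n) T mu).
Implicit Types (g h : T -> bool) (w : {ffun edge n -> T}) (v : V) (S : {set V}).

Definition prob1 g : R := expect1 mu (fun t => (g t)%:R).

Definition gr g w : rel V := adj (fun s => g (w s)).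

Definition nbr g w v S : {set V} := [set u in S | gr g w u v]%SET.

Definition at_vertex v : pred (edge n) := fun s => v \in val s.

Lemma gr_mix g v w w' u x : u != v -> x != v ->
  gr g (mix (at_vertex v) w w') u x = gr g w u x.
Proof.
move=> uv xv; apply: eq_adj => s sE; rewrite ffunE /at_vertex sE !inE.
by rewrite !(eq_sym v) (negPf uv) (negPf xv).
Qed.

Lemma nbr_mix g v w w' S : nbr g (mix (at_vertex v) w w') v S = nbr g w' v S.
Proof.
apply/finset.setP => u; rewrite !inE; congr (_ && _).
by apply: eq_adj => s sE; rewrite ffunE /at_vertex sE !inE eqxx orbT.
Qed.

Lemma nbr_mix_other g v x w w' S : x != v -> v \notin S ->
  nbr g (mix (at_vertex v) w w') x S = nbr g w x S.
Proof.
move=> xv vS; apply/finset.setP => u; rewrite !inE.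
case: (boolP (u \in S)) => //= uS; apply: gr_mix => //.
by apply: contraNneq vS => <-.
Qed.

Lemma gball_mix g v w w' r (U : {set V}) k : v != r -> v \notin U ->
  gball (gr g (mix (at_vertex v) w w')) r U k = gball (gr g w) r U k.
Proof. by move=> vr vU; apply: (eq_ball _ vr vU) => u x uv xv; exact: gr_mix. Qed.

Lemma nbrI g h w v S S' :
  (nbr g w v S :&: nbr h w v S' =
   nbr (fun t => g t && h t) w v (S :&: S'))%SET.
Proof.
by apply/finset.setP => u; rewrite !inE /gr adj_andb andbACA.
Qed.

Lemma card_nbrE g w v S : v \notin S ->
  #|nbr g w v S|%:R = \sum_s (incident S v s && g (w s))%:R :> R.
Proof. by move=> vS; rewrite /nbr card_nbr // natr_sum. Qed.

Lemma expect1_incident g S v s :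
  expect1 mu (fun t => (incident S v s && g t)%:R) = (incident S v s)%:R * prob1 g.
Proof.
rewrite /prob1 /expect1; case: incident => /=; first by rewrite mul1r.
by rewrite mul0r big1 // => t _; rewrite mulr0.
Qed.

Lemma sumr_incident v S : v \notin S -> \sum_s (incident S v s)%:R = #|S|%:R :> R.
Proof. by move=> vS; rewrite -natr_sum sum_incident. Qed.

Lemma Ex_nbr g v S : v \notin S -> Ex (fun w => #|nbr g w v S|%:R) = prob1 g * #|S|%:R.
Proof.
move=> vS; under eq_Ex do rewrite card_nbrE //.
rewrite (@Ex_sumE _ _ _ _ mu_sum1 _ (fun s t => (incident S v s && g t)%:R)).
under eq_bigr do rewrite expect1_incident.
by rewrite -mulr_suml sumr_incident // mulrC.
Qed.

(** Two counts at [v] are correlated only through the edges to common vertices of [S] and [S']. The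
    offsets give raw and centred second moments at once. *)
Lemma Ex_nbr2 g h v S S' (x y : R) : v \notin S -> v \notin S' ->
  Ex (fun w => (#|nbr g w v S|%:R + x) * (#|nbr h w v S'|%:R + y)) =
  (prob1 g * #|S|%:R + x) * (prob1 h * #|S'|%:R + y) +
  (prob1 (fun t => g t && h t) - prob1 g * prob1 h) * #|S :&: S'|%SET%:R.
Proof.
move=> vS vS'; under eq_Ex do rewrite !card_nbrE //.
rewrite (@Ex_cov _ _ _ _ mu_sum1 _ (fun s t => (incident S v s && g t)%:R)
  (fun s t => (incident S' v s && h t)%:R)) ?index_enum_uniq //.
have sumE (k : T -> bool) (X : {set V}) : v \notin X ->
    \sum_s expect1 mu (fun t => (incident X v s && k t)%:R) = prob1 k * #|X|%:R.
  move=> vX; under eq_bigr do rewrite expect1_incident.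
  by rewrite -mulr_suml sumr_incident // mulrC.
rewrite !sumE //; congr (_ + _).
have vI : v \notin (S :&: S')%SET by rewrite inE (negPf vS).
rewrite -(sumr_incident vI) mulr_sumr; apply: eq_bigr => s _.
rewrite !expect1_incident -(incidentI S' s vS) /prob1 /expect1.
case: incident => /=; case: incident => /=; rewrite ?mul0r ?mulr0 ?mul1r ?mulr1 ?subr0;
  try (by rewrite big1 // => t _; rewrite ?mul0r ?andbF ?mulr0).
by congr (_ - _); apply: eq_bigr => t _; rewrite -natrM mulnb.
Qed.

End star_moments.

(** * From second moments to mean absolute values *)

Section expectation_norm.
Context {R : realType} {E T : finType} (mu : T -> R).
Hypothesis mu_ge0 : forall t, 0 <= mu t.
Hypothesis mu_sum1 : \sum_t mu t = 1.
Notation Ex := (@Ex R E T mu).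

(** Nonnegativity of the variance of [|X|]. *)
Lemma Ex_norm_sqrt (X : {ffun E -> T} -> R) (e : R) :
  Ex (fun w => X w ^+ 2) <= e -> Ex (fun w => `|X w|) <= Num.sqrt e.
Proof.
move=> Xe; set m := Ex _.
have m0 : 0 <= m by apply: Ex_ge0.
have : 0 <= Ex (fun w => (`|X w| - m) ^+ 2) by apply: Ex_ge0 => // w; exact: sqr_ge0.
rewrite (@eq_Ex _ _ _ _ _ (fun w => X w ^+ 2 + (- (2 * m) * `|X w| + m ^+ 2))); last first.
  by move=> w; rewrite -[X w ^+ 2]real_normK ?num_real //; ring.
rewrite !ExD ExZ Ex_cst // -/m => h.
have me : m ^+ 2 <= e by nra.
by rewrite -[m]ger0_norm // -sqrtr_sqr ler_wsqrtr.
Qed.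

End expectation_norm.

(** * First and second moments of ball sizes *)

Section gball_moments.
Context {R : realType} {n : nat} {T : finType} (mu : T -> R).
Hypothesis mu_ge0 : forall t, 0 <= mu t.
Hypothesis mu_sum1 : \sum_t mu t = 1.
Notation V := (vertex n).
Notation r := (origin n).
Notation Ex := (@Ex R (edge n) T mu).
Implicit Types (g h : T -> bool) (w : {ffun edge n -> T}) (v : V) (U : {set V}).

Definition gb g w U k : {set V} := gball (gr g w) r U k.

Lemma notin_gb g w U k v : v != r -> v \notin U -> v \notin gb g w U k.
Proof.
move=> vr vU; apply: contraNN vU => /(fintype.subsetP (gball_subU _ _ _ _)).
by rewrite !inE (negPf vr).
Qed.

Lemma notin_gbD1 g w U k v : v != r -> v \notin gb g w (U :\ v)%SET k.
Proof. by move=> vr; apply: notin_gb => //; rewrite !inE eqxx. Qed.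

Lemma in_gbS g w U k v : v != r -> v \in U ->
  (v \in gb g w U k.+1) = (0 < #|nbr g w v (gb g w (U :\ v)%SET k)|)%N.
Proof.
move=> vr vU; rewrite /gb in_ballS //; apply/existsP/card_gt0P => -[u];
  by [move=> h; exists u; rewrite inE|rewrite inE => h; exists u].
Qed.

(** The root is counted apart: it belongs to every ball, whereas membership of any other vertex can
    be decided by revealing its edges last. *)
Lemma card_gbE g w U k :
  #|gb g w U k|%:R = 1 + \sum_(v in U :\ r) (v \in gb g w U k)%:R :> R.
Proof.
rewrite -natr_sum (cardsD1 r) root_ball natrD; congr (_ + _%:R).
rewrite -sum1_card big_mkcond [RHS]big_mkcond /=; apply: eq_bigr => v _.
rewrite !inE; case: eqVneq => //= vr.
case: (boolP (v \in U)) => [vU|vU]; first by case: (v \in _).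
by rewrite (negPf (notin_gb g w k vr vU)).
Qed.

Lemma gb_mix g w w' U k v : v != r -> v \notin U ->
  gb g (mix (at_vertex v) w w') U k = gb g w U k.
Proof. exact: gball_mix. Qed.

Lemma gb_mixD1 g w w' U k v : v != r ->
  gb g (mix (at_vertex v) w w') (U :\ v)%SET k = gb g w (U :\ v)%SET k.
Proof. by move=> vr; apply: gb_mix => //; rewrite !inE eqxx. Qed.

Lemma Ex_nbr_gb g U k v : v != r ->
  Ex (fun w => #|nbr g w v (gb g w (U :\ v)%SET k)|%:R) =
  prob1 mu g * Ex (fun w => #|gb g w (U :\ v)%SET k|%:R).
Proof.
move=> vr; rewrite (Ex_mix mu_sum1 (at_vertex v)) -ExZ; apply: eq_Ex => w.
rewrite -(Ex_nbr mu_sum1 g (notin_gbD1 g w U k vr)); apply: eq_Ex => w'.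
by rewrite nbr_mix gb_mixD1.
Qed.

(** Deleting both vertices excludes the edge between them, so the two counts are independent given
    the ball; the two stars are resampled one after the other. *)
Lemma Ex_nbr_gb2 g U k v x : v != r -> x != r -> v != x ->
  Ex (fun w => #|nbr g w v (gb g w (U :\ v :\ x)%SET k)|%:R *
               #|nbr g w x (gb g w (U :\ v :\ x)%SET k)|%:R) =
  prob1 mu g ^+ 2 * Ex (fun w => #|gb g w (U :\ v :\ x)%SET k|%:R ^+ 2).
Proof.
move=> vr xr vx; have vU : v \notin (U :\ v :\ x)%SET by rewrite !inE eqxx andbF.
rewrite (Ex_mixM mu_sum1 (A := at_vertex x)); last first.
  by move=> w w'; rewrite gb_mixD1 // nbr_mix_other // notin_gbD1.
transitivity (Ex (fun w => #|nbr g w v (gb g w (U :\ v :\ x)%SET k)|%:R *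
    (prob1 mu g * #|gb g w (U :\ v :\ x)%SET k|%:R))).
  apply: eq_Ex => w; congr (_ * _).
  rewrite -(Ex_nbr mu_sum1 g (notin_gbD1 g w (U :\ v)%SET k xr)).
  by apply: eq_Ex => w'; rewrite nbr_mix gb_mixD1.
rewrite (Ex_mix mu_sum1 (at_vertex v)) -ExZ; apply: eq_Ex => w.
have := Ex_nbr mu_sum1 g (notin_gb g w k vr vU).
set S := gb g w _ _ => ES.
transitivity (Ex (fun w' => (prob1 mu g * #|S|%:R) * #|nbr g w' v S|%:R)).
  by apply: eq_Ex => w'; rewrite nbr_mix gb_mix // mulrC.
by rewrite ExZ ES; ring.
Qed.

Local Notation p g := (prob1 mu g).
Local Notation N g := (#|V|%:R * prob1 mu g).

Lemma prob1_ge0 g : 0 <= p g.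
Proof. by apply: sumr_ge0 => t _; rewrite mulr_ge0. Qed.

Lemma Ex_gb_step g U k v : v != r -> v \in U ->
  Ex (fun w => (v \in gb g w U k.+1)%:R) <=
  p g * Ex (fun w => #|gb g w (U :\ v)%SET k|%:R).
Proof.
move=> vr vU; rewrite -Ex_nbr_gb //; apply: ler_Ex => // w.
by rewrite in_gbS // ler_nat; case: #|_|.
Qed.

Lemma sum_le_card (P : pred V) (F : V -> R) (c : R) : 0 <= c ->
  (forall v, P v -> F v <= c) -> \sum_(v | P v) F v <= #|V|%:R * c.
Proof.
move=> c0 Fc; rewrite (le_trans (ler_sum _ Fc)) // sumr_const -[c *+ _]mulr_natl.
by rewrite ler_wpM2r // ler_nat max_card.
Qed.

(** Union bound over the last edge of a path. The [- 1] absorbs the root: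
    [1 + N (2 N^k - 1) <= 2 N^(k+1) - 1] as soon as [N >= 2]. *)
Lemma Ex_gb_le g U k : 2 <= N g ->
  Ex (fun w => #|gb g w U k|%:R) <= 2 * N g ^+ k - 1.
Proof.
move=> N2; elim: k U => [|k IH] U.
  rewrite expr0 mulr1 -[leRHS](@Ex_cst _ (edge n) _ _ mu_sum1) /=; apply: ler_Ex => // w.
  by rewrite /gb gball0 cards1; lra.
have Nk : 1 <= N g ^+ k by rewrite exprn_ege1 //; lra.
under eq_Ex do rewrite card_gbE.
rewrite ExD Ex_cst // Ex_sum.
apply: (@le_trans _ _ (1 + #|V|%:R * (p g * (2 * N g ^+ k - 1)))).
  rewrite lerD2l; apply: sum_le_card => [|v].
    by rewrite mulr_ge0 ?prob1_ge0 //; lra.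
  rewrite !inE => /andP[vr vU]; apply: le_trans (Ex_gb_step _ _ vr vU) _.
  by rewrite ler_wpM2l ?prob1_ge0.
by rewrite exprS mulrA; nra.
Qed.

Lemma sum_cut g w U k v : v \in gb g w U k ->
  \sum_(x in U :\ r) (v \notin gb g w (U :\ x)%SET k)%:R <= k%:R :> R.
Proof.
move=> vB; rewrite -natr_sum ler_nat; apply: leq_trans (card_cut vB).
rewrite -sum1_card big_mkcond [leqRHS]big_mkcond /=; apply: leq_sum => x _.
by rewrite !inE; case: (x != r) => //=; case: (x \in U) => //; case: (_ \notin _).
Qed.

(** Pairs in the ball are sorted by whether deleting one vertex loses the other. For each vertex at
    most [k] deletions do so, so the bad pairs and the diagonal cost only a multiple of the ball
    size. For the remaining pairs each vertex is reached without the other. *)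
Lemma card_gb_sqr g w U k :
  #|gb g w U k|%:R ^+ 2 <= \sum_(v in U :\ r) \sum_(x in U :\ r | v != x)
      ((v \in gb g w (U :\ x)%SET k) && (x \in gb g w (U :\ v)%SET k))%:R +
    (2 * k + 3)%:R * #|gb g w U k|%:R :> R.
Proof.
set B := gb g w U k; set D := \sum_(v in U :\ r) _.
pose d v x := v \in gb g w (U :\ x)%SET k.
have sumB : \sum_(v in U :\ r) (v \in B)%:R = #|B|%:R - 1 :> R.
  by rewrite card_gbE -/B addrC addKr.
have step : (#|B|%:R - 1) ^+ 2 <= D + (#|B|%:R - 1) + 2 * k%:R * (#|B|%:R - 1) :> R.
  rewrite expr2 -{1 2}sumB big_distrlr /=.
  apply: (@le_trans _ _ (\sum_(v in U :\ r) \sum_(x in U :\ r)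
     ((v != x)%:R * (d v x && d x v)%:R + (v == x)%:R * (v \in B)%:R +
      (v \in B)%:R * (~~ d v x)%:R + (x \in B)%:R * (~~ d x v)%:R))).
    apply: ler_sum => v _; apply: ler_sum => x _.
    case: eqVneq => [->|vx].
      by case: (x \in B); case: (d x x); rewrite /= ?mulr0n ?mulr1n; lra.
    by case: (v \in B); case: (x \in B); case: (d v x); case: (d x v);
      rewrite /= ?mulr0n ?mulr1n; lra.
  under eq_bigr do rewrite !big_split /=.
  rewrite !big_split /= -addrA; apply: lerD.
    apply: lerD.
      rewrite le_eqVlt; apply/orP; left; apply/eqP; apply: eq_bigr => v _.
      rewrite [RHS]big_mkcondr /=; apply: eq_bigr => x _.
      by case: (v != x); rewrite ?mul1r ?mul0r.
    rewrite -sumB; apply: ler_sum => v vU; rewrite (bigD1 v) //= eqxx mul1r.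
    by rewrite big1 ?addr0 // => x /andP[_]; rewrite eq_sym => /negPf ->; rewrite mul0r.
  have cut : \sum_(v in U :\ r) \sum_(x in U :\ r) (v \in B)%:R * (~~ d v x)%:R <=
      k%:R * (#|B|%:R - 1) :> R.
    rewrite -sumB mulr_sumr; apply: ler_sum => v _; rewrite -mulr_sumr.
    case: (boolP (v \in B)) => vB; last by rewrite mul0r mulr0.
    by rewrite mul1r mulr1 sum_cut.
  rewrite [X in _ + X <= _]exchange_big /=; move: cut.
  by set Q := \sum_(v in _) _ => cut; lra.
have k0 : 0 <= k%:R :> R by [].
have B1 : 1 <= #|B|%:R :> R by rewrite ler1n card_gt0; apply/set0Pn; exists r; exact: root_ball.
by rewrite natrD natrM; nra.
Qed.

Lemma Ex_gb2_step g U k : 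
  Ex (fun w => #|gb g w U k.+1|%:R ^+ 2) <=
  \sum_(v in U :\ r) \sum_(x in U :\ r | v != x)
     p g ^+ 2 * Ex (fun w => #|gb g w (U :\ v :\ x)%SET k|%:R ^+ 2) +
  (2 * k + 5)%:R * Ex (fun w => #|gb g w U k.+1|%:R).
Proof.
apply: (le_trans (ler_Ex mu_ge0 (fun w => card_gb_sqr g w U k.+1))).
rewrite ExD ExZ (_ : 2 * k.+1 + 3 = 2 * k + 5)%N; last by lia.
rewrite lerD2r Ex_sum; apply: ler_sum => v; rewrite !inE => /andP[vr vU].
rewrite Ex_sum; apply: ler_sum => x; rewrite !inE => /andP[/andP[xr xU] vx].
rewrite -Ex_nbr_gb2 //; apply: ler_Ex => // w.
rewrite -natrM ler_nat (in_gbS g w k vr) ?in_gbS // ?inE ?vx ?xU ?vU //; last by rewrite eq_sym vx.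
rewrite (_ : U :\ x :\ v = U :\ v :\ x)%SET.
  by case: #|nbr _ _ v _| => //= a; case: #|nbr _ _ x _|.
by apply/finset.setP => y; rewrite !inE andbCA.
Qed.

(** The correction is geometric so as to stay bounded in [k]. Passing to [k + 1] adds at most
    [2 (2 k + 5) N^(k+1) <= 10 2^k N^(k+1)], while the right side gains [N^(2k+2) (20 / N) 2^-(k+1)
    = 10 2^-k N^(2k+1)]; the latter is larger because [4^k <= N^k]. *)
Lemma Ex_gb2_le g U k : 4 <= N g ->
  Ex (fun w => #|gb g w U k|%:R ^+ 2) <=
  N g ^+ (2 * k) * (1 + 20 / N g * (1 - 2^-1 ^+ k)).
Proof.
move=> N4; elim: k U => [|k IH] U.
  rewrite muln0 !expr0 subrr mulr0 addr0 mulr1 -[leRHS](@Ex_cst _ (edge n) _ _ mu_sum1); apply: ler_Ex => // w.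
  by rewrite /gb gball0 cards1 expr1n.
apply: (le_trans (Ex_gb2_step _ _ _)).
set X := N g ^+ (2 * k) * _ in IH *.
have N0 : 0 < N g by lra.
have h0 : 0 <= 1 - 2^-1 ^+ k :> R by rewrite subr_ge0 exprn_ile1 // ?invr_ge0 // invf_le1 //; lra.
have a0 : 0 <= 20 / N g by rewrite divr_ge0 // ltW.
have X0 : 0 <= X.
  by apply: mulr_ge0; [rewrite exprn_ge0 // ltW|have := mulr_ge0 a0 h0; lra].
apply: (@le_trans _ _ (N g ^+ 2 * X + (2 * k + 5)%:R * (2 * N g ^+ k.+1))).
  apply: lerD.
    rewrite (_ : N g ^+ 2 * X = #|V|%:R * (#|V|%:R * (p g ^+ 2 * X))); last by ring.
    have pX : 0 <= p g ^+ 2 * X by rewrite mulr_ge0 // exprn_ge0 // prob1_ge0.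
    apply: sum_le_card => [|v _]; first exact: mulr_ge0.
    apply: sum_le_card => // x _.
    by rewrite ler_wpM2l // exprn_ge0 // prob1_ge0.
  rewrite ler_wpM2l //; apply: (le_trans (Ex_gb_le _ _ _)); lra.
have kb : (2 * k + 5)%:R * 2 <= 10 * 2 ^+ k :> R.
  rewrite -natrX -!natrM ler_nat; elim: (k) => // j; rewrite expnS; lia.
have Nk : 4 ^+ k <= N g ^+ k by rewrite lerXn2r ?nnegrE //; lra.
rewrite /X; move: (N g) N0 Nk => M M0 Mk.
have -> : M ^+ (2 * k.+1) * (1 + 20 / M * (1 - 2^-1 ^+ k.+1)) =
  M ^+ 2 * (M ^+ (2 * k) * (1 + 20 / M * (1 - 2^-1 ^+ k))) +
  10 * M * (M ^+ k * 2^-1 ^+ k) * M ^+ k.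
  have -> : M ^+ (2 * k.+1) = M ^+ 2 * (M ^+ k * M ^+ k).
    by rewrite -!exprD; congr (_ ^+ _); lia.
  have -> : M ^+ (2 * k) = M ^+ k * M ^+ k by rewrite -exprD; congr (_ ^+ _); lia.
  by rewrite [2^-1 ^+ k.+1]exprS; set h := 2^-1 ^+ k; set m := M ^+ k; field; lra.
rewrite lerD2l exprS.
have e2 : 2 ^+ k <= M ^+ k * 2^-1 ^+ k.
  rewrite exprVn ler_pdivlMr ?exprn_gt0 // -exprMn; apply: le_trans Mk.
  by rewrite lerXn2r ?nnegrE //; lra.
have Mk0 : 0 <= M * M ^+ k by rewrite mulr_ge0 ?exprn_ge0 // ltW.
nra.
Qed.

(** Second moment method, one vertex at a time: the pair term costs at most [p^2 / 2] times the
    second moment of the ball. Each level deletes one more vertex, whence [k (j + k)], and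
    [2 N^k / |V|] pays for vertices with several neighbours in the ball. *)
Lemma Ex_gb_ge g U k j : 20 <= N g -> (#|~: U| <= j)%N ->
  N g ^+ k * (1 - (k * (j + k))%:R / #|V|%:R - 2 * N g ^+ k / #|V|%:R) <=
  Ex (fun w => #|gb g w U k|%:R).
Proof.
move=> N20; have N0 : 0 < N g by lra.
have V0 : 0 < #|V|%:R :> R by rewrite card_ord.
elim: k U j => [|k IH] U j Uj.
  rewrite mul0n expr0 mul1r mul0r; apply: (@le_trans _ _ 1).
    have : 0 <= 2 / #|V|%:R :> R by rewrite divr_ge0.
    lra.
  rewrite -[leLHS](@Ex_cst _ (edge n) _ _ mu_sum1); apply: ler_Ex => // w.
  by rewrite /gb gball0 cards1.
under eq_Ex do rewrite card_gbE.
rewrite ExD Ex_cst // Ex_sum.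
set y := 1 - (k * (j.+1 + k))%:R / #|V|%:R - 2 * N g ^+ k / #|V|%:R.
have Uv v : (#|~: (U :\ v)| <= j.+1)%N.
  by rewrite finset.setCD finset.setUC cardsU1; case: (_ \notin _); rewrite ?add0n ?add1n ?ltnS ?(leqW Uj).
have low v : v \in (U :\ r)%SET -> p g * (N g ^+ k * y) - p g ^+ 2 * N g ^+ (2 * k) <=
    Ex (fun w => (v \in gb g w U k.+1)%:R).
  rewrite !inE => /andP[vr vU].
  (* Bonferroni: [3 / 2 Y - 1 / 2 Y^2] equals the indicator of [Y > 0] at 0, 1 and 2, and is at most
     0 from 3 on. *)
  apply: (@le_trans _ _ (Ex (fun w =>
     3 / 2 * #|nbr g w v (gb g w (U :\ v)%SET k)|%:R -
     1 / 2 * #|nbr g w v (gb g w (U :\ v)%SET k)|%:R ^+ 2))).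
    rewrite (Ex_mix mu_sum1 (at_vertex v)).
    apply: (@le_trans _ _ (Ex (fun w => p g * #|gb g w (U :\ v)%SET k|%:R -
        1 / 2 * p g ^+ 2 * #|gb g w (U :\ v)%SET k|%:R ^+ 2))).
      rewrite ExB !ExZ; apply: lerB.
        by rewrite ler_wpM2l ?prob1_ge0 //; exact: IH.
      have q0 : 0 <= p g ^+ 2 by rewrite exprn_ge0 ?prob1_ge0.
      have N4 : 4 <= N g by lra.
      have := Ex_gb2_le (U :\ v)%SET k N4.
      have : N g ^+ (2 * k) * (1 + 20 / N g * (1 - 2^-1 ^+ k)) <= N g ^+ (2 * k) * 2.
        rewrite ler_pM2l ?exprn_gt0 //.
        have a1 : 20 / N g <= 1 by rewrite ler_pdivrMr // mul1r.
        have a0 : 0 <= 20 / N g by rewrite divr_ge0 // ltW.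
        have b0 : 0 <= 2^-1 ^+ k :> R by rewrite exprn_ge0 // invr_ge0.
        nra.
      move=> h1 h2; have := ler_wpM2l q0 (le_trans h2 h1); lra.
    apply: ler_Ex => // w.
    under eq_Ex do rewrite nbr_mix gb_mixD1 //.
    have vB := notin_gbD1 g w U k vr.
    have := Ex_nbr2 mu_sum1 g g 0 0 vB vB.
    under eq_Ex do rewrite !addr0 -expr2.
    rewrite finset.setIid !addr0 ExB !ExZ (Ex_nbr mu_sum1 g vB) => ->.
    have -> : prob1 mu (fun t => g t && g t) = p g.
      by apply: eq_bigr => t _; rewrite andbb.
    set s : R := #|gb _ _ _ _|%:R.
    have s0 : 0 <= s by [].
    have := prob1_ge0 g; nra.
  apply: ler_Ex => // w; rewrite in_gbS //; set Y := #|nbr _ _ _ _|.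
  case: Y => [|[|[|m]]] /=; try lra.
  rewrite -(natr1 m.+2) -(natr1 m.+1) -(natr1 m).
  by have : 0 <= m%:R :> R by []; nra.
set c := p g * _ - _ in low.
apply: (@le_trans _ _ (\sum_(v in U :\ r) c)); last first.
  by rewrite -[leLHS]add0r lerD // ler_sum.
rewrite sumr_const; set m := #|(U :\ r)%SET|.
have mV : m%:R <= #|V|%:R :> R by rewrite ler_nat max_card.
have mj : #|V|%:R - j%:R - 1 <= m%:R :> R.
  have : (#|V| <= m + j + 1)%N.
    rewrite -(cardsC U) (cardsD1 r U) -/m (addnC _ m) -!addnA leq_add2l addn1.
    by apply: (@leq_add _ _ 1) => //; exact: leq_b1.
  by rewrite -(ler_nat R) !natrD; lra.
set A := p g * N g ^+ k.
have A0 : 0 <= A by rewrite mulr_ge0 ?prob1_ge0 // exprn_ge0 // ltW.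
have cE : c = A * y - A ^+ 2.
  by rewrite /c /A (mulnC 2) exprM; set m' := N g ^+ k; ring.
have NE : N g ^+ k.+1 = #|V|%:R * A by rewrite /A exprS; ring.
have Vy : #|V|%:R * y = #|V|%:R - (k * (j.+1 + k))%:R - 2 * N g ^+ k.
  by rewrite /y; field; lra.
have y1 : y <= 1.
  have y1 : 0 <= (k * (j.+1 + k))%:R / #|V|%:R :> R by rewrite divr_ge0.
  have y2 : 0 <= 2 * N g ^+ k / #|V|%:R by rewrite divr_ge0 // mulr_ge0 // exprn_ge0 // ltW.
  by rewrite /y; lra.
have VA : 20 * N g ^+ k <= #|V|%:R * A.
  by rewrite -NE exprS ler_wpM2r // exprn_ge0 // ltW.
rewrite [leLHS](_ : _ =
   #|V|%:R * A - (k.+1 * (j + k.+1))%:R * A - 2 * #|V|%:R * A ^+ 2); last first.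
  by rewrite NE; field; lra.
(* [y] may be negative; then having at most [|V|] terms only helps. *)
have mAy : #|V|%:R * (A * y) - (j%:R + 1) * A <= m%:R * (A * y).
  have [y0|y0] := leP 0 y.
    have : 0 <= A * y by rewrite mulr_ge0.
    have : A * y <= A by rewrite -[leRHS]mulr1 ler_wpM2l.
    have : 0 <= j%:R :> R by [].
    nra.
  have : A * y <= 0 by rewrite mulr_ge0_le0 // ltW.
  have : 0 <= j%:R :> R by [].
  nra.
rewrite mulrCA Vy in mAy.
have mA2 : m%:R * A ^+ 2 <= #|V|%:R * A ^+ 2 by rewrite ler_wpM2r // exprn_ge0.
have Nk0 : 0 <= N g ^+ k by rewrite exprn_ge0 // ltW.
have AN : 2 * N g ^+ k * A <= #|V|%:R * A ^+ 2.
  by rewrite expr2 mulrA ler_wpM2r //; lra.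
have kj : (k.+1 * (j + k.+1))%:R = (k * (j.+1 + k))%:R + j%:R + k%:R + 1 :> R.
  have -> : (k.+1 * (j + k.+1) = k * (j.+1 + k) + j + k + 1)%N by clear; lia.
  by rewrite !natrD.
have kA : 0 <= k%:R * A by rewrite mulr_ge0.
rewrite -mulr_natl cE kj; move: mAy; set K := (k * _)%:R.
nra.
Qed.

(** Mean square of the normalised size minus one: the second moment bound [1 + 20 / x], minus twice
    the lower bound of the mean, plus 1. *)
Definition gb_err k j (x : R) : R :=
  20 / x + 2 * (k * (j + k))%:R / #|V|%:R + 4 * x ^+ k / #|V|%:R.

Lemma gb_conc g U k j : 20 <= N g -> (#|~: U| <= j)%N ->
  Ex (fun w => `|#|gb g w U k|%:R / N g ^+ k - 1|) <= Num.sqrt (gb_err k j (N g)).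
Proof.
move=> N20 Uj; apply: Ex_norm_sqrt => //.
have N0 : 0 < N g by lra.
have Nk0 : 0 < N g ^+ k by rewrite exprn_gt0.
rewrite (@eq_Ex _ _ _ _ _ (fun w => (N g ^+ k)^-1 ^+ 2 * #|gb g w U k|%:R ^+ 2 +
   (- (2 * (N g ^+ k)^-1) * #|gb g w U k|%:R + 1))); last by move=> w; ring.
rewrite !ExD !ExZ Ex_cst //.
have N4 : 4 <= N g by lra.
have h2 : (N g ^+ k)^-1 ^+ 2 * Ex (fun w => #|gb g w U k|%:R ^+ 2) <= 1 + 20 / N g.
  rewrite exprVn mulrC ler_pdivrMr ?exprn_gt0 //.
  apply: (le_trans (Ex_gb2_le U k N4)).
  rewrite [leLHS]mulrC (mulnC 2) exprM; apply: ler_wpM2r; first exact: sqr_ge0.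
  have b0 : 0 <= 2^-1 ^+ k :> R by rewrite exprn_ge0 // invr_ge0.
  have a0 : 0 <= 20 / N g by rewrite divr_ge0 // ltW.
  nra.
have h1 : 1 - (k * (j + k))%:R / #|V|%:R - 2 * N g ^+ k / #|V|%:R <=
   (N g ^+ k)^-1 * Ex (fun w => #|gb g w U k|%:R).
  by rewrite [leRHS]mulrC ler_pdivlMr // mulrC Ex_gb_ge.
have -> : - (2 * (N g ^+ k)^-1) * Ex (fun w => #|gb g w U k|%:R) =
  - 2 * ((N g ^+ k)^-1 * Ex (fun w => #|gb g w U k|%:R)) by ring.
move: h1 h2; set E1 := _^-1 * _; set E2 := _ * Ex _; rewrite /gb_err.
set c := (k * _)%:R; move: (N g ^+ k) (#|V|%:R^-1) (20 / N g) => d v e h1 h2.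
by lra.
Qed.

End gball_moments.

(** * Poisson expectations and Le Cam's inequality *)

Section poisson_expectation.
Context {R : realType}.
Implicit Types (th et d : R) (f g : nat -> R).

Definition pois th k : R := th ^+ k / k`!%:R * expR (- th).

(** The series is taken in the extended reals: for values in the unit interval its terms are
    nonnegative, so sums can be interchanged freely and [fine] loses nothing. *)
Definition Poi th f : R := fine (\sum_(0 <= k <oo) (pois th k * f k)%:E).

Definition unit_valued f := forall k, 0 <= f k <= 1.

Lemma pois_ge0 th k : 0 <= th -> 0 <= pois th k.
Proof. by move=> th0; rewrite mulr_ge0 ?expR_ge0 // divr_ge0 // exprn_ge0. Qed.

Lemma pois_sum1 th : 0 <= th -> (\sum_(0 <= k <oo) (pois th k)%:E = 1)%E.
Proof.
move=> th0; under eq_eseriesr do rewrite /pois mulrC EFinM.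
rewrite nneseriesZl; last by move=> k _; rewrite lee_fin divr_ge0 // exprn_ge0.
transitivity ((expR (- th))%:E * (expR th)%:E)%E; last first.
  by rewrite -EFinM expRN mulVf ?gt_eqF ?expR_gt0.
congr (_ * _)%E; rewrite expRE -EFin_lim; last first.
  by rewrite /pseries/=; under eq_fun do rewrite mulrC; exact: is_cvg_series_exp_coeff.
apply/congr_lim/funext => n/=; rewrite /pseries/= /series/= -sumEFin//.
by under eq_bigr do rewrite mulrC.
Qed.

Lemma pois_term_ge0 th f k : 0 <= th -> unit_valued f -> (0 <= (pois th k * f k)%:E)%E.
Proof. by move=> th0 f01; rewrite lee_fin mulr_ge0 ?pois_ge0 //; case/andP: (f01 k). Qed.

Lemma Poi_series th f : 0 <= th -> unit_valued f ->
  (\sum_(0 <= k <oo) (pois th k * f k)%:E = (Poi th f)%:E)%E.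
Proof.
move=> th0 f01; rewrite /Poi fineK // ge0_fin_numE; last first.
  by apply: nneseries_ge0 => k _ _; exact: pois_term_ge0.
apply: (@le_lt_trans _ _ 1%E); last exact: ltry.
rewrite -(pois_sum1 th0); apply: lee_nneseries => k *; first exact: pois_term_ge0.
by rewrite lee_fin -[leRHS]mulr1 ler_wpM2l ?pois_ge0 //; case/andP: (f01 k).
Qed.

Lemma eq_Poi th f g : f =1 g -> Poi th f = Poi th g.
Proof. by move=> /funext ->. Qed.

Lemma Poi_ge0 th f : 0 <= th -> unit_valued f -> 0 <= Poi th f.
Proof.
move=> th0 f01; rewrite -lee_fin -Poi_series //; apply: nneseries_ge0 => k _ _.
exact: pois_term_ge0.
Qed.

Lemma Poi_leD th f g e : 0 <= th -> 0 <= e -> unit_valued f -> unit_valued g ->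
  (forall k, f k <= g k + e) -> Poi th f <= Poi th g + e.
Proof.
move=> th0 e0 f01 g01 fg; rewrite -lee_fin EFinD -!Poi_series //.
rewrite -[e%:E]mule1 -(pois_sum1 th0) -nneseriesZl; last first.
  by move=> k _; rewrite lee_fin pois_ge0.
rewrite -nneseriesD; last 2 first.
- by move=> k _ _; exact: pois_term_ge0.
- by move=> k _ _; rewrite -EFinM lee_fin mulr_ge0 ?pois_ge0.
apply: lee_nneseries => k *; first exact: pois_term_ge0.
rewrite -EFinM -EFinD lee_fin (mulrC e) -mulrDr ler_wpM2l ?pois_ge0 //.
Qed.

Lemma Poi_cst1 th : 0 <= th -> Poi th (fun=> 1) = 1.
Proof.
move=> th0; apply: EFin_inj; rewrite -Poi_series //; last by move=> k; rewrite ler01 lexx.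
by rewrite -(pois_sum1 th0); apply: eq_eseriesr => k _; rewrite mulr1.
Qed.

Lemma Poi_unit th f : 0 <= th -> unit_valued f -> 0 <= Poi th f <= 1.
Proof.
move=> th0 f01; rewrite Poi_ge0 //= -[leRHS]addr0 -(Poi_cst1 th0).
apply: Poi_leD => // k; first by rewrite ler01 lexx.
by rewrite addr0; case/andP: (f01 k).
Qed.

Lemma Poi_dist th f g e : 0 <= th -> 0 <= e -> unit_valued f -> unit_valued g ->
  (forall k, `|f k - g k| <= e) -> `|Poi th f - Poi th g| <= e.
Proof.
move=> th0 e0 f01 g01 fg; rewrite ler_distl lerBlDr; apply/andP; split.
  by apply: Poi_leD => // k; have := fg k; rewrite ler_distl => /andP[]; lra.
by apply: Poi_leD => // k; have := fg k; rewrite ler_distl => /andP[].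
Qed.

Lemma Poi_exchange th et (h : nat -> nat -> R) : 0 <= th -> 0 <= et ->
  (forall i, unit_valued (h i)) ->
  Poi th (fun i => Poi et (h i)) = Poi et (fun j => Poi th (h^~ j)).
Proof.
move=> th0 et0 h01; have h01' j : unit_valued (h^~ j) by move=> i; exact: h01.
have u1 : unit_valued (fun i => Poi et (h i)) by move=> i; exact: Poi_unit.
have u2 : unit_valued (fun j => Poi th (h^~ j)) by move=> j; exact: Poi_unit.
apply: EFin_inj; rewrite -!Poi_series //.
transitivity (\sum_(0 <= i <oo) \sum_(0 <= j <oo)
    (pois th i * (pois et j * h i j))%:E)%E.
  apply: eq_eseriesr => i _; rewrite EFinM -Poi_series // -nneseriesZl //.
  by move=> j _; exact: pois_term_ge0.
rewrite nneseries_interchange; last first.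
  move=> i j; rewrite lee_fin; apply: mulr_ge0; first exact: pois_ge0.
  by apply: mulr_ge0; [exact: pois_ge0|case/andP: (h01 i j)].
apply: eq_eseriesr => j _; rewrite EFinM -Poi_series // -nneseriesZl; last first.
  by move=> i _; exact: (pois_term_ge0 i th0 (h01' j)).
by apply: eq_eseriesr => i _; rewrite -EFinM; congr EFin; ring.
Qed.

Lemma pois_conv th et m :
  pois (th + et) m = \sum_(0 <= i < m.+1) pois th i * pois et (m - i)%N.
Proof.
rewrite big_mkord /pois opprD expRD addrC exprDn mulr_suml mulr_suml.
apply: eq_bigr => i _; have im : (i <= m)%N by rewrite -ltnS.
rewrite -mulr_natr -(bin_fact im) !natrM.
have f0 k : k`!%:R != 0 :> R by rewrite pnatr_eq0 -lt0n fact_gt0.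
have b0 : 'C(m, i)%:R != 0 :> R by rewrite pnatr_eq0 -lt0n bin_gt0.
by field; rewrite !f0 b0.
Qed.

Lemma Poi_conv th et f : 0 <= th -> 0 <= et -> unit_valued f ->
  Poi (th + et) f = Poi th (fun i => Poi et (fun j => f (i + j)%N)).
Proof.
move=> th0 et0 f01; have te0 : 0 <= th + et by rewrite addr_ge0.
have f01' i : unit_valued (fun j => f (i + j)%N) by move=> j; exact: f01.
have u1 : unit_valued (fun i => Poi et (fun j => f (i + j)%N)) by move=> i; exact: Poi_unit.
apply: EFin_inj; rewrite -!Poi_series //.
(* Substitution [m = i + j]. Extending by 0 to [i > m] lets both sums range over all natural
   numbers, so that they can be interchanged. *)
pose a i m : \bar R := if (i <= m)%N then (pois th i * (pois et (m - i)%N * f m))%:E else 0%E.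
have a0 i m : (0 <= a i m)%E.
  rewrite /a; case: ifP => // _; rewrite lee_fin; apply: mulr_ge0; first exact: pois_ge0.
  by apply: mulr_ge0; [exact: pois_ge0|case/andP: (f01 m)].
transitivity (\sum_(0 <= i <oo) \sum_(0 <= m <oo) a i m)%E; last first.
  apply: eq_eseriesr => i _; rewrite EFinM -Poi_series // -nneseriesZl; last first.
    by move=> j _; exact: (pois_term_ge0 j et0 (f01' i)).
  rewrite (nneseries_split 0 i) // add0n big_nat big1 ?add0e; last first.
    by move=> m /andP[_ mi]; rewrite /a leqNgt mi.
  rewrite -nneseries_addn //; apply: eq_eseriesr => j _.
  by rewrite /a leq_addl addnK addnC.
rewrite nneseries_interchange //; apply: eq_eseriesr => m _.
rewrite (nneseries_split 0 m.+1) // add0n [X in (_ + X)%E]eseries0; last first.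
  by move=> i mi _; rewrite /a leqNgt mi.
rewrite adde0 pois_conv mulr_suml -sumEFin big_nat [RHS]big_nat; apply: eq_bigr => i /andP[_ im].
by rewrite /a -ltnS im mulrA.
Qed.

Lemma Poi_split2 d f : 0 <= d -> unit_valued f ->
  expR (- d) * f 0%N + d * expR (- d) * f 1%N <= Poi d f <=
  expR (- d) * f 0%N + d * expR (- d) * f 1%N + (1 - expR (- d) - d * expR (- d)).
Proof.
move=> d0 f01.
have sp (h : nat -> R) : (forall k, 0 <= h k) -> (\sum_(0 <= k <oo) (pois d k * h k)%:E =
   (expR (- d) * h 0%N + d * expR (- d) * h 1%N)%:E + \sum_(2 <= k <oo) (pois d k * h k)%:E)%E.
  move=> h0; rewrite (nneseries_split 0 2); last by move=> k _; rewrite lee_fin mulr_ge0 ?pois_ge0.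
  congr (_ + _)%E; rewrite add0n big_nat_recr //= big_nat_recr //= big_geq // add0r -EFinD.
  by congr EFin; rewrite /pois fact0 expr0 expr1 !divr1 mul1r.
set t := (\sum_(2 <= k <oo) (pois d k * f k)%:E)%E.
have t0 : (0 <= t)%E by apply: nneseries_ge0 => k _ _; exact: pois_term_ge0.
have f0 k : 0 <= f k by case/andP: (f01 k).
have := Poi_series d0 f01; rewrite sp // -/t => Pf.
have h1 : (\sum_(0 <= k <oo) (pois d k * 1)%:E = 1)%E.
  by rewrite -(pois_sum1 d0); apply: eq_eseriesr => k _; rewrite mulr1.
rewrite (sp (fun=> 1)) // !mulr1 in h1.
set t1 := (\sum_(2 <= k <oo) (pois d k * 1)%:E)%E in h1.
have tt1 : (t <= t1)%E.
  apply: lee_nneseries => k *; first exact: pois_term_ge0.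
  by rewrite lee_fin ler_wpM2l ?pois_ge0 //; case/andP: (f01 k).
move: t t1 t0 Pf h1 tt1 => [t| |] [t1| |] //=.
by rewrite !lee_fin => t0 [Pf] [h1] tt1; apply/andP; split; lra.
Qed.

Lemma Poi_head d f : 0 <= d -> unit_valued f -> `|Poi d f - f 0%N| <= d.
Proof.
move=> d0 f01; have /andP[lo hi] := Poi_split2 d0 f01.
have /andP[a0 a1] := f01 0%N; have /andP[b0 b1] := f01 1%N.
have e1 := expR_ge1Dx (- d); have e0 := expR_gt0 (- d).
have e2 : expR (- d) <= 1 by rewrite -expR0 ler_expR; lra.
have de : 0 <= d * expR (- d) by rewrite mulr_ge0 // ltW.
by rewrite ler_distl; apply/andP; split; nra.
Qed.

(** Comparison with the Bernoulli law of the same mean: the Poisson law moves the mass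
    [d (1 - exp (- d)) <= d^2] from 1 to 0 and to values beyond 1. *)
Lemma Poi_linear d f : 0 <= d -> unit_valued f ->
  `|Poi d f - ((1 - d) * f 0%N + d * f 1%N)| <= d ^+ 2.
Proof.
move=> d0 f01; have /andP[lo hi] := Poi_split2 d0 f01.
have /andP[a0 a1] := f01 0%N; have /andP[b0 b1] := f01 1%N.
have e1 := expR_ge1Dx (- d).
have e2 : expR (- d) <= 1 by rewrite -expR0 ler_expR; lra.
set e := expR (- d) in lo hi e1 e2.
have h1 : d * (1 - e) <= d ^+ 2 by rewrite expr2 ler_wpM2l //; lra.
have h2 : 0 <= d * (1 - e) by rewrite mulr_ge0 //; lra.
have h3 : d * (1 - e) * f 1%N <= d * (1 - e) by rewrite -[leRHS]mulr1 ler_wpM2l.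
have h4 : 0 <= d * (1 - e) * f 1%N by rewrite mulr_ge0.
have h5 : (e - 1 + d) * f 0%N <= e - 1 + d by rewrite -[leRHS]mulr1 ler_wpM2l //; lra.
have h6 : 0 <= (e - 1 + d) * f 0%N by rewrite mulr_ge0 //; lra.
by rewrite ler_distl; apply/andP; split; lra.
Qed.

(** Coupling: the larger variable is the smaller one plus an independent Poisson variable whose
    parameter is the difference, and which is nonzero with at most that probability. *)
Lemma Poi_lip th et f : 0 <= th -> 0 <= et -> unit_valued f ->
  `|Poi th f - Poi et f| <= `|th - et|.
Proof.
wlog le : th et / th <= et.
  move=> H th0 et0 f01; have [h|h] := leP th et; first exact: H.
  by rewrite distrC (distrC th) H // ltW.
move=> th0 et0 f01; rewrite distrC (distrC th).
have d0 : 0 <= et - th by rewrite subr_ge0.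
have f01' i : unit_valued (fun j => f (i + j)%N) by move=> j; exact: f01.
rewrite (ger0_norm d0) -{1}(subrKC th et) Poi_conv //.
apply: Poi_dist => // i; first exact: Poi_unit.
by have := Poi_head d0 (f01' i); rewrite addn0.
Qed.

Lemma Poi_eq0 th : 0 <= th -> Poi th (fun k => (k == 0%N)%:R) = expR (- th).
Proof.
move=> th0; have f01 : unit_valued (fun k => (k == 0%N)%:R) by move=> [|k]; rewrite /= ?ler01 ?lexx.
apply: EFin_inj; rewrite -Poi_series // (nneseries_split 0 1); last first.
  by move=> k _; exact: (pois_term_ge0 k th0 f01).
rewrite add0n big_nat_recr //= big_geq // add0e [X in (_ + X)%E]eseries0 ?adde0.
  by rewrite /pois fact0 expr0 divr1 mul1r mulr1.
by move=> [//|k] _ _; rewrite mulr0.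
Qed.

End poisson_expectation.

(** * Triples of independent Poisson variables *)

Section poisson3.
Context {R : realType}.
Implicit Types (a b c : R) (F G : nat -> nat -> nat -> R).

Definition unit_valued3 F := forall i j k, 0 <= F i j k <= 1.

Definition Poi3 a b c F : R := Poi a (fun i => Poi b (fun j => Poi c (F i j))).

Lemma Poi3_unit a b c F : 0 <= a -> 0 <= b -> 0 <= c -> unit_valued3 F ->
  0 <= Poi3 a b c F <= 1.
Proof.
move=> a0 b0 c0 F01; apply: Poi_unit => // i; apply: Poi_unit => // j.
by apply: Poi_unit => // k; exact: F01.
Qed.

Lemma Poi3_conv a b c a' b' c' F : 0 <= a -> 0 <= b -> 0 <= c ->
  0 <= a' -> 0 <= b' -> 0 <= c' -> unit_valued3 F ->
  Poi3 (a + a') (b + b') (c + c') F =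
  Poi3 a b c (fun i j k => Poi3 a' b' c'
    (fun i' j' k' => F (i + i')%N (j + j')%N (k + k')%N)).
Proof.
move=> a0 b0 c0 a'0 b'0 c'0 F01; rewrite /Poi3.
have bb' : 0 <= b + b' by rewrite addr_ge0.
have cc' : 0 <= c + c' by rewrite addr_ge0.
have U1 i j : unit_valued (F i j) by move=> k; exact: F01.
have U2 i : unit_valued (fun j => Poi (c + c') (F i j)) by move=> j; exact: Poi_unit.
have U3 : unit_valued (fun i => Poi (b + b') (fun j => Poi (c + c') (F i j))).
  by move=> i; exact: Poi_unit.
have U4 i' j j' k : unit_valued (fun k' => F i' (j + j')%N (k + k')%N) by move=> k'; exact: F01.
have U5 i' j k : unit_valued (fun j' => Poi c' (fun k' => F i' (j + j')%N (k + k')%N)).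
  by move=> j'; exact: Poi_unit.
have U6 i' j : unit_valued (fun k => Poi b' (fun j' => Poi c' (fun k' => F i' (j + j')%N (k + k')%N))).
  by move=> k; exact: Poi_unit.
have U7 i' : unit_valued (fun j => Poi c (fun k => Poi b' (fun j' => Poi c' (fun k' =>
    F i' (j + j')%N (k + k')%N)))).
  by move=> j; exact: Poi_unit.
rewrite (Poi_conv a0 a'0 U3); apply: eq_Poi => i.
transitivity (Poi a' (fun i' => Poi b (fun j => Poi c (fun k => Poi b' (fun j' => Poi c' (fun k' =>
    F (i + i')%N (j + j')%N (k + k')%N)))))).
  apply: eq_Poi => i'; rewrite (Poi_conv b0 b'0 (U2 (i + i')%N)); apply: eq_Poi => j.
  rewrite (Poi_exchange c0 b'0 (U5 (i + i')%N j)); apply: eq_Poi => j'.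
  exact: (Poi_conv c0 c'0 (U1 (i + i')%N (j + j')%N)).
rewrite (Poi_exchange a'0 b0 (fun i' => U7 (i + i')%N)); apply: eq_Poi => j.
exact: (Poi_exchange a'0 c0 (fun i' => U6 (i + i')%N j)).
Qed.

Lemma Poi3_lip a b c a' b' c' F : 0 <= a -> 0 <= b -> 0 <= c ->
  0 <= a' -> 0 <= b' -> 0 <= c' -> unit_valued3 F ->
  `|Poi3 a b c F - Poi3 a' b' c' F| <= `|a - a'| + `|b - b'| + `|c - c'|.
Proof.
move=> a0 b0 c0 a'0 b'0 c'0 F01; rewrite /Poi3.
have U1 i j : unit_valued (F i j) by move=> k; exact: F01.
have U2 e (e0 : 0 <= e) i : unit_valued (fun j => Poi e (F i j)) by move=> j; exact: Poi_unit.
have U3 e e' (e0 : 0 <= e) (e0' : 0 <= e') : unit_valued (fun i => Poi e' (fun j => Poi e (F i j))).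
  by move=> i; apply: Poi_unit => //; exact: U2.
apply: (le_trans (ler_distD (Poi a' (fun i => Poi b (fun j => Poi c (F i j)))) _ _)).
rewrite -addrA; apply: lerD; first exact: (Poi_lip a0 a'0 (U3 _ _ c0 b0)).
apply: Poi_dist; [exact: a'0|by rewrite addr_ge0|exact: U3|exact: U3|move=> i].
apply: (le_trans (ler_distD (Poi b' (fun j => Poi c (F i j))) _ _)).
apply: lerD; first exact: (Poi_lip b0 b'0 (U2 _ c0 i)).
apply: Poi_dist; [exact: b'0|exact: normr_ge0|exact: U2|exact: U2|move=> j].
exact: (Poi_lip c0 c'0 (U1 i j)).
Qed.

(** Each variable is replaced by a Bernoulli one at the cost of its squared parameter; then outcomes
    with two or more ones are discarded at the cost [2 (a b + b c + a c)]. The costs add up to the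
    square of the sum. *)
Lemma Poi3_linear a b c F : 0 <= a <= 1 -> 0 <= b <= 1 -> 0 <= c <= 1 -> unit_valued3 F ->
  `|Poi3 a b c F - ((1 - a - b - c) * F 0%N 0%N 0%N + a * F 1%N 0%N 0%N +
     b * F 0%N 1%N 0%N + c * F 0%N 0%N 1%N)| <= (a + b + c) ^+ 2.
Proof.
move=> /andP[a0 a1] /andP[b0 b1] /andP[c0 c1] F01.
pose h i j := (1 - c) * F i j 0%N + c * F i j 1%N.
have h01 i j : 0 <= h i j <= 1.
  have /andP[? ?] := F01 i j 0%N; have /andP[? ?] := F01 i j 1%N.
  by rewrite /h; apply/andP; split; nra.
pose m i := (1 - b) * h i 0%N + b * h i 1%N.
have m01 i : 0 <= m i <= 1.
  have /andP[? ?] := h01 i 0%N; have /andP[? ?] := h01 i 1%N.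
  by rewrite /m; apply/andP; split; nra.
have U1 i j : unit_valued (F i j) by move=> k; exact: F01.
have U2 i : unit_valued (fun j => Poi c (F i j)) by move=> j; exact: Poi_unit.
have U3 : unit_valued (fun i => Poi b (fun j => Poi c (F i j))) by move=> i; exact: Poi_unit.
have d1 : `|Poi3 a b c F - Poi a m| <= b ^+ 2 + c ^+ 2.
  apply: Poi_dist; [exact: a0|by rewrite addr_ge0 ?sqr_ge0|exact: U3|exact: m01|].
  move=> i; apply: (le_trans (ler_distD (Poi b (h i)) _ _)); rewrite addrC; apply: lerD.
    exact: (Poi_linear b0 (h01 i)).
  apply: Poi_dist; [exact: b0|exact: sqr_ge0|exact: U2|exact: h01|move=> j].
  exact: (Poi_linear c0 (U1 i j)).
have d2 := Poi_linear a0 m01.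
set L := (1 - a - b - c) * _ + _ + _ + _.
have d3 : `|(1 - a) * m 0%N + a * m 1%N - L| <= 2 * (a * b + b * c + a * c).
  rewrite /m /h /L.
  have /andP[] := F01 0%N 0%N 0%N; have /andP[] := F01 1%N 0%N 0%N.
  have /andP[] := F01 0%N 1%N 0%N; have /andP[] := F01 0%N 0%N 1%N.
  have /andP[] := F01 1%N 1%N 0%N; have /andP[] := F01 1%N 0%N 1%N.
  have /andP[] := F01 0%N 1%N 1%N; have /andP[] := F01 1%N 1%N 1%N.
  move: (F 0 0 0)%N (F 1 0 0)%N (F 0 1 0)%N (F 0 0 1)%N (F 1 1 0)%N (F 1 0 1)%N
    (F 0 1 1)%N (F 1 1 1)%N => f0 f1 f2 f3 f12 f13 f23 f123 *.
  have ab : 0 <= a * b by rewrite mulr_ge0.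
  have bc : 0 <= b * c by rewrite mulr_ge0.
  have ac : 0 <= a * c by rewrite mulr_ge0.
  have abc : 0 <= a * b * c by rewrite mulr_ge0.
  have abc1 : a * b * c <= a * b by rewrite -[leRHS]mulr1 ler_wpM2l.
  have abc2 : a * b * c <= b * c by rewrite -mulrA -[leRHS]mul1r ler_wpM2r.
  have abc3 : a * b * c <= a * c by rewrite mulrAC -[leRHS]mulr1 ler_wpM2l.
  have bnd x y : 0 <= x -> 0 <= y <= 1 -> 0 <= x * y <= x.
    by move=> x0 /andP[y0 y1]; rewrite mulr_ge0 //= -[leRHS]mulr1 ler_wpM2l.
  have bd (x y : R) : 0 <= x -> 0 <= y -> y <= 1 -> 0 <= x * y /\ x * y <= x.
    by move=> x0 y0 y1; apply/andP/bnd => //; rewrite y0.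
  have [? ?] : 0 <= (a * b + b * c + a * c - a * b * c) * f0 /\
      (a * b + b * c + a * c - a * b * c) * f0 <= a * b + b * c + a * c - a * b * c by apply: bd => //; lra.
  have [? ?] : 0 <= (a * b + a * c - a * b * c) * f1 /\
      (a * b + a * c - a * b * c) * f1 <= a * b + a * c - a * b * c by apply: bd => //; lra.
  have [? ?] : 0 <= (a * b + b * c - a * b * c) * f2 /\
      (a * b + b * c - a * b * c) * f2 <= a * b + b * c - a * b * c by apply: bd => //; lra.
  have [? ?] : 0 <= (a * c + b * c - a * b * c) * f3 /\
      (a * c + b * c - a * b * c) * f3 <= a * c + b * c - a * b * c by apply: bd => //; lra.
  have [? ?] : 0 <= (a * b - a * b * c) * f12 /\ (a * b - a * b * c) * f12 <= a * b - a * b * c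
    by apply: bd => //; lra.
  have [? ?] : 0 <= (a * c - a * b * c) * f13 /\ (a * c - a * b * c) * f13 <= a * c - a * b * c
    by apply: bd => //; lra.
  have [? ?] : 0 <= (b * c - a * b * c) * f23 /\ (b * c - a * b * c) * f23 <= b * c - a * b * c
    by apply: bd => //; lra.
  have [? ?] : 0 <= (a * b * c) * f123 /\ (a * b * c) * f123 <= a * b * c by apply: bd => //; lra.
  (* The positive coefficients and the negative ones each have total size
     [2 (a b + b c + a c) - 3 a b c]. *)
  set X := _ - _; have -> : X = (a * b + b * c + a * c - a * b * c) * f0
     - (a * b + a * c - a * b * c) * f1 - (a * b + b * c - a * b * c) * f2
     - (a * c + b * c - a * b * c) * f3 + (a * b - a * b * c) * f12 + (a * c - a * b * c) * f13
     + (b * c - a * b * c) * f23 + (a * b * c) * f123 by rewrite /X; ring.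
  by rewrite ler_norml; apply/andP; split; lra.
have -> : (a + b + c) ^+ 2 = b ^+ 2 + c ^+ 2 + (a ^+ 2 + 2 * (a * b + b * c + a * c)) by ring.
apply: (le_trans (ler_distD (Poi a m) _ _)); apply: lerD; first exact: d1.
apply: (le_trans (ler_distD ((1 - a) * m 0%N + a * m 1%N) _ _)); exact: lerD.
Qed.

End poisson3.

(** * Le Cam's inequality with three exclusive outcomes *)

Section le_cam.
Context {R : realType} {E T : finType} (mu : T -> R).
Hypothesis mu_ge0 : forall t, 0 <= mu t.
Hypothesis mu_sum1 : \sum_t mu t = 1.
Notation Ex := (@Ex R E T mu).
Variables x y z : E -> T -> bool.
Hypothesis xyz : forall s t, (x s t + y s t + z s t <= 1)%N.

Let rate (u : E -> T -> bool) s : R := expect1 mu (fun t => (u s t)%:R).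

Let rate01 u s : 0 <= rate u s <= 1.
Proof.
apply/andP; split; first by apply: sumr_ge0 => t _; rewrite mulr_ge0.
rewrite -mu_sum1; apply: ler_sum => t _; rewrite -[leRHS]mulr1 ler_wpM2l //.
by case: (u s t).
Qed.

Let sum_rate_ge0 u (es : seq E) : 0 <= \sum_(s <- es) rate u s.
Proof. by apply: sumr_ge0 => s _; case/andP: (rate01 u s). Qed.

Let expect1_xyz s (G : nat -> nat -> nat -> R) :
  expect1 mu (fun t => G (x s t) (y s t) (z s t)) =
  (1 - rate x s - rate y s - rate z s) * G 0%N 0%N 0%N + rate x s * G 1%N 0%N 0%N +
  rate y s * G 0%N 1%N 0%N + rate z s * G 0%N 0%N 1%N.
Proof.
rewrite /rate /expect1 -[X in X - _ - _ - _]mu_sum1 -!sumrB !mulr_suml -!big_split /=.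
apply: eq_bigr => t _; have := xyz s t.
by case: (x s t); case: (y s t); case: (z s t) => //= _; rewrite ?mulr0n ?mulr1n; ring.
Qed.

(** The head coordinate is integrated first and its outcome moves into the offsets [i], [j], [k], so
    the induction hypothesis applies to the tail for every outcome. By [xyz] the head has a
    four-point law, which [Poi3_linear] compares with three Poisson variables; additivity of Poisson
    parameters merges them with the tail. *)
Lemma le_cam (es : seq E) F i j k : uniq es -> unit_valued3 F ->
  `|Ex (fun w => F (i + \sum_(s <- es) x s (w s))%N (j + \sum_(s <- es) y s (w s))%N
                   (k + \sum_(s <- es) z s (w s))%N) -
    Poi3 (\sum_(s <- es) expect1 mu (fun t => (x s t)%:R))
         (\sum_(s <- es) expect1 mu (fun t => (y s t)%:R))
         (\sum_(s <- es) expect1 mu (fun t => (z s t)%:R))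
      (fun i' j' k' => F (i + i')%N (j + j')%N (k + k')%N)| <=
  \sum_(s <- es) (expect1 mu (fun t => (x s t)%:R) + expect1 mu (fun t => (y s t)%:R) +
     expect1 mu (fun t => (z s t)%:R)) ^+ 2.
Proof.
rewrite -!/(rate _ _); move=> ues F01; elim: es i j k ues => [|s es IH] i j k.
  move=> _; rewrite !big_nil.
  have -> : Ex (fun w => F (i + \sum_(s <- [::]) x s (w s))%N (j + \sum_(s <- [::]) y s (w s))%N
                   (k + \sum_(s <- [::]) z s (w s))%N) = F i j k.
    by rewrite -[RHS](@Ex_cst _ E _ _ mu_sum1); apply: eq_Ex => w; rewrite !big_nil !addn0.
  have z1 : 0 <= (0 : R) <= 1 by rewrite lexx ler01.
  have := Poi3_linear z1 z1 z1 (fun i' j' k' => F01 (i + i')%N (j + j')%N (k + k')%N).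
  by rewrite !addn0 !mul0r !addr0 !subr0 mul1r expr0n /= distrC.
move=> /= /andP[ses ues].
pose f t (w : {ffun E -> T}) := F (i + x s t + \sum_(s <- es) x s (w s))%N
  (j + y s t + \sum_(s <- es) y s (w s))%N (k + z s t + \sum_(s <- es) z s (w s))%N.
have -> : Ex (fun w => F (i + \sum_(s <- s :: es) x s (w s))%N (j + \sum_(s <- s :: es) y s (w s))%N
   (k + \sum_(s <- s :: es) z s (w s))%N) = expect1 mu (fun t => Ex (f t)).
  rewrite -(@Ex_split_coord _ _ _ _ mu_sum1 s f); last first.
    move=> t w w' ww'; rewrite /f; congr (F (_ + _) (_ + _) (_ + _))%N;
      by rewrite !big_seq; apply: eq_bigr => s' s'es; rewrite ww' //;
        apply: contraNneq ses => <-.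
  by apply: eq_Ex => w; rewrite /f !big_cons !addnA.
pose G i' j' k' := Poi3 (\sum_(s <- es) rate x s) (\sum_(s <- es) rate y s) (\sum_(s <- es) rate z s)
   (fun i1 j1 k1 => F (i + i' + i1)%N (j + j' + j1)%N (k + k' + k1)%N).
have G01 : unit_valued3 G by move=> i' j' k'; apply: Poi3_unit => // *; exact: F01.
have d1 : `|expect1 mu (fun t => Ex (f t)) - expect1 mu (fun t => G (x s t) (y s t) (z s t))| <=
    \sum_(s <- es) (rate x s + rate y s + rate z s) ^+ 2.
  rewrite /expect1 -sumrB; apply: (le_trans (ler_norm_sum _ _ _)).
  rewrite -[leRHS]mul1r -mu_sum1 mulr_suml; apply: ler_sum => t _.
  rewrite -mulrBr normrM ger0_norm // ler_wpM2l //.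
  by have := IH (i + x s t)%N (j + y s t)%N (k + z s t)%N ues.
rewrite !big_cons.
have -> : Poi3 (rate x s + \sum_(j0 <- es) rate x j0) (rate y s + \sum_(j0 <- es) rate y j0)
    (rate z s + \sum_(j0 <- es) rate z j0) (fun i' j' k' => F (i + i')%N (j + j')%N (k + k')%N) =
  Poi3 (rate x s) (rate y s) (rate z s) G.
  have r0 u s' : 0 <= rate u s' by case/andP: (rate01 u s').
  rewrite (Poi3_conv (r0 x s) (r0 y s) (r0 z s) (sum_rate_ge0 x es) (sum_rate_ge0 y es)
    (sum_rate_ge0 z es) (fun i' j' k' => F01 (i + i')%N (j + j')%N (k + k')%N)).
  apply: eq_Poi => i'; apply: eq_Poi => j'; apply: eq_Poi => k'.
  by apply: eq_Poi => i1; apply: eq_Poi => j1; apply: eq_Poi => k1; rewrite !addnA.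
apply: (le_trans (ler_distD (expect1 mu (fun t => G (x s t) (y s t) (z s t))) _ _)).
rewrite addrC; apply: lerD => //.
by rewrite distrC expect1_xyz; exact: Poi3_linear.
Qed.

End le_cam.

(** * Two graphs *)

Section two_graphs.
Context {R : realType} {n : nat} {T : finType} (mu : T -> R).
Hypothesis mu_ge0 : forall t, 0 <= mu t.
Hypothesis mu_sum1 : \sum_t mu t = 1.
Variables (g h : T -> bool) (p : R).
Hypothesis pg : prob1 mu g = p.
Hypothesis ph : prob1 mu h = p.
Notation V := (vertex n).
Notation r := (origin n).
Notation Ex := (@Ex R (edge n) T mu).
Implicit Types (w : {ffun edge n -> T}) (v x : V) (U S : {set V}).

Let gh t := g t && h t.
Let p11 := prob1 mu gh.
Let N := #|V|%:R * p.

Let p11_ge0 : 0 <= p11. Proof. exact: prob1_ge0. Qed.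
Let p_ge0 : 0 <= p. Proof. by rewrite -pg prob1_ge0. Qed.

Let p11_le : p11 <= p.
Proof.
rewrite -pg; apply: ler_sum => t _; rewrite ler_wpM2l // /gh.
by case: (g t); case: (h t).
Qed.

Let V0 : 0 < #|V|%:R :> R. Proof. by rewrite card_ord. Qed.

Definition gcap w U k : {set V} := (gb g w U k :&: gb h w U k)%SET.

Lemma card_gcapE w U k :
  #|gcap w U k|%:R = 1 + \sum_(v in U :\ r) ((v \in gb g w U k) && (v \in gb h w U k))%:R :> R.
Proof.
rewrite -natr_sum (cardsD1 r) inE !root_ball natrD; congr (_ + _%:R).
rewrite -sum1_card big_mkcond [RHS]big_mkcond /=; apply: eq_bigr => v _.
rewrite !inE; case: eqVneq => //= vr.
case: (boolP (v \in U)) => [vU|vU]; first by case: (_ && _).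
by rewrite (negPf (notin_gb g w k vr vU)).
Qed.

Lemma card_gcap_le w U k : #|gcap w U k|%:R <= #|gb g w U k|%:R :> R.
Proof. by rewrite ler_nat subset_leq_card // subsetIl. Qed.

(** The probability that both counts are positive is at most the mean of their product, to which a
    common vertex contributes [p11] through one edge and other pairs [p^2]. *)
Lemma Ex_gcap_step U k v : v != r -> v \in U ->
  Ex (fun w => ((v \in gb g w U k.+1) && (v \in gb h w U k.+1))%:R) <=
  p ^+ 2 * Ex (fun w => #|gb g w (U :\ v)%SET k|%:R * #|gb h w (U :\ v)%SET k|%:R) +
  p11 * Ex (fun w => #|gcap w (U :\ v)%SET k|%:R).
Proof.
move=> vr vU.
apply: (@le_trans _ _ (Ex (fun w => #|nbr g w v (gb g w (U :\ v)%SET k)|%:R *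
   #|nbr h w v (gb h w (U :\ v)%SET k)|%:R))).
  apply: ler_Ex => // w; rewrite !in_gbS // -natrM ler_nat.
  by case: #|_| => // a; case: #|_|.
rewrite (Ex_mix mu_sum1 (at_vertex v)) -!ExZ -ExD; apply: ler_Ex => // w.
have vB := notin_gbD1 g w U k vr; have vB' := notin_gbD1 h w U k vr.
have := Ex_nbr2 mu_sum1 g h 0 0 vB vB'.
rewrite !addr0 pg ph -/gh -/p11 -/(gcap w (U :\ v)%SET k) => E.
rewrite (@eq_Ex _ _ _ _ _ (fun w' => (#|nbr g w' v (gb g w (U :\ v)%SET k)|%:R + 0) *
   (#|nbr h w' v (gb h w (U :\ v)%SET k)|%:R + 0))); last first.
  by move=> w'; rewrite !nbr_mix !gb_mixD1 // !addr0.
rewrite E; have := p_ge0; have := p11_ge0.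
have : 0 <= #|gcap w (U :\ v)%SET k|%:R :> R by [].
by nra.
Qed.

Lemma Ex_gb2_le2 (f : T -> bool) U k : prob1 mu f = p -> 20 <= N ->
  Ex (fun w => #|gb f w U k|%:R ^+ 2) <= 2 * N ^+ (2 * k).
Proof.
move=> pf N20; have N4 : 4 <= #|V|%:R * prob1 mu f by rewrite pf -/N; lra.
apply: (le_trans (Ex_gb2_le mu_ge0 mu_sum1 U k N4)); rewrite pf -/N [leRHS]mulrC.
apply: ler_wpM2l; first by rewrite exprn_ge0 //; lra.
have a1 : 20 / N <= 1 by rewrite ler_pdivrMr ?mul1r //; lra.
have a0 : 0 <= 20 / N by rewrite divr_ge0 //; lra.
have b0 : 0 <= 2^-1 ^+ k :> R by rewrite exprn_ge0 // invr_ge0.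
by nra.
Qed.

Lemma Ex_gb_le2 (f : T -> bool) U k : prob1 mu f = p -> 20 <= N ->
  Ex (fun w => #|gb f w U k|%:R) <= 2 * N ^+ k.
Proof.
move=> pf N20; have N2 : 2 <= #|V|%:R * prob1 mu f by rewrite pf -/N; lra.
by apply: (le_trans (Ex_gb_le mu_ge0 mu_sum1 U k N2)); rewrite pf -/N; lra.
Qed.

(** In units of [N^(k+1)], a common vertex passed on by a shared edge multiplies the previous bound
    by [rho], and separate edges cost [4 N^(k+1) / |V|]. The latter fits into [8 N^(k+1) / |V|]
    since the previous error [8 N^k / |V|] is at most half of that. The root adds 1 per level, paid
    by the geometric term. *)
Lemma Ex_gcap_le rho U k : 0 <= rho <= 1 -> p11 <= rho * p + p ^+ 2 -> 20 <= N ->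
  Ex (fun w => #|gcap w U k|%:R) <=
  N ^+ k * (rho ^+ k + 2 / N * (1 - 2^-1 ^+ k) + 8 * N ^+ k / #|V|%:R).
Proof.
move=> /andP[rho0 rho1] p11r N20; have N0 : 0 < N by lra.
elim: k U => [|k IH] U.
  rewrite !expr0 subrr mulr0 addr0 mul1r -[leLHS]addr0; apply: lerD; last by rewrite divr_ge0.
  rewrite -[leRHS](@Ex_cst _ (edge n) _ _ mu_sum1); apply: ler_Ex => // w.
  by rewrite /gcap /gb !gball0 finset.setIid cards1.
under eq_Ex do rewrite card_gcapE.
rewrite ExD Ex_cst // Ex_sum.
set Z := rho ^+ k + _ + _ in IH *.
have Nk0 : 0 < N ^+ k by rewrite exprn_gt0.
have Z0 : 0 <= Z.
  rewrite /Z !addr_ge0 ?exprn_ge0 //; last by rewrite divr_ge0 // mulr_ge0 // ltW.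
  rewrite mulr_ge0 ?divr_ge0 ?(ltW N0) // subr_ge0 exprn_ile1 // ?invr_ge0 // invf_le1 //; lra.
(* Origin of the 4: one [2 N^(2k)] bounds the mean product of the ball sizes, another the mean
   common part, which meets the [p^2] in the bound for [p11]. *)
apply: (@le_trans _ _ (1 + #|V|%:R * (rho * p * (N ^+ k * Z) + 4 * (p ^+ 2 * N ^+ (2 * k))))).
  have p20 : 0 <= p ^+ 2 by rewrite exprn_ge0.
  have N2k : 0 <= N ^+ (2 * k) by rewrite exprn_ge0 // ltW.
  rewrite lerD2l; apply: sum_le_card => [|v].
    apply: addr_ge0; first by rewrite !mulr_ge0 // ltW.
    by rewrite !mulr_ge0.
  rewrite !inE => /andP[vr vU]; apply: le_trans (Ex_gcap_step _ vr vU) _.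
  have := IH (U :\ v)%SET; set C := Ex _ => CN.
  have C0 : 0 <= C by apply: Ex_ge0.
  have C2 : C <= 2 * N ^+ (2 * k).
    apply: (@le_trans _ _ (2 * N ^+ k)).
      apply: le_trans (Ex_gb_le2 (U :\ v)%SET k pg N20).
      by apply: ler_Ex => // w; exact: card_gcap_le.
    by apply: ler_wpM2l => //; apply: ler_weXn2l; [lra|rewrite mul2n -addnn leq_addr].
  have Q2 : Ex (fun w => #|gb g w (U :\ v)%SET k|%:R * #|gb h w (U :\ v)%SET k|%:R) <= 2 * N ^+ (2 * k).
    have G := Ex_gb2_le2 (U :\ v)%SET k pg N20; have H := Ex_gb2_le2 (U :\ v)%SET k ph N20.
    apply: (@le_trans _ _ (2^-1 * (Ex (fun w => #|gb g w (U :\ v)%SET k|%:R ^+ 2) +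
       Ex (fun w => #|gb h w (U :\ v)%SET k|%:R ^+ 2)))); last by lra.
    rewrite -ExD -ExZ; apply: ler_Ex => // w.
    move: (#|_|%:R) (#|_|%:R) => a b.
    by have := sqr_ge0 (a - b); rewrite sqrrB; nra.
  have t1 : p11 * C <= (rho * p + p ^+ 2) * C by rewrite ler_wpM2r.
  have t2 : rho * p * C <= rho * p * (N ^+ k * Z) by rewrite ler_wpM2l // mulr_ge0.
  have t3 : p ^+ 2 * C <= p ^+ 2 * (2 * N ^+ (2 * k)) by rewrite ler_wpM2l.
  have t4 := ler_wpM2l p20 Q2.
  by lra.
have e1 : 1 <= N ^+ k * 2^-1 ^+ k by rewrite -exprMn exprn_ege1 //; lra.
have NE : #|V|%:R * (p ^+ 2 * N ^+ (2 * k)) = N ^+ k.+1 * (N ^+ k.+1 / #|V|%:R).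
  by rewrite (mulnC 2) exprM !exprS /N; set y := (_ * p) ^+ k; field; rewrite gt_eqF.
have rE : #|V|%:R * (rho * p * (N ^+ k * Z)) = N ^+ k.+1 * (rho * Z).
  by rewrite exprS /N; ring.
rewrite mulrDr rE (mulrCA _ 4) NE.
have NV0 : 0 <= N ^+ k / #|V|%:R by rewrite divr_ge0 // ltW.
have NV : 8 * (N ^+ k / #|V|%:R) <= 4 * (N ^+ k.+1 / #|V|%:R).
  rewrite exprS -mulrA; nra.
have rZ : rho * Z <= rho ^+ k.+1 + 2 / N * (1 - 2^-1 ^+ k) + 8 * N ^+ k / #|V|%:R.
  have B0 : 0 <= 2 / N * (1 - 2^-1 ^+ k) + 8 * N ^+ k / #|V|%:R.
    apply: addr_ge0; last by rewrite -mulrA mulr_ge0.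
    by rewrite mulr_ge0 ?divr_ge0 ?(ltW N0) // subr_ge0 exprn_ile1 // ?invr_ge0 // invf_le1 //; lra.
  rewrite /Z exprS -addrA mulrDr -addrA lerD2l -[leRHS]mul1r ler_wpM2r //.
have Nk1 : 0 <= N ^+ k.+1 by rewrite exprn_ge0 // ltW.
apply: (@le_trans _ _ (1 + (N ^+ k.+1 * (rho ^+ k.+1 + 2 / N * (1 - 2^-1 ^+ k) + 8 * N ^+ k / #|V|%:R) +
   4 * (N ^+ k.+1 * (N ^+ k.+1 / #|V|%:R))))).
  by rewrite lerD2l lerD2r ler_wpM2l.
have -> : N ^+ k.+1 * (rho ^+ k.+1 + 2 / N * (1 - 2^-1 ^+ k.+1) + 8 * N ^+ k.+1 / #|V|%:R) =
   N ^+ k.+1 * (rho ^+ k.+1 + 2 / N * (1 - 2^-1 ^+ k)) + N ^+ k * 2^-1 ^+ k +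
   8 * (N ^+ k.+1 * (N ^+ k.+1 / #|V|%:R)).
  rewrite [2^-1 ^+ k.+1]exprS [N ^+ k.+1]exprS; set y := 2^-1 ^+ k; set z := N ^+ k; set q := rho ^+ _.
  by field; rewrite !gt_eqF.
have := ler_wpM2l Nk1 NV; rewrite mulrDr.
have -> : 8 * N ^+ k / #|V|%:R = 8 * (N ^+ k / #|V|%:R) by rewrite mulrA.
set A := N ^+ k.+1 * (_ + _); set B := N ^+ k.+1 * (8 * _); set D := N ^+ k.+1 / _.
by lra.
Qed.

Lemma Ex_gcap_le_norm rho U k : 0 <= rho <= 1 -> p11 <= rho * p + p ^+ 2 -> 20 <= N ->
  Ex (fun w => #|gcap w U k|%:R / N ^+ k) <= rho ^+ k + 2 / N + 8 * N ^+ k / #|V|%:R.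
Proof.
move=> rho01 p11r N20; have N0 : 0 < N by lra.
under eq_Ex do rewrite mulrC.
rewrite ExZ mulrC ler_pdivrMr ?exprn_gt0 // [leRHS]mulrC.
apply: (le_trans (Ex_gcap_le U k rho01 p11r N20)).
rewrite ler_wpM2l ?exprn_ge0 ?(ltW N0) // lerD2r lerD2l.
have b0 : 0 <= 2^-1 ^+ k :> R by rewrite exprn_ge0 // invr_ge0.
have a0 : 0 <= 2 / N by rewrite divr_ge0 // ltW.
by nra.
Qed.

(** Of use when [rho ^+ k] is small: then the mean alone controls the deviation. *)
Lemma gcap_conc_small rho U k : 0 <= rho <= 1 -> p11 <= rho * p + p ^+ 2 -> 20 <= N ->
  Ex (fun w => `|#|gcap w U k|%:R / N ^+ k - rho ^+ k|) <=
  2 * rho ^+ k + 2 / N + 8 * N ^+ k / #|V|%:R.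
Proof.
move=> rho01 p11r N20; have N0 : 0 < N by lra.
have rk : 0 <= rho ^+ k by rewrite exprn_ge0 //; case/andP: rho01.
apply: (@le_trans _ _ (Ex (fun w => #|gcap w U k|%:R / N ^+ k + rho ^+ k))).
  apply: ler_Ex => // w; apply: (le_trans (ler_normB _ _)).
  by rewrite !ger0_norm // divr_ge0 // exprn_ge0 // ltW.
rewrite ExD Ex_cst //.
by have := Ex_gcap_le_norm U k rho01 p11r N20; lra.
Qed.

(* The ball of the intersection graph lies in both balls; it is itself an
   Erdos-Renyi ball with edge probability p11. *)
Lemma gcap_conc rho U k j : 0 <= rho <= 1 -> rho * p <= p11 ->
  p11 <= rho * p + p ^+ 2 -> 20 <= #|V|%:R * p11 -> (#|~: U| <= j)%N ->
  Ex (fun w => `|#|gcap w U k|%:R / N ^+ k - rho ^+ k|) <=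
  2 / N + 8 * N ^+ k / #|V|%:R + 2 * Num.sqrt (@gb_err R n k j (#|V|%:R * p11)).
Proof.
move=> rho01 rp p11r N20 Uj; have /andP[rho0 rho1] := rho01.
have N20' : 20 <= N by apply: (le_trans N20); rewrite ler_wpM2l.
have N0 : 0 < N by lra.
have p0 : 0 < p by have := N0; rewrite /N pmulr_rgt0.
have Nk0 : 0 < N ^+ k by rewrite exprn_gt0.
have M0 : 0 < #|V|%:R * p11 by lra.
have Mk0 : 0 < (#|V|%:R * p11) ^+ k by rewrite exprn_gt0.
(* From [|x| = x + 2 x^-]: the mean of [x] is bounded above by [Ex_gcap_le_norm], and the negative
   part by the deviation of the ball of the intersection graph. *)
apply: (@le_trans _ _ (Ex (fun w => (#|gcap w U k|%:R / N ^+ k - rho ^+ k) +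
   2 * `|#|gb gh w U k|%:R / (#|V|%:R * p11) ^+ k - 1|))).
  apply: ler_Ex => // w.
  set c := _ / N ^+ k; set b := #|gb gh w U k|%:R / _.
  (* Ratio of the normalisations of the intersection ball and of the two balls; being at least
     [rho ^+ k], it turns [b] close to 1 into a lower bound for [c]. *)
  pose ta := (p11 / p) ^+ k.
  have ta1 : ta <= 1 by rewrite exprn_ile1 ?divr_ge0 // ler_pdivrMr // mul1r.
  have ta0 : rho ^+ k <= ta.
    by rewrite lerXn2r ?nnegrE // ?divr_ge0 // ler_pdivlMr.
  have tb : ta * b <= c.
    have -> : ta * b = #|gb gh w U k|%:R / N ^+ k.
      rewrite /ta /b /N expr_div_n !exprMn; field.
      by rewrite !expf_neq0 // gt_eqF //; have := M0; rewrite pmulr_rgt0.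
    rewrite ler_wpM2r ?invr_ge0 ?(ltW Nk0) // ler_nat subset_leq_card //.
    rewrite /gcap finset.subsetI; apply/andP; split; apply: gball_sub => // u v;
      by rewrite /gr adj_andb => /andP[].
  have rk0 : 0 <= rho ^+ k by rewrite exprn_ge0.
  have [cr|cr] := leP (rho ^+ k) c.
    by rewrite ger0_norm ?subr_ge0 // lerDl mulr_ge0.
  have cr' : c - rho ^+ k < 0 by rewrite subr_lt0.
  rewrite ltr0_norm //.
  have : rho ^+ k - c <= `|b - 1|.
    apply: (@le_trans _ _ (ta * (1 - b))); first by lra.
    have := ler_norm (1 - b); rewrite distrC => hb.
    apply: (le_trans (ler_wpM2l (le_trans rk0 ta0) hb)).
    by rewrite -[leRHS]mul1r ler_wpM2r.
  lra.
rewrite ExD ExB Ex_cst // ExZ.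
have h1 := Ex_gcap_le_norm U k rho01 p11r N20'.
have h2 := gb_conc mu_ge0 mu_sum1 k N20 Uj.
by rewrite -/p11 in h2; lra.
Qed.

Lemma gb_conc2 (f : T -> bool) U k j : prob1 mu f = p -> 20 <= N -> (#|~: U| <= j)%N ->
  Ex (fun w => `|#|gb f w U k|%:R / N ^+ k - 1|) <= Num.sqrt (@gb_err R n k j N).
Proof.
by move=> pf N20 Uj; have := gb_conc mu_ge0 mu_sum1 (g := f) k (U := U) (j := j); rewrite pf; exact.
Qed.

Definition star_counts F w v S S' : R :=
  F #|nbr g w v S :\: nbr h w v S'|%SET #|nbr h w v S' :\: nbr g w v S|%SET
    #|nbr g w v S :&: nbr h w v S'|%SET.

(** An edge at [v] is counted in the first star only, the second only, or both, which gives
    exclusive outcomes. When its other end lies in both sets the total rate is [2 p - p11], and the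
    square, at most [4 p^2], is shared between [|S|] and [|S'|]. *)
Lemma le_cam_star F v S S' : v \notin S -> v \notin S' -> unit_valued3 F ->
  `|Ex (fun w => star_counts F w v S S') -
    Poi3 (p * #|S|%:R - p11 * #|S :&: S'|%SET%:R) (p * #|S'|%:R - p11 * #|S :&: S'|%SET%:R)
      (p11 * #|S :&: S'|%SET%:R) F| <= 2 * p ^+ 2 * (#|S|%:R + #|S'|%:R).
Proof.
move=> vS vS' F01.
pose A s t := incident S v s && g t; pose B s t := incident S' v s && h t.
pose X s t := A s t && ~~ B s t; pose Y s t := B s t && ~~ A s t; pose Z s t := A s t && B s t.
have excl s t : (X s t + Y s t + Z s t <= 1)%N by rewrite /X /Y /Z; case: (A s t); case: (B s t).
have vI : v \notin (S :&: S')%SET by rewrite inE (negPf vS).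
have cZ w : #|nbr g w v S :&: nbr h w v S'|%SET = (\sum_s Z s (w s))%N.
  rewrite nbrI /nbr card_nbr //; apply: eq_bigr => s _.
  by rewrite -(incidentI S' s vS) andbACA.
have cA w : #|nbr g w v S| = (\sum_s A s (w s))%N by rewrite /nbr card_nbr.
have cB w : #|nbr h w v S'| = (\sum_s B s (w s))%N by rewrite /nbr card_nbr.
have cX w : #|nbr g w v S :\: nbr h w v S'|%SET = (\sum_s X s (w s))%N.
  have := cardsID (nbr h w v S') (nbr g w v S); rewrite cZ cA => E.
  apply/eqP; rewrite -(eqn_add2l (\sum_s Z s (w s))%N) E -big_split /=; apply/eqP.
  by apply: eq_bigr => s _; rewrite /Z /X; case: (A s _); case: (B s _).
have cY w : #|nbr h w v S' :\: nbr g w v S|%SET = (\sum_s Y s (w s))%N.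
  have := cardsID (nbr g w v S) (nbr h w v S'); rewrite finset.setIC cZ cB => E.
  apply/eqP; rewrite -(eqn_add2l (\sum_s Z s (w s))%N) E -big_split /=; apply/eqP.
  by apply: eq_bigr => s _; rewrite /Z /Y; case: (A s _); case: (B s _).
have rA s : expect1 mu (fun t => (A s t)%:R) = (incident S v s)%:R * p.
  by rewrite expect1_incident pg.
have rB s : expect1 mu (fun t => (B s t)%:R) = (incident S' v s)%:R * p.
  by rewrite expect1_incident ph.
have rZ s : expect1 mu (fun t => (Z s t)%:R) = (incident (S :&: S')%SET v s)%:R * p11.
  rewrite -expect1_incident; apply: eq_bigr => t _.
  by rewrite -(incidentI S' s vS) /Z /A /B andbACA.
have rX s : expect1 mu (fun t => (X s t)%:R) =
    expect1 mu (fun t => (A s t)%:R) - expect1 mu (fun t => (Z s t)%:R).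
  rewrite /expect1 -sumrB; apply: eq_bigr => t _; rewrite -mulrBr; congr (_ * _).
  by rewrite /X /Z; case: (A s t); case: (B s t); rewrite /= ?mulr0n ?mulr1n; lra.
have rY s : expect1 mu (fun t => (Y s t)%:R) =
    expect1 mu (fun t => (B s t)%:R) - expect1 mu (fun t => (Z s t)%:R).
  rewrite /expect1 -sumrB; apply: eq_bigr => t _; rewrite -mulrBr; congr (_ * _).
  by rewrite /Y /Z; case: (A s t); case: (B s t); rewrite /= ?mulr0n ?mulr1n; lra.
have := le_cam mu_ge0 mu_sum1 excl 0 0 0 (index_enum_uniq (edge n)) F01.
have -> : \sum_s expect1 mu (fun t => (Z s t)%:R) = p11 * #|S :&: S'|%SET%:R.
  by under eq_bigr do rewrite rZ; rewrite -mulr_suml sumr_incident // mulrC.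
have -> : \sum_s expect1 mu (fun t => (X s t)%:R) = p * #|S|%:R - p11 * #|S :&: S'|%SET%:R.
  under eq_bigr do rewrite rX rA rZ.
  by rewrite sumrB -!mulr_suml !sumr_incident // !(mulrC #|_|%:R).
have -> : \sum_s expect1 mu (fun t => (Y s t)%:R) = p * #|S'|%:R - p11 * #|S :&: S'|%SET%:R.
  under eq_bigr do rewrite rY rB rZ.
  by rewrite sumrB -!mulr_suml !sumr_incident // !(mulrC #|_|%:R).
have -> : Ex (fun w => star_counts F w v S S') =
  Ex (fun w => F (0 + \sum_s X s (w s))%N (0 + \sum_s Y s (w s))%N (0 + \sum_s Z s (w s))%N).
  by apply: eq_Ex => w; rewrite /star_counts cX cY cZ !add0n.
move/le_trans; apply.
rewrite -(sumr_incident vS) -(sumr_incident vS') -big_split /= mulr_sumr; apply: ler_sum => s _.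
rewrite rX rY rZ rA rB.
have := p11_ge0; have := p_ge0; have := p11_le.
rewrite -(incidentI S' s vS).
by case: (incident S v s); case: (incident S' v s); rewrite /= ?mulr0n ?mulr1n => *; nra.
Qed.

End two_graphs.

(** * Empirical averages over the vertices *)

Section averages.
Context {R : realType} {n : nat} {T : finType} (mu : T -> R).
Hypothesis mu_ge0 : forall t, 0 <= mu t.
Hypothesis mu_sum1 : \sum_t mu t = 1.
Variables (g h : T -> bool) (p : R).
Hypothesis pg : prob1 mu g = p.
Hypothesis ph : prob1 mu h = p.
Notation V := (vertex n).
Notation r := (origin n).
Notation Ex := (@Ex R (edge n) T mu).
Implicit Types (w : {ffun edge n -> T}) (v x u : V) (U S : {set V}).

Let gh t := g t && h t.
Let p11 := prob1 mu gh.
Let N := #|V|%:R * p.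
Notation VT := [set: V]%SET.
Notation VR := ([set: V]%SET :\ r)%SET.

Let p11_ge0 : 0 <= p11. Proof. exact: prob1_ge0. Qed.
Let p_ge0 : 0 <= p. Proof. by rewrite -pg prob1_ge0. Qed.

Let p11_le : p11 <= p.
Proof.
rewrite -pg; apply: ler_sum => t _; rewrite ler_wpM2l // /gh.
by case: (g t); case: (h t).
Qed.

Let V0 : 0 < #|V|%:R :> R. Proof. by rewrite card_ord. Qed.

Lemma VRP v : (v \in VR) = (v != r).
Proof. by rewrite !inE andbT. Qed.

Definition psi F w U v k : R :=
  star_counts g h F w v (gb g w (U :\ v)%SET k) (gb h w (U :\ v)%SET k).

Lemma psi_unit F w U v k : unit_valued3 F -> 0 <= psi F w U v k <= 1.
Proof. by move=> F01; exact: F01. Qed.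

Lemma psi_mix F w w' v x k : x != r -> v != x ->
  psi F (mix (at_vertex x) w w') (VT :\ x)%SET v k = psi F w (VT :\ x)%SET v k.
Proof.
move=> xr vx; have xU : x \notin (VT :\ x :\ v)%SET by rewrite !inE eqxx andbF.
by rewrite /psi /star_counts !gb_mix // !nbr_mix_other // notin_gb.
Qed.

Lemma nbr_eq_sum0 (f : T -> bool) w v S S' : S' \subset S ->
  (\sum_(u in nbr f w v S) (u \notin S'))%N = 0%N -> nbr f w v S = nbr f w v S'.
Proof.
move=> SS' /eqP; rewrite sum_nat_eq0 => /forallP s0; apply/finset.setP => u.
apply/idP/idP => uY; last first.
  by move: uY; rewrite !inE => /andP[uS ->]; rewrite (fintype.subsetP SS').
have := s0 u; rewrite uY /= eqb0 negbK => uS'.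
by move: uY; rewrite !inE uS' => /andP[_ ->].
Qed.

Lemma setD1C U v x : (U :\ v :\ x = U :\ x :\ v)%SET.
Proof. by apply/finset.setP => y; rewrite !inE andbCA. Qed.

(** Deleting [x] affects the statistic of [v] only if some counted neighbour leaves its ball; then
    the right side is at least 1, and two values in the unit interval differ by at most 1. *)
Lemma psi_diff F w v x k : unit_valued3 F ->
  `|psi F w VT v k - psi F w (VT :\ x)%SET v k| <=
  \sum_(u in nbr g w v (gb g w (VT :\ v)%SET k)) (u \notin gb g w (VT :\ v :\ x)%SET k)%:R +
  \sum_(u in nbr h w v (gb h w (VT :\ v)%SET k)) (u \notin gb h w (VT :\ v :\ x)%SET k)%:R.
Proof.
move=> F01; rewrite -!natr_sum -natrD.
have sub f : gb f w (VT :\ v :\ x)%SET k \subset gb f w (VT :\ v)%SET k.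
  by apply: gball_sub => //; exact: subD1set.
set a := (\sum_(u in _) _)%N; set b := (\sum_(u in _) _)%N.
case E : (a + b)%N => [|c].
  move/eqP: E; rewrite addn_eq0 => /andP[/eqP a0 /eqP b0].
  rewrite /psi /star_counts (nbr_eq_sum0 (sub g) a0) (nbr_eq_sum0 (sub h) b0).
  by rewrite [in X in `|X - _|]setD1C subrr normr0.
apply: (@le_trans _ _ 1); last by rewrite ler1n.
have /andP[? ?] := psi_unit w VT v k F01; have /andP[? ?] := psi_unit w (VT :\ x)%SET v k F01.
by rewrite ler_norml; apply/andP; split; lra.
Qed.

Lemma sum_nbr_cut (f : T -> bool) w v k : 
  \sum_(x in VR | v != x) \sum_(u in nbr f w v (gb f w (VT :\ v)%SET k))
     (u \notin gb f w (VT :\ v :\ x)%SET k)%:R <=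
  k%:R * #|nbr f w v (gb f w (VT :\ v)%SET k)|%:R :> R.
Proof.
rewrite exchange_big /= -sum1_card natr_sum mulr_sumr; apply: ler_sum => u.
rewrite inE => /andP[uB _]; rewrite mulr1; apply: le_trans (sum_cut uB).
rewrite le_eqVlt; apply/orP; left; apply/eqP; apply: eq_bigl => x.
by rewrite !inE !andbT (eq_sym v).
Qed.

Lemma sum_psi_diff F w v k : unit_valued3 F ->
  \sum_(x in VR | v != x) `|psi F w VT v k - psi F w (VT :\ x)%SET v k| <=
  k%:R * (#|nbr g w v (gb g w (VT :\ v)%SET k)|%:R + #|nbr h w v (gb h w (VT :\ v)%SET k)|%:R).
Proof.
move=> F01; rewrite mulrDr; apply: le_trans (lerD (sum_nbr_cut g w v k) (sum_nbr_cut h w v k)).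
by rewrite -big_split /=; apply: ler_sum => x _; exact: psi_diff.
Qed.

Lemma card_setC_D2 v x : (#|~: (VT :\ v :\ x)%SET| <= 2)%N.
Proof.
apply: (@leq_trans #|[set v; x]%SET|); last by rewrite cards2; case: (_ != _).
by apply: subset_leq_card; apply/fintype.subsetP => y; rewrite !inE; case: (y == v); case: (y == x).
Qed.

(** Variance of a sum of weakly dependent terms. The diagonal gives [1 / |V|]. Off the diagonal each
    term is replaced by its version with the other vertex deleted, at a total cost of [2 k] times
    the number of counted neighbours. The edges at [x] are then independent of the term of [v], and
    Le Cam's inequality turns the conditional mean of the term of [x] into the Poisson average
    assumed close to [c0]. *)
Lemma avg_psi F (c0 eps : R) k : unit_valued3 F -> 0 <= c0 <= 1 -> 20 <= N -> 0 <= eps ->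
  (forall U, (#|~: U| <= 2)%N ->
    Ex (fun w => `|Poi3 (p * #|gb g w U k|%:R - p11 * #|gcap g h w U k|%:R)
      (p * #|gb h w U k|%:R - p11 * #|gcap g h w U k|%:R) (p11 * #|gcap g h w U k|%:R) F - c0|) <= eps) ->
  Ex (fun w => `|(\sum_(v in VR) (psi F w VT v k - c0)) / #|V|%:R|) <=
  Num.sqrt (#|V|%:R^-1 + 8 * k%:R * N ^+ k.+1 / #|V|%:R ^+ 2 + 8 * p ^+ 2 * N ^+ k + eps).
Proof.
move=> F01 /andP[c00 c01] N20 eps0 Heps; apply: Ex_norm_sqrt => //.
have N0 : 0 < N by lra.
pose D w U v := psi F w U v k - c0.
have D1 w U v : `|D w U v| <= 1.
  by have /andP[? ?] := psi_unit w U v k F01; rewrite /D ler_norml; apply/andP; split; lra.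
pose dd w v x := `|psi F w VT v k - psi F w (VT :\ x)%SET v k|.
pose e2 := 8 * p ^+ 2 * N ^+ k + eps.
have cross v x : v != r -> x != r -> v != x ->
    Ex (fun w => D w (VT :\ x)%SET v * D w (VT :\ v)%SET x) <= e2.
  move=> vr xr vx; rewrite (Ex_mixM mu_sum1 (A := at_vertex x)); last first.
    by move=> w w'; rewrite /D psi_mix.
  pose S w := gb g w (VT :\ v :\ x)%SET k; pose S' w := gb h w (VT :\ v :\ x)%SET k.
  apply: (@le_trans _ _ (Ex (fun w => `|Poi3 (p * #|S w|%:R - p11 * #|gcap g h w (VT :\ v :\ x)%SET k|%:R)
      (p * #|S' w|%:R - p11 * #|gcap g h w (VT :\ v :\ x)%SET k|%:R)
      (p11 * #|gcap g h w (VT :\ v :\ x)%SET k|%:R) F - c0| + 2 * p ^+ 2 * (#|S w|%:R + #|S' w|%:R)))).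
    apply: ler_Ex => // w.
    (* Only the conditional mean of the second factor is estimated; the first factor is at most
       1. *)
    apply: (le_trans (ler_norm _)); rewrite normrM -[leRHS]mul1r ler_pM //.
    have xS : x \notin S w by exact: notin_gbD1.
    have xS' : x \notin S' w by exact: notin_gbD1.
    have := le_cam_star mu_ge0 mu_sum1 pg ph xS xS' F01.
    have -> : Ex (fun w' => D (mix (at_vertex x) w w') (VT :\ v)%SET x) =
       Ex (fun w' => star_counts g h F w' x (S w) (S' w)) - c0.
      rewrite -[X in _ - X](@Ex_cst _ (edge n) _ _ mu_sum1) -ExB; apply: eq_Ex => w'.
      by rewrite /D /psi /star_counts !gb_mixD1 // !nbr_mix.
    rewrite -/gh -/p11 -/(gcap g h w (VT :\ v :\ x)%SET k).
    set P3 := Poi3 _ _ _ F; set E3 := Ex _ => LC.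
    have -> : E3 - c0 = (P3 - c0) + (E3 - P3) by ring.
    by apply: (le_trans (ler_normD _ _)); rewrite lerD2l.
  rewrite ExD ExZ ExD /e2 addrC; apply: lerD; last exact: (Heps _ (card_setC_D2 v x)).
  have hs := Ex_gb_le2 mu_ge0 mu_sum1 (VT :\ v :\ x)%SET k pg N20.
  have hs' := Ex_gb_le2 mu_ge0 mu_sum1 (VT :\ v :\ x)%SET k ph N20.
  have p20 : 0 <= p ^+ 2 by rewrite exprn_ge0.
  by have := ler_wpM2l p20 (lerD hs hs'); rewrite -/N; lra.
have e20 : 0 <= e2 by rewrite addr_ge0 // !mulr_ge0 // exprn_ge0 // ltW.
pose YY w v : R := #|nbr g w v (gb g w (VT :\ v)%SET k)|%:R + #|nbr h w v (gb h w (VT :\ v)%SET k)|%:R.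
have pw w : (\sum_(v in VR) D w VT v) ^+ 2 <= #|V|%:R +
   (\sum_(v in VR) \sum_(x in VR | v != x) D w (VT :\ x)%SET v * D w (VT :\ v)%SET x +
    2 * k%:R * \sum_(v in VR) YY w v).
  rewrite expr2 big_distrlr /=.
  have split v : v \in VR -> \sum_(x in VR) D w VT v * D w VT x <= 1 +
     \sum_(x in VR | v != x) (D w (VT :\ x)%SET v * D w (VT :\ v)%SET x + dd w v x + dd w x v).
    move=> vR; rewrite (bigD1 v) //=; apply: lerD.
      apply: (le_trans (ler_norm _)); rewrite normrM -[leRHS]mulr1 ler_pM //.
    rewrite (eq_bigl (fun x => (x \in VR) && (v != x))); last by move=> x; rewrite (eq_sym v).
    apply: ler_sum => x _.
    have := D1 w VT x; have := D1 w (VT :\ x)%SET v.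
    have -> : dd w v x = `|D w VT v - D w (VT :\ x)%SET v| by rewrite /dd /D; congr `|_|; ring.
    have -> : dd w x v = `|D w VT x - D w (VT :\ v)%SET x| by rewrite /dd /D; congr `|_|; ring.
    move: (D w VT v) (D w VT x) (D w (VT :\ x)%SET v) (D w (VT :\ v)%SET x) => a b a' b' a'1 b1.
    have -> : a * b = a' * b' + (a - a') * b + a' * (b - b') by ring.
    rewrite -!addrA lerD2l; apply: lerD; apply: (le_trans (ler_norm _)); rewrite normrM.
      by rewrite -[leRHS]mulr1 ler_wpM2l.
    by rewrite -[leRHS]mul1r ler_wpM2r.
  apply: (le_trans (ler_sum _ split)); rewrite big_split /=; apply: lerD.
    by rewrite sumr_const ler_nat max_card.
  under eq_bigr do rewrite !big_split /=.
  rewrite !big_split /= -addrA lerD2l.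
  have s1 : \sum_(v in VR) \sum_(x in VR | v != x) dd w v x <= k%:R * \sum_(v in VR) YY w v.
    by rewrite mulr_sumr; apply: ler_sum => v _; exact: sum_psi_diff.
  have s2 : \sum_(v in VR) \sum_(x in VR | v != x) dd w x v = \sum_(v in VR) \sum_(x in VR | v != x) dd w v x.
    under eq_bigr do rewrite big_mkcondr.
    rewrite exchange_big /=; apply: eq_bigr => v _; rewrite [RHS]big_mkcondr /=.
    by apply: eq_bigr => x _; rewrite eq_sym.
  by rewrite s2; apply: (le_trans (lerD s1 s1)); rewrite /YY big_split /= -[leRHS]mulrA [leRHS]mulr_natl mulr2n.
have EYY v : v \in VR -> Ex (fun w => YY w v) <= 4 * (p * N ^+ k).
  rewrite VRP => vr; rewrite ExD !Ex_nbr_gb // pg ph.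
  have hs := Ex_gb_le2 mu_ge0 mu_sum1 (VT :\ v)%SET k pg N20.
  have hs' := Ex_gb_le2 mu_ge0 mu_sum1 (VT :\ v)%SET k ph N20.
  by have := ler_wpM2l p_ge0 (lerD hs hs'); rewrite -/N; lra.
have tot : Ex (fun w => (\sum_(v in VR) D w VT v) ^+ 2) <=
   #|V|%:R + (#|V|%:R * (#|V|%:R * e2) + 2 * k%:R * (#|V|%:R * (4 * (p * N ^+ k)))).
  apply: (le_trans (ler_Ex mu_ge0 pw)); rewrite ExD Ex_cst // lerD2l ExD ExZ !Ex_sum.
  apply: lerD.
    apply: sum_le_card => [|v]; first by rewrite mulr_ge0.
    rewrite VRP => vr; rewrite Ex_sum; apply: sum_le_card => // x.
    by rewrite VRP => /andP[xr vx]; exact: cross.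
  rewrite ler_wpM2l // ?mulr_ge0 //; apply: sum_le_card; last exact: EYY.
  by rewrite !mulr_ge0 // exprn_ge0 // ltW.
rewrite (@eq_Ex _ _ _ _ _ (fun w => #|V|%:R^-1 ^+ 2 * (\sum_(v in VR) D w VT v) ^+ 2)); last first.
  by move=> w; rewrite exprMn mulrC.
rewrite ExZ exprVn mulrC ler_pdivrMr ?exprn_gt0 //; apply: (le_trans tot).
rewrite le_eqVlt; apply/orP; left; apply/eqP; rewrite /e2 [N ^+ k.+1]exprS /N.
by set y := (_ * p) ^+ k; field; rewrite gt_eqF.
Qed.

(** The variance enters linearly through [|y| <= y^2 / (2 t) + t / 2]; below, [t] is the square root
    of the typical mean. *)
Lemma star_dev (f : T -> bool) v S (t : R) : v \notin S -> 0 < t ->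
  Ex (fun w => `|#|nbr f w v S|%:R - prob1 mu f * #|S|%:R|) <= (prob1 mu f * #|S|%:R / t + t) / 2.
Proof.
move=> vS t0.
apply: (@le_trans _ _ (Ex (fun w => (2 * t)^-1 *
   ((#|nbr f w v S|%:R + - (prob1 mu f * #|S|%:R)) * (#|nbr f w v S|%:R + - (prob1 mu f * #|S|%:R))) + t / 2))).
  apply: ler_Ex => // w; set y := _ - _; rewrite -expr2 -[y ^+ 2]real_normK ?num_real //.
  rewrite -subr_ge0; have -> : (2 * t)^-1 * `|y| ^+ 2 + t / 2 - `|y| = (2 * t)^-1 * (`|y| - t) ^+ 2.
    by field; rewrite gt_eqF.
  by rewrite mulr_ge0 ?sqr_ge0 // invr_ge0 mulr_ge0 // ltW.
rewrite ExD Ex_cst // ExZ (Ex_nbr2 mu_sum1 f f _ _ vS vS) finset.setIid subrr mul0r add0r.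
have -> : prob1 mu (fun t => f t && f t) = prob1 mu f by apply: eq_bigr => y _; rewrite andbb.
have f0 := prob1_ge0 mu_ge0 f.
have -> : (prob1 mu f * #|S|%:R / t + t) / 2 = (2 * t)^-1 * (prob1 mu f * #|S|%:R) + t / 2.
  by field; rewrite gt_eqF.
rewrite lerD2r ler_wpM2l ?invr_ge0 ?mulr_ge0 ?(ltW t0) // ler_wpM2r // gerBl.
exact: mulr_ge0.
Qed.

Lemma sum_gb_removed (f : T -> bool) w k :
  \sum_(v in VR) (#|gb f w VT k|%:R - #|gb f w (VT :\ v)%SET k|%:R) <= k%:R * #|gb f w VT k|%:R :> R.
Proof.
apply: (@le_trans _ _ (\sum_(v in VR) \sum_(u in gb f w VT k) (u \notin gb f w (VT :\ v)%SET k)%:R)).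
  apply: ler_sum => v _; rewrite lerBlDr -!natr_sum -natrD ler_nat.
  rewrite -!sum1_card big_mkcond [X in (_ <= X + _)%N]big_mkcond [X in (_ <= _ + X)%N]big_mkcond /=.
  rewrite -big_split /=; apply: leq_sum => u _.
  by case: (u \in gb f w VT k); case: (u \in gb f w (VT :\ v)%SET k).
rewrite exchange_big /= -sum1_card natr_sum mulr_sumr; apply: ler_sum => u uB; rewrite mulr1.
exact: sum_cut.
Qed.

Lemma gb_removed_ge0 (f : T -> bool) w v k : 0 <= #|gb f w VT k|%:R - #|gb f w (VT :\ v)%SET k|%:R :> R.
Proof. by rewrite subr_ge0 ler_nat subset_leq_card // gball_sub // subD1set. Qed.

Lemma gcap_removed w v k :
  `|#|gcap g h w VT k|%:R - #|gcap g h w (VT :\ v)%SET k|%:R| <=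
  (#|gb g w VT k|%:R - #|gb g w (VT :\ v)%SET k|%:R) +
  (#|gb h w VT k|%:R - #|gb h w (VT :\ v)%SET k|%:R) :> R.
Proof.
have sub f : gb f w (VT :\ v)%SET k \subset gb f w VT k by rewrite gball_sub // subD1set.
have cd f : #|gb f w VT k|%:R - #|gb f w (VT :\ v)%SET k|%:R =
    #|gb f w VT k :\: gb f w (VT :\ v)%SET k|%SET%:R :> R.
  rewrite -(cardsID (gb f w (VT :\ v)%SET k) (gb f w VT k)) (finset.setIidPr (sub f)) natrD.
  by rewrite addrC addKr.
rewrite !cd.
have cs : gcap g h w (VT :\ v)%SET k \subset gcap g h w VT k by apply: finset.setISS; exact: sub.
rewrite -(cardsID (gcap g h w (VT :\ v)%SET k) (gcap g h w VT k)) (finset.setIidPr cs) natrD.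
rewrite addrC addKr ger0_norm // -natrD ler_nat.
apply: leq_trans (leq_card_setU _ _); apply: subset_leq_card; apply/fintype.subsetP => u.
rewrite !inE; case: (u \in gb g w VT k); case: (u \in gb h w VT k) => //=; rewrite ?andbT ?andbF //.
by rewrite negb_and.
Qed.

Lemma normr_div_pos (x y : R) : 0 < y -> `|x / y| = `|x| / y.
Proof. by move=> y0; rewrite normf_div (ger0_norm (ltW y0)). Qed.

(** * Neighbour counts and parent ratios at one level *)

Section level.
(** [m] is the order of the ball size and [r0] the proportion of the common part, so [p * m] is the
    typical number of neighbours in the ball. *)
Variables (m r0 : R) (k : nat).
Hypothesis p_gt0 : 0 < p.
Hypothesis m_gt0 : 0 < m.
Hypothesis mu_ge1 : 1 <= p * m.
Let t := Num.sqrt (p * m).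

Let t1 : 1 <= t. Proof. by rewrite -sqrtr1 ler_wsqrtr. Qed.
Let t0 : 0 < t. Proof. exact: lt_le_trans t1. Qed.
Let tt : p * m = t ^+ 2. Proof. by rewrite sqr_sqrtr // mulr_ge0 // ltW. Qed.

Let dev_bound (s : R) : 0 <= s -> (p * s / t + t) / 2 / (p * m) <= t^-1 + `|s / m - 1|.
Proof.
move=> s0; have -> : (p * s / t + t) / 2 / (p * m) = (s / m + 1) / 2 * t^-1.
  have -> : p * s = (s / m) * t ^+ 2 by rewrite -tt; field; rewrite gt_eqF.
  by rewrite tt; field; rewrite !gt_eqF.
have ti : 0 < t^-1 <= 1 by rewrite invr_gt0 t0 invf_le1.
have [ti0 ti1] := andP ti.
have := ler_norm (s / m - 1); have := normr_ge0 (s / m - 1); nra.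
Qed.

(** Fluctuation of the count given the ball, plus deviation of the ball size; the latter appears
    twice because it also enters the variance. *)
Lemma level_nbr (f : T -> bool) v : prob1 mu f = p -> v != r ->
  Ex (fun w => `|#|nbr f w v (gb f w (VT :\ v)%SET k)|%:R / (p * m) - 1|) <=
  t^-1 + 2 * Ex (fun w => `|#|gb f w (VT :\ v)%SET k|%:R / m - 1|).
Proof.
move=> pf vr; rewrite (Ex_mix mu_sum1 (at_vertex v)).
rewrite -ExZ -[X in X + _](@Ex_cst _ (edge n) _ _ mu_sum1) -ExD; apply: ler_Ex => // w.
set S := gb f w (VT :\ v)%SET k; have vS : v \notin S by exact: notin_gbD1.
apply: (@le_trans _ _ (Ex (fun w' => `|#|nbr f w' v S|%:R - prob1 mu f * #|S|%:R| / (p * m) + `|#|S|%:R / m - 1|))).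
  apply: ler_Ex => // w'; rewrite nbr_mix gb_mixD1 // -/S pf.
  have pm0 : 0 < p * m by rewrite mulr_gt0.
  rewrite -(normr_div_pos _ pm0).
  set y := #|nbr _ _ _ _|%:R; have -> : y / (p * m) - 1 = (y - p * #|S|%:R) / (p * m) + (#|S|%:R / m - 1).
    by field; rewrite !gt_eqF.
  exact: ler_normD.
rewrite ExD Ex_cst //; under eq_Ex do rewrite mulrC.
rewrite ExZ mulrC.
have := star_dev f vS t0; rewrite pf => sd.
have pmi : 0 <= (p * m)^-1 by rewrite invr_ge0 mulr_ge0 // ltW.
have := ler_wpM2r pmi sd; have := dev_bound (ler0n R #|S|); set q := Ex _; lra.
Qed.

Lemma level_cap v : v != r ->
  Ex (fun w => `|#|nbr g w v (gb g w (VT :\ v)%SET k) :&: nbr h w v (gb h w (VT :\ v)%SET k)|%SET%:R / (p * m)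
     - p11 / p * r0|) <=
  t^-1 + Ex (fun w => `|#|gb g w (VT :\ v)%SET k|%:R / m - 1|) +
  Ex (fun w => `|#|gcap g h w (VT :\ v)%SET k|%:R / m - r0|).
Proof.
move=> vr; rewrite (Ex_mix mu_sum1 (at_vertex v)).
rewrite -[X in X + _ + _](@Ex_cst _ (edge n) _ _ mu_sum1) -!ExD; apply: ler_Ex => // w.
set S := gb g w (VT :\ v)%SET k; set C := gcap g h w (VT :\ v)%SET k.
have vC : v \notin C by rewrite inE (negPf (notin_gbD1 _ _ _ _ vr)).
have pm0 : 0 < p * m by rewrite mulr_gt0.
apply: (@le_trans _ _ (Ex (fun w' => `|#|nbr gh w' v C|%:R - prob1 mu gh * #|C|%:R| / (p * m) + `|#|C|%:R / m - r0|))).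
  apply: ler_Ex => // w'; rewrite !nbr_mix !gb_mixD1 // nbrI -/(gcap g h w _ k) -/C.
  rewrite -(normr_div_pos _ pm0).
  set y := #|nbr _ _ _ _|%:R.
  have -> : y / (p * m) - p11 / p * r0 = (y - p11 * #|C|%:R) / (p * m) + p11 / p * (#|C|%:R / m - r0).
    by field; rewrite !gt_eqF.
  apply: (le_trans (ler_normD _ _)); rewrite lerD2l normrM -[leRHS]mul1r ler_wpM2r //.
  by rewrite ger0_norm ?divr_ge0 // ler_pdivrMr // mul1r.
rewrite ExD Ex_cst // lerD2r; under eq_Ex do rewrite mulrC.
rewrite ExZ mulrC.
have sd := star_dev gh vC t0.
have pmi : 0 <= (p * m)^-1 by rewrite invr_ge0 ltW.
apply: (le_trans (ler_wpM2r pmi sd)).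
apply: le_trans (dev_bound (ler0n R #|S|)).
rewrite ler_wpM2r // ler_wpM2r // lerD2r ler_wpM2r ?invr_ge0 ?(ltW t0) //.
by rewrite ler_pM // ?prob1_ge0 // card_gcap_le.
Qed.

(** Averaging over [v] returns to the full ball: each of its vertices is lost for at most [k]
    deletions. *)
Let avg_removed (f : T -> bool) :
  \sum_(v in VR) Ex (fun w => `|#|gb f w (VT :\ v)%SET k|%:R / m - 1|) <=
  #|V|%:R * Ex (fun w => `|#|gb f w VT k|%:R / m - 1|) + k%:R / m * Ex (fun w => #|gb f w VT k|%:R).
Proof.
rewrite -Ex_sum -!ExZ -ExD; apply: ler_Ex => // w.
have mi : 0 <= m^-1 by rewrite invr_ge0 ltW.
apply: (@le_trans _ _ (\sum_(v in VR) (`|#|gb f w VT k|%:R / m - 1| +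
   (#|gb f w VT k|%:R - #|gb f w (VT :\ v)%SET k|%:R) / m))).
  apply: ler_sum => v _; have := gb_removed_ge0 f w v k.
  set a := #|gb f w VT k|%:R; set b := #|gb f w _ k|%:R => ab.
  rewrite -[X in _ <= _ + X]ger0_norm ?mulr_ge0 //.
  have -> : b / m - 1 = (a / m - 1) - (a - b) / m by ring.
  exact: ler_normB.
rewrite big_split /=; apply: lerD; first exact: sum_le_card.
rewrite -mulr_suml; have := ler_wpM2r mi (sum_gb_removed f w k).
by set q := #|gb f w VT k|%:R; lra.
Qed.

Let avg_cap_removed :
  \sum_(v in VR) Ex (fun w => `|#|gcap g h w (VT :\ v)%SET k|%:R / m - r0|) <=
  #|V|%:R * Ex (fun w => `|#|gcap g h w VT k|%:R / m - r0|) +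
  (k%:R / m * Ex (fun w => #|gb g w VT k|%:R) + k%:R / m * Ex (fun w => #|gb h w VT k|%:R)).
Proof.
rewrite -Ex_sum -!ExZ -!ExD; apply: ler_Ex => // w.
have mi : 0 <= m^-1 by rewrite invr_ge0 ltW.
apply: (@le_trans _ _ (\sum_(v in VR) (`|#|gcap g h w VT k|%:R / m - r0| +
   ((#|gb g w VT k|%:R - #|gb g w (VT :\ v)%SET k|%:R) / m +
    (#|gb h w VT k|%:R - #|gb h w (VT :\ v)%SET k|%:R) / m)))).
  apply: ler_sum => v _; have := gcap_removed w v k.
  set a := #|gcap g h w VT k|%:R; set b := #|gcap g h w _ k|%:R => ab.
  rewrite -mulrDl; have := ler_wpM2r mi ab; rewrite -[X in _ * X <= _](ger0_norm mi) -normrM => ab'.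
  have -> : b / m - r0 = (a / m - r0) - (a - b) / m by ring.
  by apply: (le_trans (ler_normB _ _)); rewrite lerD2l.
rewrite !big_split /=; apply: lerD; first exact: sum_le_card.
rewrite -!mulr_suml; have := ler_wpM2r mi (sum_gb_removed g w k).
have := ler_wpM2r mi (sum_gb_removed h w k).
by set q := #|gb g w VT k|%:R; set q' := #|gb h w VT k|%:R; lra.
Qed.

Definition lev_size (f : T -> bool) : R :=
  Ex (fun w => `|#|gb f w VT k|%:R / m - 1|) + k%:R / (m * #|V|%:R) * Ex (fun w => #|gb f w VT k|%:R).

Definition lev_cap : R := Ex (fun w => `|#|gcap g h w VT k|%:R / m - r0|) +
  k%:R / (m * #|V|%:R) * Ex (fun w => #|gb g w VT k|%:R) +
  k%:R / (m * #|V|%:R) * Ex (fun w => #|gb h w VT k|%:R).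

Lemma level_avg_nbr (f : T -> bool) : prob1 mu f = p ->
  \sum_(v in VR) Ex (fun w => `|#|nbr f w v (gb f w (VT :\ v)%SET k)|%:R / (p * m) - 1|) / #|V|%:R <=
  t^-1 + 2 * lev_size f.
Proof.
move=> pf; rewrite -mulr_suml ler_pdivrMr //.
apply: (@le_trans _ _ (\sum_(v in VR) (t^-1 + 2 * Ex (fun w => `|#|gb f w (VT :\ v)%SET k|%:R / m - 1|)))).
  by apply: ler_sum => v; rewrite VRP => vr; exact: level_nbr.
rewrite big_split /= -mulr_sumr.
have h1 : \sum_(v in VR) t^-1 <= #|V|%:R * t^-1 by apply: sum_le_card; rewrite ?invr_ge0 ?(ltW t0).
have h2 := avg_removed f.
have -> : (t^-1 + 2 * lev_size f) * #|V|%:R = #|V|%:R * t^-1 +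
   2 * (#|V|%:R * Ex (fun w => `|#|gb f w VT k|%:R / m - 1|) + k%:R / m * Ex (fun w => #|gb f w VT k|%:R)).
  by rewrite /lev_size; set q := Ex _; set q' := Ex _; field; rewrite !gt_eqF.
by apply: lerD => //; rewrite ler_wpM2l.
Qed.

(** The ratio never exceeds 1, so an error in the denominator is not amplified even when the
    denominator is small; when it is 0, so is [z]. *)
Lemma ratio_dev (y1 y2 z : nat) (c : R) : (z <= maxn y1 y2)%N ->
  `|z%:R / (maxn y1 y2)%:R - c| <= `|z%:R / (p * m) - c| + `|y1%:R / (p * m) - 1| + `|y2%:R / (p * m) - 1|.
Proof.
move=> zM; set M := maxn y1 y2 in zM *; set q := p * m.
have q0 : 0 < q by rewrite mulr_gt0.
have MM : `|M%:R / q - 1| <= `|y1%:R / q - 1| + `|y2%:R / q - 1|.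
  by rewrite /M; case: (leqP y1 y2) => _; rewrite ?lerDl ?lerDr.
have [M0|M0] := posnP M.
  have -> : z = 0%N by apply/eqP; rewrite -leqn0 -M0.
  by rewrite !mul0r -addrA lerDl addr_ge0.
have Mr : 0 < M%:R :> R by rewrite ltr0n.
have rat0 : 0 <= z%:R / M%:R :> R by rewrite divr_ge0.
have rat1 : z%:R / M%:R <= 1 :> R by rewrite ler_pdivrMr // mul1r ler_nat.
have -> : z%:R / M%:R - c = (z%:R / q - c) + z%:R / M%:R * (1 - M%:R / q).
  by field; rewrite !gt_eqF.
rewrite -[leRHS]addrA; apply: (le_trans (ler_normD _ _)); rewrite lerD2l; apply: le_trans MM.
by rewrite normrM (distrC 1) -[leRHS]mul1r ler_wpM2r // ger0_norm //.
Qed.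

Definition par_ratio w v k' : R :=
  #|nbr g w v (gb g w (VT :\ v)%SET k') :&: nbr h w v (gb h w (VT :\ v)%SET k')|%SET%:R /
  (maxn #|nbr g w v (gb g w (VT :\ v)%SET k')| #|nbr h w v (gb h w (VT :\ v)%SET k')|)%:R.

Lemma level_avg_ratio :
  \sum_(v in VR) Ex (fun w => `|par_ratio w v k - p11 / p * r0|) / #|V|%:R <=
  3 * t^-1 + 3 * lev_size g + 2 * lev_size h + lev_cap.
Proof.
have h1 := level_avg_nbr pg; have h2 := level_avg_nbr ph.
have h3 : \sum_(v in VR) Ex (fun w => `|#|nbr g w v (gb g w (VT :\ v)%SET k) :&: nbr h w v (gb h w (VT :\ v)%SET k)|%SET%:R / (p * m)
     - p11 / p * r0|) / #|V|%:R <= t^-1 + lev_size g + lev_cap.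
  rewrite -mulr_suml ler_pdivrMr //.
  apply: (@le_trans _ _ (\sum_(v in VR) (t^-1 + Ex (fun w => `|#|gb g w (VT :\ v)%SET k|%:R / m - 1|) +
      Ex (fun w => `|#|gcap g h w (VT :\ v)%SET k|%:R / m - r0|)))).
    by apply: ler_sum => v; rewrite VRP => vr; exact: level_cap.
  rewrite !big_split /=.
  have k1 : \sum_(v in VR) t^-1 <= #|V|%:R * t^-1 by apply: sum_le_card; rewrite ?invr_ge0 ?(ltW t0).
  have k2 := avg_removed g; have k3 := avg_cap_removed.
  apply: (le_trans (lerD (lerD k1 k2) k3)); rewrite le_eqVlt; apply/orP; left; apply/eqP.
  rewrite /lev_size /lev_cap; move: (Ex _) (Ex _) (Ex _) (Ex _) => q1 q2 q3 q4.
  by field; rewrite !gt_eqF.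
apply: (@le_trans _ _ (t^-1 + lev_size g + lev_cap + (t^-1 + 2 * lev_size g) + (t^-1 + 2 * lev_size h)));
  last by lra.
apply: le_trans (lerD (lerD h3 h1) h2); rewrite -!big_split /=; apply: ler_sum => v _.
rewrite -!mulrDl ler_wpM2r ?invr_ge0 // -!ExD; apply: ler_Ex => // w.
apply: ratio_dev; rewrite leq_max; apply/orP; left; apply: subset_leq_card; exact: subsetIl.
Qed.

End level.

End averages.

(** * Asymptotics of the critical distance *)

Section null_sequences.
Context {R : realType}.
Implicit Types (x y : nat -> R).

Lemma cvg0P x : x @ \oo --> (0 : R) <->
  (forall e : R, 0 < e -> \forall n \near \oo, `|x n| <= e).
Proof.
split=> [x0 e e0|h].
  by have /cvgr0Pnorm_le/(_ _ e0) := x0.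
by apply/cvgr0Pnorm_le.
Qed.

Lemma cvg0_le x y : y @ \oo --> (0 : R) ->
  (\forall n \near \oo, 0 <= x n <= y n) -> x @ \oo --> (0 : R).
Proof. by move=> y0 xy; exact: (squeeze_cvgr xy (cvg_cst _) y0). Qed.

Lemma cvg0D x y : x @ \oo --> (0 : R) -> y @ \oo --> (0 : R) ->
  (fun n => x n + y n) @ \oo --> (0 : R).
Proof. by move=> x0 y0; rewrite -[X in _ --> X](addr0 0); exact: cvgD. Qed.

Lemma cvg0M x y : x @ \oo --> (0 : R) -> y @ \oo --> (0 : R) ->
  (fun n => x n * y n) @ \oo --> (0 : R).
Proof. by move=> x0 y0; rewrite -[X in _ --> X](mulr0 0); exact: cvgM. Qed.

Lemma cvg0Z c x : x @ \oo --> (0 : R) -> (fun n => c * x n) @ \oo --> (0 : R).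
Proof. by move=> x0; rewrite -[X in _ --> X](mulr0 c); apply: cvgM => //; exact: cvg_cst. Qed.

Lemma cvg0_sqrt x : x @ \oo --> (0 : R) -> (fun n => Num.sqrt (x n)) @ \oo --> (0 : R).
Proof.
by move=> x0; rewrite -[X in _ --> X](@sqrtr0 R); exact: (continuous_cvg _ (@sqrt_continuous R _)).
Qed.

(** With [y = ln z], the bound [exp y >= y^(j+1) / (j+1)!] makes the quotient at most
    [(j+1)! / y]. *)
Lemma ln_pow_small (j : nat) (e : R) : 0 < e ->
  exists X : R, forall z : R, X <= z -> 1 < z /\ ln z ^+ j / z <= e.
Proof.
move=> e0; pose A := 1 + j.+1`!%:R / e.
have fe : 0 <= j.+1`!%:R / e by rewrite divr_ge0 // ltW.
have A1 : 1 <= A by rewrite lerDl.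
exists (expR A) => x Ax.
have x1 : 1 < x by apply: lt_le_trans Ax; rewrite -expR0 ltr_expR; lra.
have x0 : 0 < x by lra.
split=> //; set y := ln x.
have Ay : A <= y by rewrite -[A]expRK ler_ln ?posrE ?expR_gt0.
have y0 : 0 < y by lra.
have yx : y ^+ j.+1 / j.+1`!%:R <= x.
  rewrite -[X in _ <= X]lnK ?posrE // -/y.
  by apply: le_trans (expR_ge1Dxn j (ltW y0)); rewrite lerDr.
have f0 : 0 < j.+1`!%:R :> R by rewrite ltr0n fact_gt0.
rewrite ler_pdivrMr //; apply: (@le_trans _ _ (e * (y ^+ j.+1 / j.+1`!%:R))); last first.
  by rewrite ler_wpM2l // ltW.
have ye : 1 <= e / j.+1`!%:R * y.
  apply: (@le_trans _ _ (e / j.+1`!%:R * (j.+1`!%:R / e))); first by rewrite mulf_div (mulrC e) divff // mulf_neq0 // gt_eqF.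
  by apply: ler_wpM2l; [rewrite divr_ge0 // ltW|move: Ay; rewrite /A; lra].
rewrite exprS; have -> : e * (y * y ^+ j / j.+1`!%:R) = (e / j.+1`!%:R * y) * y ^+ j by ring.
by rewrite -[leLHS]mul1r ler_wpM2r // exprn_ge0 // ltW.
Qed.

End null_sequences.

(** * Growth of the mean degree and of the critical distance *)

Section critical_distance.
Context {R : realType} (alpha : nat -> R).
Hypothesis alpha_gt0 : forall n, 0 < alpha n.
Hypothesis alpha_liminf : (0 < limn_einf (EFin \o alpha))%E.
Hypothesis alpha_limsup : (limn_esup (EFin \o alpha) < +oo)%E.
Notation q := (edge_prob alpha).

Definition Nn n : R := n%:R * q n.

(* Sealed, so that no tactic evaluates the exponents Kn n. *)
Fact Kn_sig : {K : nat -> nat | forall n, K n = (`|dstar q n|%N).-1}.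
Proof. by exists (fun n => (`|dstar q n|%N).-1). Qed.

Definition Kn n : nat := sval Kn_sig n.
Notation lln n := (ln (ln n%:R) ^+ 2 : R).

Lemma alpha_lower : exists2 a, 0 < a & \forall n \near \oo, a <= alpha n.
Proof.
have := alpha_liminf; rewrite limn_einf_lim (cvg_lim _ (@cvg_einfs_sup _ _)) // => h.
have [_ [m _ <-]] := ereal_sup_gt h.
have lb k : (m <= k)%N -> (einfs (EFin \o alpha) m <= (alpha k)%:E)%E.
  by move=> mk; apply: ereal_inf_lbound; exists k.
move: (einfs _ m) lb => [a| |] lb // a0; last by have := lb m (leqnn m).
exists a; first by rewrite -lte_fin.
by exists m => // n /= mn; rewrite -lee_fin; exact: lb.
Qed.

Lemma alpha_upper : exists A, \forall n \near \oo, alpha n <= A.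
Proof.
have := alpha_limsup; rewrite limn_esup_lim (cvg_lim _ (@cvg_esups_inf _ _)) // => h.
have [_ [m _ <-]] := ereal_inf_lt h.
have ub k : (m <= k)%N -> ((alpha k)%:E <= esups (EFin \o alpha) m)%E.
  by move=> mk; apply: ereal_sup_ubound; exists k.
move: (esups _ m) ub => [a| |] ub // _; last by have := ub m (leqnn m).
by exists a; exists m => // n /= mn; rewrite -lee_fin; exact: ub.
Qed.

Lemma near_nat_ge (X : R) : \forall n \near \oo, X <= n%:R :> R.
Proof. exact: nbhs_infty_ger. Qed.

Lemma ln_pow_cvg j : (fun n => ln n%:R ^+ j / n%:R : R) @ \oo --> (0 : R).
Proof.
apply/cvg0P => e e0; have [X hX] := @ln_pow_small R j e e0.
near=> n; have Xn : X <= n%:R by near: n; exact: near_nat_ge.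
have [n1 le] := hX _ Xn; rewrite ger0_norm // divr_ge0 // exprn_ge0 // ln_ge0 // ltW //.
Unshelve. all: by end_near. Qed.

Lemma ln_nat_ge (X : R) : \forall n \near \oo, X <= ln n%:R.
Proof.
near=> n; rewrite -[X]expRK ler_ln ?posrE ?expR_gt0 //.
  by near: n; exact: near_nat_ge.
by apply: (@lt_le_trans _ _ 1) => //; near: n; exact: near_nat_ge.
Unshelve. all: by end_near. Qed.

Lemma lln_cvg : (fun n => lln n / ln n%:R) @ \oo --> (0 : R).
Proof.
apply/cvg0P => e e0; have [X hX] := @ln_pow_small R 2 e e0.
near=> n; have Xn : X <= ln n%:R by near: n; exact: ln_nat_ge.
have [n1 le] := hX _ Xn; rewrite ger0_norm // divr_ge0 ?sqr_ge0 //; lra.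
Unshelve. all: by end_near. Qed.

Lemma NnE n : (0 < n)%N -> Nn n = alpha n * ln n%:R.
Proof. by move=> n0; rewrite /Nn /edge_prob mulrC divfK // pnatr_eq0 -lt0n. Qed.

Lemma Nn_ge (c : R) : \forall n \near \oo, c <= Nn n.
Proof.
have [a a0 aN] := alpha_lower.
near=> n; rewrite NnE; last by near: n; exact: nbhs_infty_gt.
have an : a <= alpha n by near: n.
have ln1 : `|c| / a <= ln n%:R by near: n; exact: ln_nat_ge.
have ca : 0 <= `|c| / a by rewrite divr_ge0 // ltW.
apply: (le_trans (ler_norm c)); rewrite -[leLHS](divfK (lt0r_neq0 a0)) mulrC.
by apply: ler_pM => //; exact: ltW.
Unshelve. all: by end_near. Qed.

Lemma Nn_le : exists2 A, 0 < A & \forall n \near \oo, Nn n <= A * ln n%:R.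
Proof.
have [A AN] := alpha_upper; exists (Num.max A 1); first by rewrite lt_max ltr01 orbT.
near=> n; rewrite NnE; last by near: n; exact: nbhs_infty_gt.
have l0 : 0 <= ln n%:R :> R by near: n; exact: ln_nat_ge.
by rewrite ler_wpM2r // le_max; apply/orP; left; near: n.
Unshelve. all: by end_near. Qed.

Lemma lln_ge1 : \forall n \near \oo, 1 <= lln n.
Proof.
near=> n; have e1 : expR 1 <= ln n%:R :> R by near: n; exact: ln_nat_ge.
have l1 : 1 <= ln (ln n%:R) :> R.
  by rewrite -[leLHS]expRK ler_ln ?posrE ?expR_gt0 //; apply: lt_le_trans e1; exact: expR_gt0.
by rewrite exprn_ege1.
Unshelve. all: by end_near. Qed.

(** For large [n] one has [N >= 2] and [n / (log log n)^2 > 1], so no exponent [<= 0] qualifies and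
    the minimum over the integers is a positive natural number. Its minimality gives the strict
    bound at [K]. *)
Lemma dstarP : \forall n \near \oo, [/\ dstar q n = (Kn n).+1%:Z,
  Nn n ^+ Kn n < n%:R / lln n & n%:R / lln n <= Nn n ^+ (Kn n).+1].
Proof.
near=> n.
have N2 : 2 <= Nn n by near: n; exact: Nn_ge.
have l1 : 1 <= lln n by near: n; exact: lln_ge1.
have ly : lln n / ln n%:R <= 2^-1.
  have : `|lln n / ln n%:R| <= 2^-1 by near: n; move/cvg0P: lln_cvg; apply; rewrite invr_gt0.
  by apply: le_trans; exact: ler_norm.
have yn : ln n%:R ^+ 1 / n%:R <= 1 :> R.
  have : `|ln n%:R ^+ 1 / n%:R| <= 1 :> R by near: n; move/cvg0P: (ln_pow_cvg 1); apply.
  by apply: le_trans; exact: ler_norm.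
have y1 : 1 <= ln n%:R :> R by near: n; exact: ln_nat_ge.
have n1 : 1 <= n%:R :> R by near: n; exact: near_nat_ge.
set x := n%:R / lln n.
have l0 : 0 < lln n by lra.
have x1 : 1 < x.
  rewrite /x ltr_pdivlMr // mul1r; move: ly yn; rewrite expr1 !ler_pdivrMr; [|lra|lra].
  lra.
have exk : exists k, x <= Nn n ^+ k.
  have [k hk] : exists k : nat, x <= k%:R by exists (Num.bound x); rewrite ltW // archi_boundP; lra.
  exists k; apply: (le_trans hk); apply: (@le_trans _ _ (2 ^+ k)).
    by rewrite -natrX ler_nat ltnW // ltn_expl.
  by rewrite lerXn2r ?nnegrE //; lra.
have [k xk kmin] := ex_minnP exk.
have k0 : (0 < k)%N by rewrite lt0n; apply: contraTneq xk => ->; rewrite expr0 -ltNge.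
have Sd : [set d | [set d : int | x <= Nn n ^ d] d /\
    (forall d', [set d : int | x <= Nn n ^ d] d' -> d <= d')] k%:Z.
  split=> //= -[d'|d'] /= xd'.
    by rewrite lez_nat; apply: kmin.
  exfalso; move: xd'; apply/negP; rewrite -ltNge; apply: le_lt_trans x1.
  rewrite NegzE -exprnN invf_le1 ?exprn_gt0 //; last by lra.
  by rewrite exprn_ege1 //; lra.
have dk : dstar q n = k%:Z.
  rewrite /dstar; case: xgetP => [d _ [Sd1 Sd2]|/(_ k%:Z)]; last by move=> /(_ Sd).
  by apply/eqP; rewrite eq_le; case: Sd => S1 S2; rewrite (Sd2 _ S1) (S2 _ Sd1).
have Kk : (Kn n).+1 = k by rewrite /Kn (svalP Kn_sig) dk absz_nat prednK.
rewrite Kk dk; split=> //; rewrite ltNge; apply/negP => /kmin.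
by rewrite -Kk ltnn.
Unshelve. all: by end_near. Qed.

(** Here the divisor [(log log n)^2] in the definition of [d_n^*] acts: the power just below the
    threshold is [o(n)], not merely at most [n]. *)
Lemma Nn_Kn_small : (fun n => Nn n ^+ Kn n / n%:R) @ \oo --> (0 : R).
Proof.
have lc : (fun n => (lln n)^-1) @ \oo --> (0 : R).
  apply/cvg0P => e e0; near=> n.
  have el : expR (1 + e^-1) <= ln n%:R :> R by near: n; exact: ln_nat_ge.
  have e'0 : 0 < e^-1 by rewrite invr_gt0.
  have l1 : 1 + e^-1 <= ln (ln n%:R) :> R.
    by rewrite -[leLHS]expRK ler_ln ?posrE ?expR_gt0 //; apply: lt_le_trans el; exact: expR_gt0.
  have l2 : e^-1 <= lln n by rewrite expr2; nra.
  have l3 : 0 < lln n by exact: lt_le_trans l2.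
  rewrite ger0_norm ?invr_ge0 ?(ltW l3) // -[leRHS]invrK lef_pV2 ?posrE //.
apply: (cvg0_le lc); near=> n.
have n0 : 0 < n%:R :> R by rewrite ltr0n; near: n; exact: nbhs_infty_gt.
have N0 : 0 <= Nn n by near: n; exact: Nn_ge.
have [_ h _] : [/\ dstar q n = (Kn n).+1%:Z,
  Nn n ^+ Kn n < n%:R / lln n & n%:R / lln n <= Nn n ^+ (Kn n).+1] by near: n; exact: dstarP.
rewrite divr_ge0 ?exprn_ge0 ?(ltW n0) //= ler_pdivrMr // mulrC; exact: ltW.
Unshelve. all: by end_near. Qed.

Lemma Kn_le : \forall n \near \oo, (Kn n)%:R <= ln n%:R :> R.
Proof.
near=> n.
have l1 : 1 <= lln n by near: n; exact: lln_ge1.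
have Ne : expR 1 <= Nn n by near: n; exact: Nn_ge.
have n0 : 0 < n%:R :> R by rewrite ltr0n; near: n; exact: nbhs_infty_gt.
have [_ h _] : [/\ dstar q n = (Kn n).+1%:Z,
  Nn n ^+ Kn n < n%:R / lln n & n%:R / lln n <= Nn n ^+ (Kn n).+1] by near: n; exact: dstarP.
move: (Kn n) (Nn n) (ln (ln n%:R)) h Ne l1 => K M l h Ne l1.
rewrite -[leLHS]expRK ler_ln ?posrE ?expR_gt0 //.
have -> : expR K%:R = expR 1 ^+ K :> R by rewrite -expRM_natr mul1r.
apply: (@le_trans _ _ (M ^+ K)).
  by rewrite lerXn2r ?nnegrE ?expR_ge0 //; apply: le_trans Ne; exact: expR_ge0.
apply: (le_trans (ltW h)); rewrite ler_pdivrMr; last by lra.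
by rewrite -[leLHS]mulr1 ler_wpM2l // ltW.
Unshelve. all: by end_near. Qed.

Lemma Nn2_small : (fun n => Nn n ^+ 2 / n%:R) @ \oo --> (0 : R).
Proof.
have [A A0 NA] := Nn_le.
apply: (cvg0_le (cvg0Z (A ^+ 2) (ln_pow_cvg 2))); near=> n.
have N0 : 0 <= Nn n by near: n; exact: Nn_ge.
have h : Nn n <= A * ln n%:R by near: n.
rewrite divr_ge0 ?sqr_ge0 //= mulrA -exprMn ler_wpM2r ?invr_ge0 //.
by rewrite lerXn2r ?nnegrE //; apply: le_trans h.
Unshelve. all: by end_near. Qed.

Lemma Kn2_small : (fun n => (Kn n)%:R ^+ 2 / n%:R) @ \oo --> (0 : R).
Proof.
apply: (cvg0_le (ln_pow_cvg 2)); near=> n.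
have h : (Kn n)%:R <= ln n%:R :> R by near: n; exact: Kn_le.
rewrite divr_ge0 ?sqr_ge0 //= ler_wpM2r ?invr_ge0 //.
by rewrite lerXn2r ?nnegrE //; apply: le_trans h.
Unshelve. all: by end_near. Qed.

Lemma invn_small : (fun n => n%:R^-1) @ \oo --> (0 : R).
Proof. by have := ln_pow_cvg 0; under eq_fun do rewrite expr0 div1r. Qed.

Lemma invNn_small : (fun n => (Nn n)^-1) @ \oo --> (0 : R).
Proof.
apply/cvg0P => e e0; near=> n.
have h : e^-1 <= Nn n by near: n; exact: Nn_ge.
have e'0 : 0 < e^-1 by rewrite invr_gt0.
have N0 : 0 < Nn n by lra.
by rewrite ger0_norm ?invr_ge0 ?(ltW N0) // -[leRHS]invrK lef_pV2 ?posrE.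
Unshelve. all: by end_near. Qed.

(** The mean degree is [O(log n)], so boundedly many factors cannot reach [n / (log log n)^2]. This
    makes [rho_n ^ K] vanish in the limit when [rho < 1]. *)
Lemma Kn_ge J : \forall n \near \oo, (J <= Kn n)%N.
Proof.
have [A A0 NA] := Nn_le.
have c : (fun n => A ^+ J * (ln n%:R ^+ J.+2 / n%:R)) @ \oo --> (0 : R).
  exact: cvg0Z (ln_pow_cvg _).
near=> n.
have N1 : 1 <= Nn n by near: n; exact: Nn_ge.
have h : Nn n <= A * ln n%:R by near: n.
have n0 : 0 < n%:R :> R by rewrite ltr0n; near: n; exact: nbhs_infty_gt.
have y1 : 1 <= ln n%:R :> R by near: n; exact: ln_nat_ge.
have l1 : 1 <= lln n by near: n; exact: lln_ge1.
have l0 : 0 < lln n by lra.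
have sm : A ^+ J * (ln n%:R ^+ J.+2 / n%:R) <= 2^-1.
  have : `|A ^+ J * (ln n%:R ^+ J.+2 / n%:R)| <= 2^-1 by near: n; move/cvg0P: c; apply; rewrite invr_gt0.
  by apply: le_trans; exact: ler_norm.
have [_ _ k1] : [/\ dstar q n = (Kn n).+1%:Z,
  Nn n ^+ Kn n < n%:R / lln n & n%:R / lln n <= Nn n ^+ (Kn n).+1] by near: n; exact: dstarP.
move: (Kn n) (Nn n) k1 h N1 => K M k1 h N1; rewrite leqNgt; apply/negP => KJ.
have NJ : M ^+ K.+1 <= M ^+ J by apply: ler_weXn2l.
have M0 : 0 <= M by exact: le_trans N1.
have NJ2 : M ^+ J <= A ^+ J * ln n%:R ^+ J.
  by rewrite -exprMn lerXn2r ?nnegrE //; exact: le_trans h.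
have lly : lln n <= ln n%:R ^+ 2.
  have y0 : 0 < ln n%:R :> R by exact: lt_le_trans y1.
  rewrite lerXn2r ?nnegrE //; [exact: ln_ge0|exact: ltW|].
  by apply: ltW; apply: ln_sublinear.
have := le_trans k1 (le_trans NJ NJ2); rewrite ler_pdivrMr // => nle.
have : n%:R <= A ^+ J * ln n%:R ^+ J.+2.
  apply: (le_trans nle); rewrite -mulrA ler_wpM2l ?exprn_ge0 ?(ltW A0) //.
  by rewrite -[J.+2]addn2 exprD ler_wpM2l // exprn_ge0 // (le_trans ler01).
apply/negP; rewrite -ltNge; move: sm; rewrite mulrA ler_pdivrMr // => /le_lt_trans; apply.
by rewrite gtr_pMl // invf_lt1 // ltr1n.
Unshelve. all: by end_near. Qed.

(** For the case [lambda = 1], where [q_n N^(K+1) = N N^(K+1) / n >= N / (log log n)^2] has to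
    diverge. *)
Lemma lln_Nn_small : (fun n => lln n / Nn n) @ \oo --> (0 : R).
Proof.
have [a a0 aN] := alpha_lower.
apply: (cvg0_le (cvg0Z a^-1 lln_cvg)); near=> n.
have an : a <= alpha n by near: n.
have y1 : 1 <= ln n%:R :> R by near: n; exact: ln_nat_ge.
have y0 : 0 < ln n%:R :> R by lra.
have NE : Nn n = alpha n * ln n%:R by apply: NnE; near: n; exact: nbhs_infty_gt.
have N0 : 0 < Nn n by rewrite NE mulr_gt0.
have le : a * ln n%:R <= Nn n by rewrite NE ler_wpM2r // ltW.
have ay : 0 < a * ln n%:R by rewrite mulr_gt0.
have : (Nn n)^-1 <= (a * ln n%:R)^-1 by rewrite lef_pV2 ?posrE.
rewrite [(a * _)^-1]invfM => iN; apply/andP; split; first by rewrite divr_ge0 ?sqr_ge0 // ltW.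
by rewrite mulrCA; apply: ler_wpM2l => //; exact: sqr_ge0.
Unshelve. all: by end_near. Qed.

Lemma near_q01 : \forall n \near \oo, 0 < q n <= 1.
Proof.
near=> n.
have n0 : 0 < n%:R :> R by rewrite ltr0n; near: n; exact: nbhs_infty_gt.
have N1 : 1 <= Nn n by near: n; exact: Nn_ge.
have N2 : Nn n ^+ 2 / n%:R <= 1.
  have : `|Nn n ^+ 2 / n%:R| <= 1 by near: n; move/cvg0P: Nn2_small; apply.
  by apply: le_trans; exact: ler_norm.
have qE : q n = Nn n / n%:R by rewrite /Nn mulrC mulKf // gt_eqF.
rewrite qE divr_gt0 //=; last by lra.
by move: N2; rewrite !ler_pdivrMr // mul1r; nra.
Unshelve. all: by end_near. Qed.

End critical_distance.

(** * The Poisson functional of the statement *)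

Section poisson_integral.
Context {R : realType}.
Implicit Types (a b : R).

Lemma ge0_integral_nat (m : {measure set nat -> \bar R}) (f : nat -> \bar R) :
  (forall k, 0 <= f k)%E -> (forall k, f k \is a fin_num) ->
  (\int[m]_x f x = \sum_(0 <= k <oo) (f k * m [set k]))%E.
Proof.
move=> f0 ffin.
have TU : [set: nat] = \bigcup_k [set k] by apply/seteqP; split => // k _; exists k.
rewrite TU ge0_integral_bigcup //=; last first.
  by apply/trivIsetP => i j _ _ ij; apply/seteqP; split => // x [/= -> ji]; rewrite ji eqxx in ij.
apply: eq_eseriesr => k _.
rewrite (eq_integral (cst (f k))); last by move=> x /set_mem /= ->.
by rewrite -(fineK (ffin k)) integral_cst.
Qed.

Lemma poisson_prob_set1 a k : 0 < a -> poisson_prob a 0%N [set k] = (pois a k)%:E.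
Proof.
move=> a0; rewrite /poisson_prob a0 esum_set1; last by rewrite lee_fin poisson_pmf_ge0.
by rewrite /poisson_pmf a0.
Qed.

Lemma integral_poisson a (f : nat -> R) : 0 < a -> unit_valued f ->
  (\int[poisson_prob a 0%N]_x (f x)%:E = (Poi a f)%:E)%E.
Proof.
move=> a0 f01; rewrite ge0_integral_nat //; last by move=> k; rewrite lee_fin; case/andP: (f01 k).
rewrite -Poi_series ?(ltW a0) //; apply: eq_eseriesr => k _.
by rewrite mulrC EFinM; congr (_ * _)%E; exact: poisson_prob_set1.
Qed.

Lemma measurable_nat2 (A : set (nat * nat)) : measurable A.
Proof.
apply: countable_measurable; last exact: countableP.
move=> [i j]; rewrite (_ : [set (i, j)] = [set i] `*` [set j]); first exact: measurableX.
by apply/seteqP; split => [[x y] [-> ->]|[x y] [/= -> ->]].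
Qed.

Lemma measurable_nat3 (A : set (nat * nat * nat)) : measurable A.
Proof.
apply: countable_measurable; last exact: countableP.
move=> [i j]; rewrite (_ : [set (i, j)] = [set i] `*` [set j]).
  by apply: measurableX => //; exact: measurable_nat2.
by apply/seteqP; split => [[x y] [-> ->]|[x y] [/= -> ->]].
Qed.

Let pp a : subprobability nat R := poisson_prob a 0%N.

(** Packaged as a subprobability to supply the finiteness that Tonelli's theorem asks for. *)
Let pp2 a : subprobability (nat * nat)%type R := product_subprobability (pp a, pp a).

Lemma poisson3_fubini a b (f : nat * nat * nat -> \bar R) : (forall w, 0 <= f w)%E ->
  (\int[poisson3 a b]_w f w = \int[pp2 a]_x \int[pp b]_y f (x, y))%E.
Proof.
move=> f0; rewrite -[RHS](@fubini_tonelli1 _ _ (nat * nat)%type nat R (pp2 a) (pp b) f) //.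
by move=> _ Y mY; exact: measurable_nat3.
Qed.

Lemma poisson2_fubini a (f : nat * nat -> \bar R) : (forall w, 0 <= f w)%E ->
  (\int[pp2 a]_x f x = \int[pp a]_x \int[pp a]_y f (x, y))%E.
Proof.
move=> f0; rewrite -[RHS](@fubini_tonelli1 _ _ nat nat R (pp a) (pp a) f) //.
by move=> _ Y mY; exact: measurable_nat2.
Qed.

Lemma integral_poisson3 a b (F : nat -> nat -> nat -> R) : 0 < a -> 0 < b -> unit_valued3 F ->
  (\int[poisson3 a b]_w (F w.1.1 w.1.2 w.2)%:E = (Poi3 a a b F)%:E)%E.
Proof.
move=> a0 b0 F01; rewrite poisson3_fubini; last first.
  by move=> w; rewrite lee_fin; case/andP: (F01 w.1.1 w.1.2 w.2).
transitivity (\int[pp2 a]_x (Poi b (F x.1 x.2))%:E)%E.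
  by apply: eq_integral => x _; exact: (@integral_poisson b (F x.1 x.2)).
rewrite poisson2_fubini; last by move=> x; rewrite lee_fin Poi_ge0 // ltW.
rewrite /Poi3 -integral_poisson //; last first.
  by move=> i; apply: Poi_unit; [exact: ltW|move=> j; apply: Poi_unit => //; exact: ltW].
apply: eq_integral => i _; apply: (@integral_poisson a (fun j => Poi b (F i j))) => //.
by move=> j; apply: Poi_unit => //; exact: ltW.
Qed.

Lemma Poi_pos b : 0 <= b -> Poi b (fun k => (0 < k)%N%:R) = 1 - expR (- b).
Proof.
move=> b0; rewrite -(Poi_eq0 b0); apply/eqP; rewrite eq_sym subr_eq; apply/eqP.
apply: EFin_inj; rewrite EFinD -!Poi_series //; last 2 first.
- by move=> [|k]; rewrite /= ?lexx ?ler01.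
- by move=> [|k]; rewrite /= ?lexx ?ler01.
rewrite -nneseriesD; last 2 first.
- by move=> k _ _; rewrite lee_fin mulr_ge0 ?pois_ge0.
- by move=> k _ _; rewrite lee_fin mulr_ge0 ?pois_ge0.
rewrite -[LHS](pois_sum1 b0); apply: eq_eseriesr => k _; rewrite -EFinD -mulrDr.
by case: k => [|k] /=; rewrite ?add0r ?addr0 mulr1.
Qed.

Lemma poisson3_pos a b : 0 < a -> 0 < b ->
  poisson3 a b [set w | (0 < w.2)%N] = (1 - expR (- b))%:E.
Proof.
move=> a0 b0; have U1 : unit_valued3 (fun (i j k : nat) => (0 < k)%N%:R : R).
  by move=> i j [|k]; rewrite /= ?lexx ?ler01.
have -> : poisson3 a b [set w | (0 < w.2)%N] =
    (\int[poisson3 a b]_w ((0 < w.2)%N%:R : R)%:E)%E.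
  rewrite -[LHS]mul1e -(integral_cst (poisson3 a b) (measurable_nat3 _) 1) /= integral_mkcond.
  apply: eq_integral => w _; rewrite patchE; case: ifPn; first by rewrite inE /= => ->.
  by rewrite notin_setE /= => /negP; rewrite -leqNgt leqn0 => /eqP ->.
rewrite (integral_poisson3 a0 b0 U1); congr EFin.
have Pb := Poi_pos (ltW b0).
have cst c : 0 <= c <= 1 -> Poi a (fun=> c) = c.
  move=> c01; have u : unit_valued (fun=> c : R) by [].
  apply: EFin_inj; rewrite -Poi_series ?(ltW a0) //.
  under eq_eseriesr do rewrite mulrC EFinM.
  rewrite nneseriesZl; last by move=> k _; rewrite lee_fin pois_ge0 // ltW.
  by rewrite pois_sum1 ?mule1 // ltW.
have e01 : 0 <= 1 - expR (- b) <= 1.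
  by rewrite -Pb; apply: Poi_unit; [exact: ltW|exact: (U1 0%N 0%N)].
by rewrite /Poi3 Pb !cst.
Qed.

Definition ratio3 (i j k : nat) : R := k%:R / (maxn i j + k)%N%:R.

Lemma ratio3_unit : unit_valued3 ratio3.
Proof.
move=> i j [|k]; rewrite /ratio3; first by rewrite mul0r lexx ler01.
have h : 0 < (maxn i j + k.+1)%N%:R :> R by rewrite ltr0n addnS.
by rewrite divr_ge0 //= ler_pdivrMr // mul1r ler_nat leq_addl.
Qed.

(** Multiplying by the probability of [Z > 0] removes the conditioning, and the ratio vanishes at
    [Z = 0]. *)
Lemma gPoissonE a b : 0 < a -> 0 < b ->
  gPoisson a b * (1 - expR (- b)) = Poi3 a a b ratio3.
Proof.
move=> a0 b0; rewrite /gPoisson poisson3_pos //=.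
have e1 : 1 - expR (- b) != 0 by rewrite subr_eq0 eq_sym lt_eqF // -expR0 ltr_expR oppr_lt0.
rewrite divfK //; have := integral_poisson3 a0 b0 ratio3_unit => IE.
rewrite -[RHS]/(fine (Poi3 a a b ratio3)%:E) -IE integral_mkcond; congr fine.
apply: eq_integral => w _; rewrite patchE; case: ifPn => //.
rewrite notin_setE /= => /negP; rewrite -leqNgt leqn0 => /eqP w0.
by rewrite /ratio3 w0 mul0r.
Qed.

End poisson_integral.

(** * Distances and parent sets in terms of balls *)

Section parents.
Context {R : realType} {n : nat} {T : finType}.
Variables (g h : T -> bool) (w : {ffun edge n -> T}).
Notation V := (vertex n).
Notation r := (origin n).
Notation VT := [set: V]%SET.
Implicit Types (v : V) (k : nat).

Let B1 k := gb g w VT k.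
Let B2 k := gb h w VT k.
Let Y1 v k := #|nbr g w v (gb g w (VT :\ v)%SET k)|.
Let Y2 v k := #|nbr h w v (gb h w (VT :\ v)%SET k)|.

Lemma at_distE (f : T -> bool) v k :
  at_dist (gr f w) r k.+1%:Z v = (v \in gb f w VT k.+1) && (v \notin gb f w VT k).
Proof.
rewrite /at_dist /gb !gball_gdistP; case: gdist => [m|//].
by rewrite -ltnNge eqz_nat eqn_leq.
Qed.

Lemma mem_gb_leq (f : T -> bool) U v k l : (k <= l)%N -> v \in gb f w U k -> v \in gb f w U l.
Proof. by move=> kl; apply/fintype.subsetP; exact: gball_leq. Qed.

(** A vertex outside both balls of radius [k] and inside both of radius [k + 2] has only two
    possible distances, so these agree exactly when it misses both or neither of the balls of radius
    [k + 1]. For [a], [b] in {0, 1} that indicator is [1 - a - b + 2 a b]. Other vertices are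
    charged to the right side. *)
Lemma same_dist_bound v k :
  `|(gdist (gr g w) r v == gdist (gr h w) r v)%:R -
    (1 - (v \notin B1 k.+1)%:R - (v \notin B2 k.+1)%:R +
     2 * ((v \notin B1 k.+1) && (v \notin B2 k.+1))%:R)| <=
  (v \in B1 k)%:R + (v \in B2 k)%:R + (v \notin B1 k.+2)%:R + (v \notin B2 k.+2)%:R :> R.
Proof.
rewrite /B1 /B2 /gb !gball_gdistP.
have key (a b : option nat) :
  [|| (if a is Some m then m <= k else false), (if b is Some m then m <= k else false),
     ~~ (if a is Some m then m <= k.+2 else false) | ~~ (if b is Some m then m <= k.+2 else false)]%N ||
  ((a == b) == ((if a is Some m then m <= k.+1 else false) == (if b is Some m then m <= k.+1 else false)))%N.
  case: a => [a|] //=; case: b => [b|] //=; rewrite ?orbT //.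
  have -> : (Some a == Some b) = (a == b) by [].
  case: (leqP a k) => //= ka; case: (leqP b k) => //= kb.
  case: (leqP a k.+2) => //= ka2; case: (leqP b k.+2) => //= kb2.
  by apply/eqP; apply/eqP/eqP; lia.
have := key (gdist (gr g w) r v) (gdist (gr h w) r v).
have gen (e a1 a2 b1 b2 c1 c2 : bool) : [|| a1, a2, ~~ c1 | ~~ c2] || (e == (b1 == b2)) ->
  `|e%:R - (1 - (~~ b1)%:R - (~~ b2)%:R + 2 * (~~ b1 && ~~ b2)%:R)| <=
  a1%:R + a2%:R + (~~ c1)%:R + (~~ c2)%:R :> R.
  by case: e; case: a1; case: a2; case: b1; case: b2; case: c1; case: c2 => //= _;
    rewrite ?mulr0n ?mulr1n ler_norml; apply/andP; split; lra.
exact: gen.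
Qed.

Lemma both_dist_bound v k :
  `|(at_dist (gr g w) r k.+1%:Z v && at_dist (gr h w) r k.+1%:Z v)%:R -
    (1 - (v \notin B1 k.+1)%:R - (v \notin B2 k.+1)%:R +
     ((v \notin B1 k.+1) && (v \notin B2 k.+1))%:R)| <=
  (v \in B1 k)%:R + (v \in B2 k)%:R :> R.
Proof.
rewrite !at_distE -/(B1 _) -/(B2 _) -/(B1 _) -/(B2 _).
case: (v \in B1 k.+1); case: (v \in B2 k.+1); case: (v \in B1 k); case: (v \in B2 k);
  rewrite /= ?mulr0n ?mulr1n ler_norml; apply/andP; split; lra.
Qed.

Lemma par_nbr (f : T -> bool) v k : v != r ->
  v \in gb f w VT k.+1 -> v \notin gb f w VT k ->
  par (gr f w) r v = nbr f w v (gb f w (VT :\ v)%SET k).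
Proof. exact: par_ball. Qed.

Lemma Y_eq0 (f : T -> bool) v k : v != r ->
  (#|nbr f w v (gb f w (VT :\ v)%SET k)| == 0%N) = (v \notin gb f w VT k.+1).
Proof. by move=> vr; rewrite in_gbS ?inE // -eqn0Ngt. Qed.

Definition phi v : R :=
  #|par (gr g w) r v :&: par (gr h w) r v|%SET%:R /
  (maxn #|par (gr g w) r v| #|par (gr h w) r v|)%:R.

Lemma ratio_unit (z y1 y2 : nat) : (z <= y1)%N ->
  (0 <= z%:R / (maxn y1 y2)%:R :> R) && (z%:R / (maxn y1 y2)%:R <= 1 :> R).
Proof.
move=> zy; rewrite divr_ge0 //=; have [->|M0] := posnP (maxn y1 y2).
  by rewrite invr0 mulr0 ler01.
by rewrite ler_pdivrMr ?ltr0n // mul1r ler_nat; apply: leq_trans zy (leq_maxl _ _).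
Qed.

Lemma phi_unit v : 0 <= phi v <= 1.
Proof. by apply: ratio_unit; apply: subset_leq_card; exact: subsetIl. Qed.

Lemma phi_ratio v k : v != r -> v \in B1 k.+1 -> v \notin B1 k -> v \in B2 k.+1 -> v \notin B2 k ->
  phi v = par_ratio g h w v k.
Proof. by move=> vr v1 v1' v2 v2'; rewrite /phi (par_nbr vr v1 v1') (par_nbr vr v2 v2'). Qed.

(** Meant for [lambda] in {0, 1}, where almost all vertices are at distance [k + 1] in both graphs
    for a suitable [k]; each exceptional one costs at most 1. *)
Lemma phi_bound v k (c : R) : v != r -> 0 <= c <= 1 ->
  `|phi v - c| <= (v \in B1 k)%:R + (v \in B2 k)%:R + (v \notin B1 k.+1)%:R + (v \notin B2 k.+1)%:R +
    `|par_ratio g h w v k - c|.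
Proof.
move=> vr /andP[c0 c1]; have /andP[f0 f1] := phi_unit v.
have le1 : `|phi v - c| <= 1 by rewrite ler_norml; apply/andP; split; lra.
have n0 := normr_ge0 (par_ratio g h w v k - c).
case: (boolP (v \in B1 k)) => a1; first by rewrite mulr1n -!addrA (le_trans le1) // lerDl !addr_ge0.
case: (boolP (v \in B2 k)) => a2; first by rewrite mulr1n mulr0n add0r -!addrA (le_trans le1) // lerDl !addr_ge0.
case: (boolP (v \in B1 k.+1)) => b1; last by rewrite mulr0n mulr1n !add0r -!addrA (le_trans le1) // lerDl !addr_ge0.
case: (boolP (v \in B2 k.+1)) => b2; last by rewrite mulr0n mulr1n !add0r (le_trans le1) // lerDl.
by rewrite !mulr0n !add0r (phi_ratio vr b1 a1 b2 a2).
Qed.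

(** Disposes of the vertices whose parents lie at different levels in the two graphs: one parent set
    is close to [m], the other much smaller. *)
Lemma ratio_small (z y1 y2 : nat) (m : R) : 0 < m -> (z <= y1)%N ->
  z%:R / (maxn y1 y2)%:R <= `|y2%:R / m - 1| + y1%:R / m.
Proof.
move=> m0 zy; have [M0|M0] := posnP (maxn y1 y2).
  by rewrite M0 invr0 mulr0 addr_ge0 // divr_ge0 // ltW.
have /andP[f0 f1] := ratio_unit y2 zy.
set M := maxn y1 y2 in M0 f0 f1 *; set f := z%:R / M%:R in f0 f1 *.
have Mr : 0 < M%:R :> R by rewrite ltr0n.
have -> : f = f * (1 - M%:R / m) + z%:R / m by rewrite /f; field; rewrite !gt_eqF.
apply: lerD; last by rewrite ler_wpM2r ?invr_ge0 ?(ltW m0) // ler_nat.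
have yM : y2%:R / m <= M%:R / m by rewrite ler_wpM2r ?invr_ge0 ?(ltW m0) // ler_nat leq_maxr.
have := ler_norm (1 - y2%:R / m); rewrite distrC => hn.
have n0 := normr_ge0 (y2%:R / m - 1); nra.
Qed.

Lemma par_ratio0 v k : v != r -> (v \notin B1 k.+1) || (v \notin B2 k.+1) ->
  par_ratio g h w v k = 0 :> R.
Proof.
move=> vr; rewrite -!Y_eq0 // /par_ratio; case/orP; rewrite cards_eq0 => /eqP ->.
  by rewrite finset.set0I cards0 mul0r.
by rewrite finset.setI0 cards0 mul0r.
Qed.

(** Four cases by membership in the two balls of radius [k + 1]. The ratio at radius [k] vanishes
    unless [v] is in both, so it needs no indicator; [c] stands for the ratio of the vertices
    outside both. The mixed cases go to [ratio_small]. *)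
Lemma phi_mid_bound v k (c m : R) : v != r -> 0 <= c <= 1 -> 0 < m ->
  `|phi v - (par_ratio g h w v k + c * ((v \notin B1 k.+1) && (v \notin B2 k.+1))%:R)| <=
  (v \in B1 k)%:R + (v \in B2 k)%:R +
  (`|(Y1 v k.+1)%:R / m - 1| + `|(Y2 v k.+1)%:R / m - 1| + `|par_ratio g h w v k.+1 - c| +
   ((Y1 v k)%:R / m + (Y2 v k)%:R / m)).
Proof.
move=> vr /andP[c0 c1] m0; have /andP[f0 f1] := phi_unit v.
have [p0 p1] : 0 <= par_ratio g h w v k :> R /\ par_ratio g h w v k <= 1 :> R.
  by apply/andP/ratio_unit; apply: subset_leq_card; exact: subsetIl.
have n1 := normr_ge0 ((Y1 v k.+1)%:R / m - 1); have n2 := normr_ge0 ((Y2 v k.+1)%:R / m - 1).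
have n3 := normr_ge0 (par_ratio g h w v k.+1 - c).
have y1 : 0 <= (Y1 v k)%:R / m by rewrite divr_ge0 // ltW.
have y2 : 0 <= (Y2 v k)%:R / m by rewrite divr_ge0 // ltW.
have up (b : bool) : (b -> par_ratio g h w v k = 0 :> R) ->
    `|phi v - (par_ratio g h w v k + c * b%:R)| <= 1.
  case: b => [/(_ isT) ->|_]; rewrite /= ?mulr0n ?mulr1n ler_norml; apply/andP; split; lra.
have up' : `|phi v - (par_ratio g h w v k + c * ((v \notin B1 k.+1) && (v \notin B2 k.+1))%:R)| <= 1.
  by apply: up => /andP[b1 _]; apply: par_ratio0 => //; rewrite b1.
have tail0 : 0 <= `|(Y1 v k.+1)%:R / m - 1| + `|(Y2 v k.+1)%:R / m - 1| +
    `|par_ratio g h w v k.+1 - c| + ((Y1 v k)%:R / m + (Y2 v k)%:R / m) by lra.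
case: (boolP (v \in B1 k)) => a1.
  by apply: (le_trans up'); rewrite mulr1n -addrA lerDl addr_ge0.
case: (boolP (v \in B2 k)) => a2.
  by apply: (le_trans up'); rewrite mulr1n mulr0n add0r lerDl.
rewrite mulr0n !add0r.
case: (boolP (v \in B1 k.+1)) => b1; case: (boolP (v \in B2 k.+1)) => b2 /=.
- by rewrite mulr0n mulr0 addr0 (phi_ratio vr b1 a1 b2 a2) subrr normr0; lra.
- rewrite (par_ratio0 vr) ?b2 ?orbT // mulr0n mulr0 addr0 subr0 ger0_norm //.
  case: (boolP (v \in B2 k.+2)) => c2.
    have := @ratio_small #|par (gr g w) r v :&: par (gr h w) r v|%SET #|par (gr g w) r v| #|par (gr h w) r v| m m0
      (subset_leq_card (subsetIl _ _)).
    rewrite -/(phi v) (par_nbr vr b1 a1) (par_nbr vr c2 b2) -/(Y1 v k) -/(Y2 v k.+1).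
    lra.
  (* Outside the ball of radius [k + 2] there is no neighbour in that of radius [k + 1], and
     [|0 / m - 1| = 1] pays for the error. *)
  have /eqP -> : Y2 v k.+1 == 0%N by rewrite /Y2 Y_eq0.
  rewrite mul0r sub0r normrN1; lra.
- rewrite (par_ratio0 vr) ?b1 // mulr0n mulr0 addr0 subr0 ger0_norm //.
  case: (boolP (v \in B1 k.+2)) => c2'.
    have := @ratio_small #|par (gr h w) r v :&: par (gr g w) r v|%SET #|par (gr h w) r v| #|par (gr g w) r v| m m0
      (subset_leq_card (subsetIl _ _)).
    rewrite finset.setIC maxnC -/(phi v) (par_nbr vr c2' b1) (par_nbr vr b2 a2) -/(Y1 v k.+1) -/(Y2 v k).
    lra.
  have /eqP -> : Y1 v k.+1 == 0%N by rewrite /Y1 Y_eq0.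
  rewrite mul0r sub0r normrN1; lra.
- rewrite (par_ratio0 vr) ?b1 // mulr1n mulr1 add0r.
  have le1 : `|phi v - c| <= 1 by rewrite ler_norml; apply/andP; split; lra.
  case: (boolP (v \in B1 k.+2)) => c1'; last first.
    have /eqP -> : Y1 v k.+1 == 0%N by rewrite /Y1 Y_eq0.
    by rewrite mul0r sub0r normrN1; lra.
  case: (boolP (v \in B2 k.+2)) => c2'; last first.
    have /eqP -> : Y2 v k.+1 == 0%N by rewrite /Y2 Y_eq0.
    by rewrite mul0r sub0r normrN1; lra.
  rewrite (phi_ratio vr c1' b1 c2' b2); lra.
Qed.

End parents.

(** * The correlated pair of graphs *)

Section correlated_pair.
Context {R : realType}.
Implicit Types (q rho : R).

Definition mu3 q rho (t : bool * bool * bool) : R :=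
  bernoulli_pmf q t.1.1 * bernoulli_pmf rho t.1.2 * bernoulli_pmf q t.2.

Definition sel1 (t : bool * bool * bool) : bool := t.1.1.
Definition sel2 (t : bool * bool * bool) : bool := if t.1.2 then t.1.1 else t.2.

Lemma sum_bool3 (F : bool * bool * bool -> R) :
  \sum_t F t = \sum_(a : bool) \sum_(b : bool) \sum_(c : bool) F (a, b, c).
Proof.
rewrite pair_bigA pair_bigA /=; apply: eq_bigr => -[[a b] c] _ //.
Qed.

Lemma mu3_ge0 q rho t : 0 <= q <= 1 -> 0 <= rho <= 1 -> 0 <= mu3 q rho t.
Proof. by move=> q01 r01; rewrite !mulr_ge0 ?bernoulli_pmf_ge0. Qed.

Lemma mu3_sum1 q rho : \sum_t mu3 q rho t = 1.
Proof. by rewrite sum_bool3 !big_bool /mu3 /bernoulli_pmf /=; ring. Qed.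

Lemma prob_sel1 q rho : prob1 (mu3 q rho) sel1 = q.
Proof. by rewrite /prob1 /expect1 sum_bool3 !big_bool /mu3 /bernoulli_pmf /sel1 /=; ring. Qed.

Lemma prob_sel2 q rho : prob1 (mu3 q rho) sel2 = q.
Proof. by rewrite /prob1 /expect1 sum_bool3 !big_bool /mu3 /bernoulli_pmf /sel2 /=; ring. Qed.

Lemma prob_sel12 q rho :
  prob1 (mu3 q rho) (fun t => sel1 t && sel2 t) = rho * q + (1 - rho) * q ^+ 2.
Proof. by rewrite /prob1 /expect1 sum_bool3 !big_bool /mu3 /bernoulli_pmf /sel1 /sel2 /=; ring. Qed.

Definition E3 n q rho (f : sample n -> R) : R := @Ex R (edge n) _ (mu3 q rho) f.

Lemma markov_Pr n q rho (X : sample n -> R) (e : R) : 0 <= q <= 1 -> 0 <= rho <= 1 -> 0 < e ->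
  0 <= Pr q rho [pred w | e < `|X w|] <= e^-1 * E3 q rho (fun w => `|X w|).
Proof.
move=> q01 r01 e0; apply/andP; split.
  by apply: sumr_ge0 => w _; apply: (@pweight_ge0 R (edge n) _ (mu3 q rho)) => t; exact: mu3_ge0.
rewrite /Pr big_mkcond /E3 -ExZ; apply: ler_sum => w _ /=.
have w0 : 0 <= pweight (mu3 q rho) w by apply: pweight_ge0 => t; exact: mu3_ge0.
case: ifP => [eX|_]; last by rewrite !mulr_ge0 ?invr_ge0 ?(ltW e0).
rewrite -[leLHS]mulr1 -/(pweight (mu3 q rho) w) ler_wpM2l //.
by rewrite mulrC ler_pdivlMr // mul1r ltW.
Qed.

Lemma cvg_in_prob_L1 (q rho : nat -> R) (X : forall n, sample n -> R) (l : R) :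
  (\forall n \near \oo, 0 <= q n <= 1) -> (forall n, 0 <= rho n <= 1) ->
  (fun n => E3 (q n) (rho n) (fun w => `|X n w - l|)) @ \oo --> (0 : R) ->
  cvg_in_prob q rho X l.
Proof.
move=> q01 r01 XL e e0; apply: (cvg0_le (cvg0Z e^-1 XL)); near=> n.
have q01n : 0 <= q n <= 1 by near: n.
exact: (@markov_Pr n (q n) (rho n) (fun w => X n w - l) e q01n (r01 n) e0).
Unshelve. all: by end_near. Qed.

(** Uniform in [L], which will be [Ln n] and diverges when [lambda = 0]. From [1/2] on, the slope is
    at most [L exp (- L / 2) <= 1]; below [1/2], the distance to [y >= 1] is at least [1/2] while
    the exponentials differ by at most 1. *)
Lemma expR_lip (L x y : R) : 0 <= L -> 0 <= x -> 1 <= y ->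
  `|expR (- (L * x)) - expR (- (L * y))| <= 2 * `|x - y|.
Proof.
move=> L0 x0 y1.
have le1 z : 0 <= z -> expR (- (L * z)) <= 1.
  by move=> z0; rewrite -expR0 ler_expR oppr_le0 mulr_ge0.
have [xh|xh] := leP x 2^-1.
  have d : 2^-1 <= `|x - y|.
    by have := ler_norm (y - x); rewrite distrC; lra.
  have := expR_ge0 (- (L * x)); have := expR_ge0 (- (L * y)).
  have := le1 x x0; have := le1 y (le_trans ler01 y1).
  by move=> *; rewrite ler_norml; apply/andP; split; lra.
have key a b : 2^-1 <= a -> a <= b -> 0 <= expR (- (L * a)) - expR (- (L * b)) <= b - a.
  move=> ah ab; have ab0 : 0 <= L * (b - a) by rewrite mulr_ge0 // subr_ge0.
  have -> : expR (- (L * b)) = expR (- (L * a)) * expR (- (L * (b - a))).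
    by rewrite -expRD; congr expR; ring.
  set ea := expR (- (L * a)); set ed := expR (- (L * (b - a))).
  have ea0 : 0 <= ea by exact: expR_ge0.
  have ed1 : ed <= 1 by rewrite /ed -expR0 ler_expR oppr_le0.
  have ed2 : 1 - L * (b - a) <= ed by apply: le_trans (expR_ge1Dx _); lra.
  have eaL : ea * L <= 1.
    have h1 : L <= expR (L / 2).
      apply: (@le_trans _ _ ((1 + L / 4) ^+ 2)); first by have := sqr_ge0 (1 - L / 4); nra.
      have -> : expR (L / 2) = expR (L / 4) ^+ 2 by rewrite -expRM_natr; congr expR; field.
      by rewrite lerXn2r ?nnegrE ?expR_ge0 //; [lra|exact: expR_ge1Dx].
    have h2 : ea * expR (L / 2) <= 1.
      have La := ler_wpM2l L0 ah.
      have La0 : - (L * a) + L / 2 <= 0 by lra.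
      by rewrite /ea -expRD -[leRHS]expR0 ler_expR.
    by apply: le_trans h2; rewrite ler_wpM2l.
  by apply/andP; split; nra.
have [xy|xy] := leP x y.
  have /andP[a b] := key x y (ltW xh) xy.
  rewrite (ger0_norm a) distrC ger0_norm ?subr_ge0 //; lra.
have /andP[a b] : 0 <= expR (- (L * y)) - expR (- (L * x)) <= x - y by apply: key; lra.
rewrite distrC (ger0_norm a) ger0_norm ?subr_ge0 ?(ltW xy) //; lra.
Qed.

End correlated_pair.

(** * Poisson probabilities of having no neighbour *)

Section poisson_values.
Context {R : realType}.
Implicit Types (a b c th : R).

Lemma Poi_scale th c (f : nat -> R) : 0 <= th -> 0 <= c <= 1 -> unit_valued f ->
  Poi th (fun k => c * f k) = c * Poi th f.
Proof.
move=> th0 /andP[c0 c1] f01.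
have cf01 : unit_valued (fun k => c * f k).
  by move=> k; have /andP[f0 f1] := f01 k; rewrite mulr_ge0 //= mulr_ile1.
apply: EFin_inj; rewrite EFinM -!Poi_series // -nneseriesZl; last first.
  by move=> k _; exact: pois_term_ge0.
by apply: eq_eseriesr => k _; rewrite -EFinM mulrCA.
Qed.

Lemma Poi_cst th c : 0 <= th -> 0 <= c <= 1 -> Poi th (fun=> c) = c.
Proof.
move=> th0 c01; transitivity (Poi th (fun=> c * 1)); first by rewrite mulr1.
by rewrite (@Poi_scale _ _ (fun=> 1)) // ?Poi_cst1 ?mulr1 // => k; rewrite ler01 lexx.
Qed.

(** The arguments are the numbers of neighbours counted for the first graph only, the second only,
    and both: hence [i + k] and [j + k] below are the full counts of each graph. *)
Definition none3 (i j k : nat) : R := ((i == 0%N) && (j == 0%N) && (k == 0%N))%:R.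
Definition none1 (i j k : nat) : R := (i + k == 0)%N%:R.
Definition none2 (i j k : nat) : R := (j + k == 0)%N%:R.

Lemma boolr_unit (b : bool) : (0 <= b%:R :> R) && (b%:R <= 1 :> R).
Proof. by case: b; rewrite ?lexx ?ler01. Qed.

Lemma expRN_unit th : 0 <= th -> 0 <= expR (- th) <= 1.
Proof. by move=> th0; rewrite expR_ge0 /= -expR0 ler_expR oppr_le0. Qed.

Let eq0_unit : unit_valued (fun k => (k == 0%N)%:R : R).
Proof. by move=> k; exact: boolr_unit. Qed.

Let mul_unit c : 0 <= c <= 1 -> unit_valued (fun k => c * (k == 0%N)%:R : R).
Proof. by move=> /andP[c0 c1] k; case: (k == 0%N); rewrite ?mulr1 ?mulr0 ?lexx ?ler01 ?c0. Qed.

Lemma Poi_mul0 th c : 0 <= th -> 0 <= c <= 1 ->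
  Poi th (fun k => c * (k == 0%N)%:R) = c * expR (- th).
Proof. by move=> th0 c01; rewrite (Poi_scale th0 c01 eq0_unit) Poi_eq0. Qed.

Lemma Poi3_none3 a b c : 0 <= a -> 0 <= b -> 0 <= c ->
  Poi3 a b c none3 = expR (- (a + b + c)).
Proof.
move=> a0 b0 c0; rewrite /Poi3.
have u1 (d : bool) th : 0 <= th -> 0 <= d%:R * expR (- th) <= 1.
  by move=> /expRN_unit; case: d; rewrite ?mul1r ?mul0r ?lexx ?ler01.
transitivity (Poi a (fun i => expR (- (b + c)) * (i == 0%N)%:R)); last first.
  by rewrite Poi_mul0 ?expRN_unit ?addr_ge0 // -expRD; congr expR; ring.
apply: eq_Poi => i.
transitivity (Poi b (fun j => ((i == 0%N)%:R * expR (- c)) * (j == 0%N)%:R)).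
  apply: eq_Poi => j; transitivity (Poi c (fun k => ((i == 0%N) && (j == 0%N))%:R * (k == 0%N)%:R)).
    by apply: eq_Poi => k; rewrite /none3 -natrM mulnb.
  by rewrite Poi_mul0 ?boolr_unit // -mulnb natrM mulrAC.
by rewrite Poi_mul0 ?u1 // -mulrA -expRD mulrC; congr (expR _ * _); ring.
Qed.

Lemma Poi3_none1 a b c : 0 <= a -> 0 <= b -> 0 <= c -> Poi3 a b c none1 = expR (- (a + c)).
Proof.
move=> a0 b0 c0; rewrite /Poi3.
transitivity (Poi a (fun i => expR (- c) * (i == 0%N)%:R)); last first.
  by rewrite Poi_mul0 ?expRN_unit // -expRD; congr expR; ring.
apply: eq_Poi => i; transitivity (Poi b (fun=> expR (- c) * (i == 0%N)%:R)); last first.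
  by rewrite Poi_cst //; exact: mul_unit (expRN_unit c0) i.
apply: eq_Poi => j; transitivity (Poi c (fun k => (i == 0%N)%:R * (k == 0%N)%:R)).
  by apply: eq_Poi => k; rewrite /none1 addn_eq0 -natrM mulnb.
by rewrite Poi_mul0 ?boolr_unit // mulrC.
Qed.

Lemma Poi3_none2 a b c : 0 <= a -> 0 <= b -> 0 <= c -> Poi3 a b c none2 = expR (- (b + c)).
Proof.
move=> a0 b0 c0; rewrite /Poi3.
transitivity (Poi a (fun=> expR (- (b + c)))); last by rewrite Poi_cst // expRN_unit // addr_ge0.
apply: eq_Poi => i; transitivity (Poi b (fun j => expR (- c) * (j == 0%N)%:R)); last first.
  by rewrite Poi_mul0 ?expRN_unit // -expRD; congr expR; ring.
apply: eq_Poi => j; transitivity (Poi c (fun k => (j == 0%N)%:R * (k == 0%N)%:R)).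
  by apply: eq_Poi => k; rewrite /none2 addn_eq0 -natrM mulnb.
by rewrite Poi_mul0 ?boolr_unit // mulrC.
Qed.

Lemma none3_unit : unit_valued3 none3. Proof. by move=> i j k; exact: boolr_unit. Qed.
Lemma none1_unit : unit_valued3 none1. Proof. by move=> i j k; exact: boolr_unit. Qed.
Lemma none2_unit : unit_valued3 none2. Proof. by move=> i j k; exact: boolr_unit. Qed.

End poisson_values.

(** * Star statistics as ball membership and parent ratios *)

Section psi_values.
Context {R : realType} {n : nat} {T : finType}.
Variables (g h : T -> bool) (w : {ffun edge n -> T}).
Notation V := (vertex n).
Notation r := (origin n).
Notation VT := [set: V]%SET.
Implicit Types (v : V) (k : nat).

Lemma cardIDl (A B : {set V}) : (#|A :\: B| + #|A :&: B| = #|A|)%SET%N.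
Proof. by rewrite addnC cardsID. Qed.

Lemma cardIDr (A B : {set V}) : (#|B :\: A| + #|A :&: B| = #|B|)%SET%N.
Proof. by rewrite finset.setIC cardIDl. Qed.

Lemma psi_none1 v k : v != r -> psi g h none1 w VT v k = (v \notin gb g w VT k.+1)%:R :> R.
Proof. by move=> vr; rewrite /psi /star_counts /none1 cardIDl Y_eq0. Qed.

Lemma psi_none2 v k : v != r -> psi g h none2 w VT v k = (v \notin gb h w VT k.+1)%:R :> R.
Proof. by move=> vr; rewrite /psi /star_counts /none2 cardIDr Y_eq0. Qed.

Lemma psi_none3 v k : v != r -> psi g h none3 w VT v k =
  ((v \notin gb g w VT k.+1) && (v \notin gb h w VT k.+1))%:R :> R.
Proof.
move=> vr; rewrite /psi /star_counts /none3 -!Y_eq0 //.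
set A := nbr g w v _; set B := nbr h w v _; congr (_%:R).
rewrite -(cardIDl A B) -(cardIDr A B) !addn_eq0.
by case: (_ == 0)%N; case: (_ == 0)%N; case: (_ == 0)%N.
Qed.

Lemma psi_ratio3 v k : psi g h ratio3 w VT v k = par_ratio g h w v k :> R.
Proof.
rewrite /psi /star_counts /ratio3 /par_ratio.
by rewrite addn_maxl cardIDl cardIDr.
Qed.

End psi_values.

(** * Limits *)

Section limits.
Context {R : realType} (alpha rho_ : nat -> R) (lambda rho gamma : R).
Hypothesis alpha_gt0 : forall n, 0 < alpha n.
Hypothesis alpha_liminf : (0 < limn_einf (EFin \o alpha))%E.
Hypothesis alpha_limsup : (limn_esup (EFin \o alpha) < +oo)%E.
Hypothesis rho_01 : forall n, 0 < rho_ n < 1.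
Hypothesis lambda_itv : 0 <= lambda <= 1.
Hypothesis rho_itv : 0 <= rho <= 1.
Hypothesis gamma_itv : 0 <= gamma <= 1.
Hypothesis lambda_cvg : lambda_seq (edge_prob alpha) @ \oo --> lambda.
Hypothesis rho_cvg : rho_ @ \oo --> rho.
Hypothesis gamma_rho_lt1 : rho < 1 -> gamma = 0.
Hypothesis gamma_rho_eq1 : rho = 1 -> gamma_seq (edge_prob alpha) rho_ @ \oo --> gamma.

Notation q := (edge_prob alpha).
Notation N := (Nn alpha).
Notation K := (Kn alpha).
Notation mu n := (mu3 (q n) (rho_ n)).
Notation En n := (@Ex R (edge n) (bool * bool * bool)%type (mu n)).
Notation VT n := [set: vertex n]%SET.
Notation VR n := ([set: vertex n]%SET :\ origin n)%SET.
Notation p11 n := (prob1 (mu n) (fun t => sel1 t && sel2 t)).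

Definition Ln n : R := N n ^+ (K n).+1 / n%:R.

Definition okn n := [/\ (0 < n)%N, 0 < q n <= 1 & 20 <= N n].

Lemma near_ok : \forall n \near \oo, okn n.
Proof.
near=> n; split; first by near: n; exact: nbhs_infty_gt.
  by near: n; exact: near_q01.
by near: n; exact: Nn_ge.
Unshelve. all: by end_near. Qed.

Lemma mu_ge0 n : okn n -> forall t, 0 <= mu n t.
Proof.
move=> [_ /andP[q0 q1] _] t; apply: mu3_ge0; first by rewrite (ltW q0).
by case/andP: (rho_01 n) => r0 r1; rewrite !ltW.
Qed.

Lemma cardV n : okn n -> #|vertex n| = n.
Proof. by case=> n0 _ _; rewrite card_ord prednK. Qed.

Lemma natV n : okn n -> #|vertex n|%:R = n%:R :> R.
Proof. by move/cardV ->. Qed.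

Lemma n_gt0 n : okn n -> 0 < n%:R :> R.
Proof. by case=> n0 _ _; rewrite ltr0n. Qed.

Lemma NE n : okn n -> #|vertex n|%:R * q n = N n.
Proof. by move=> ok; rewrite natV. Qed.

Lemma N_gt0 n : okn n -> 0 < N n.
Proof. by case=> _ _; apply: lt_le_trans; rewrite ltr0n. Qed.

Lemma p11E n : p11 n = rho_ n * q n + (1 - rho_ n) * q n ^+ 2.
Proof. exact: prob_sel12. Qed.

Lemma p11_bounds n : okn n ->
  [/\ 0 <= p11 n, rho_ n * q n <= p11 n, p11 n <= rho_ n * q n + q n ^+ 2 & p11 n <= q n].
Proof.
move=> [_ /andP[q0 q1] _]; rewrite p11E; have /andP[r0 r1] := rho_01 n.
have q2 : 0 <= q n ^+ 2 by exact: sqr_ge0.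
have q2q : q n ^+ 2 <= q n by rewrite expr2 -[leRHS]mulr1 ler_wpM2l // ltW.
have rq : 0 <= rho_ n * q n by rewrite mulr_ge0 // ltW.
have r1' : 0 <= 1 - rho_ n by lra.
have a : 0 <= (1 - rho_ n) * q n ^+ 2 by rewrite mulr_ge0.
have b : (1 - rho_ n) * q n ^+ 2 <= q n ^+ 2 by rewrite -[leRHS]mul1r ler_wpM2r //; lra.
have c : (1 - rho_ n) * q n ^+ 2 <= (1 - rho_ n) * q n by rewrite ler_wpM2l.
by split; lra.
Qed.

Lemma q_small : q @ \oo --> (0 : R).
Proof.
apply: (cvg0_le (Nn2_small alpha_liminf alpha_limsup)); near=> n.
have ok : okn n by near: n; exact: near_ok.
have [n0 /andP[q0 q1] N20] := ok; rewrite (ltW q0) /=.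
have n0' := n_gt0 ok; rewrite ler_pdivlMr // mulrC -/(N n) expr2 -[leLHS]mulr1 ler_wpM2l //.
  by rewrite ltW // N_gt0.
by apply: le_trans N20; rewrite ler1n.
Unshelve. all: by end_near. Qed.

Lemma rho_unit n : 0 <= rho_ n <= 1.
Proof. by case/andP: (rho_01 n) => r0 r1; rewrite !ltW. Qed.

Lemma kk2 (k n : nat) : (k * (2 + k))%:R / n%:R <= 3 * (k%:R ^+ 2 / n%:R) :> R.
Proof.
rewrite mulrA; apply: ler_wpM2r; first by rewrite invr_ge0.
by rewrite -natrX -natrM ler_nat; nia.
Qed.

(** At most two vertices are deleted, those of a pair in the variance computation; hence the bound
    2. *)
Lemma conc_ball (k : nat -> nat) : (fun n => N n ^+ k n / n%:R) @ \oo --> (0 : R) ->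
  (fun n => (k n)%:R ^+ 2 / n%:R) @ \oo --> (0 : R) ->
  exists2 eta : nat -> R, eta @ \oo --> (0 : R) & \forall n \near \oo,
    forall f (U : {set vertex n}), prob1 (mu n) f = q n -> (#|~: U| <= 2)%N ->
    En n (fun w => `|#|gb f w U (k n)|%:R / N n ^+ k n - 1|) <= eta n.
Proof.
move=> Nk k2.
exists (fun n => Num.sqrt (20 * (N n)^-1 + 6 * ((k n)%:R ^+ 2 / n%:R) + 4 * (N n ^+ k n / n%:R))).
  apply: cvg0_sqrt; apply: cvg0D; [apply: cvg0D|]; apply: cvg0Z => //.
  exact: invNn_small.
near=> n; have ok : okn n by near: n; exact: near_ok.
move=> f U pf Uj; have [n0 q01 N20] := ok.
have := @gb_conc2 R n _ (mu n) (mu_ge0 ok) (mu3_sum1 _ _) (q n) f U (k n) 2 pf.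
rewrite NE // => /(_ N20 Uj) /le_trans; apply; apply: ler_wsqrtr.
rewrite /gb_err natV // -!mulrA lerD2r lerD2l.
have -> : 6 = 2 * 3 :> R by ring.
by rewrite -mulrA; apply: ler_wpM2l => //; rewrite [X in _ <= 3 * X]mulrA -expr2; exact: kk2.
Unshelve. all: by end_near. Qed.

Lemma rho_pow_small (k : nat -> nat) : rho < 1 -> (forall J, \forall n \near \oo, (J <= k n)%N) ->
  (fun n => rho_ n ^+ k n) @ \oo --> (0 : R).
Proof.
move=> rho1 kJ; pose s := (1 + rho) / 2.
have s1 : s < 1 by rewrite /s; lra.
have s0 : 0 <= s by rewrite /s; case/andP: rho_itv => *; lra.
have rs : rho < s by rewrite /s; lra.
apply/cvg0P => e e0.
have /cvg0P/(_ e e0) [J _ hJ] : (fun j => s ^+ j) @ \oo --> (0 : R).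
  by apply: cvg_expr; rewrite ger0_norm.
have sJ : s ^+ J <= e by have := hJ J (leqnn J); rewrite /= ger0_norm // exprn_ge0.
near=> n; have /andP[r0 r1] := rho_unit n.
have Jk : (J <= k n)%N by near: n.
have rsn : rho_ n <= s by near: n; exact: cvgr_le rho_cvg _ rs.
rewrite ger0_norm ?exprn_ge0 //; apply: le_trans sJ.
apply: (@le_trans _ _ (s ^+ k n)); first by rewrite lerXn2r ?nnegrE.
by rewrite ler_wiXn2l // ltW.
Unshelve. all: by end_near. Qed.

(** If [rho < 1] then [rho_n ^ k] tends to 0 and a bound on the mean is enough. If [rho = 1] then
    eventually [rho_n >= 1 / 2], so the intersection graph keeps half of the mean degree and its
    balls give the lower bound. *)
Lemma conc_cap (k : nat -> nat) : (fun n => N n ^+ k n / n%:R) @ \oo --> (0 : R) ->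
  (fun n => (k n)%:R ^+ 2 / n%:R) @ \oo --> (0 : R) ->
  (forall J, \forall n \near \oo, (J <= k n)%N) ->
  exists2 zeta : nat -> R, zeta @ \oo --> (0 : R) & \forall n \near \oo,
    forall U : {set vertex n}, (#|~: U| <= 2)%N ->
    En n (fun w => `|#|gcap sel1 sel2 w U (k n)|%:R / N n ^+ k n - rho_ n ^+ k n|) <= zeta n.
Proof.
move=> Nk k2 kJ; have iN := invNn_small alpha_liminf.
have [rho1|rho1] := ltP rho 1.
  exists (fun n => 2 * rho_ n ^+ k n + 2 * (N n)^-1 + 8 * (N n ^+ k n / n%:R)).
    apply: cvg0D; [apply: cvg0D|]; apply: cvg0Z => //; exact: rho_pow_small.
  near=> n; have ok : okn n by near: n; exact: near_ok.
  move=> U Uj; have [n0 q01 N20] := ok; have [_ _ p1 _] := p11_bounds ok.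
  have := @gcap_conc_small R n _ (mu n) (mu_ge0 ok) (mu3_sum1 _ _) sel1 sel2 (q n)
    (prob_sel1 _ _) (prob_sel2 _ _) (rho_ n) U (k n) (rho_unit n) p1.
  by rewrite NE // natV // => /(_ N20) /le_trans; apply; rewrite -!mulrA.
have rhoE : rho = 1 by apply/eqP; rewrite eq_le rho1; case/andP: rho_itv => _ ->.
exists (fun n => 2 * (N n)^-1 + 8 * (N n ^+ k n / n%:R) +
   2 * Num.sqrt (40 * (N n)^-1 + 6 * ((k n)%:R ^+ 2 / n%:R) + 4 * (N n ^+ k n / n%:R))).
  apply: cvg0D; first by apply: cvg0D; exact: cvg0Z.
  apply: cvg0Z; apply: cvg0_sqrt; apply: cvg0D; last exact: cvg0Z.
  by apply: cvg0D; exact: cvg0Z.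
near=> n; have ok : okn n by near: n; exact: near_ok.
(* Half of it is the 20 required by [gcap_conc] for the intersection graph. *)
have N40 : 40 <= N n by near: n; exact: Nn_ge.
have rh : 2^-1 <= rho_ n.
  near: n; apply: (cvgr_ge rho) => //; rewrite rhoE; lra.
move=> U Uj; have [n0 /andP[q0 q1] N20] := ok; have [p0 p1 p2 p3] := p11_bounds ok.
have N0 := N_gt0 ok.
have M : N n / 2 <= #|vertex n|%:R * p11 n.
  rewrite -(NE ok) -mulrA ler_wpM2l //; apply: le_trans p1; rewrite mulrC ler_wpM2r // ltW //.
have M20 : 20 <= #|vertex n|%:R * p11 n by apply: le_trans M; lra.
have := @gcap_conc R n _ (mu n) (mu_ge0 ok) (mu3_sum1 _ _) sel1 sel2 (q n)
    (prob_sel1 _ _) (prob_sel2 _ _) (rho_ n) U (k n) 2 (rho_unit n) p1 p2 M20 Uj.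
rewrite NE // natV // => /le_trans; apply; rewrite -!mulrA; apply: lerD => //.
rewrite ler_wpM2l //; apply: ler_wsqrtr; rewrite /gb_err natV //.
rewrite natV // in M.
have MN : n%:R * p11 n <= N n by rewrite /Nn ler_wpM2l.
have M0 : 0 < n%:R * p11 n by lra.
apply: lerD; last first.
  rewrite -mulrA ler_wpM2l // ler_wpM2r ?invr_ge0 // lerXn2r ?nnegrE // ltW //.
apply: lerD.
  have -> : 40 = 20 * 2 :> R by ring.
  rewrite -mulrA ler_wpM2l // -[X in _ <= X * _]invrK -invfM lef_pV2 ?posrE //.
    by rewrite mulrC.
  by rewrite mulr_gt0 // invr_gt0.
have -> : 6 = 2 * 3 :> R by ring.
by rewrite -!mulrA; apply: ler_wpM2l => //; rewrite [X in _ <= 3 * X]mulrA -expr2; exact: kk2.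
Unshelve. all: by end_near. Qed.

Lemma gamma_n_cvg : (fun n => rho_ n ^+ (K n).+1) @ \oo --> gamma.
Proof.
have [rho1|rho1] := ltP rho 1.
  rewrite gamma_rho_lt1 //; apply: rho_pow_small => // J.
  near=> n; apply: leqW; near: n; exact: Kn_ge.
have rhoE : rho = 1 by apply/eqP; rewrite eq_le rho1; case/andP: rho_itv => _ ->.
apply: cvg_trans (gamma_rho_eq1 rhoE); apply: near_eq_cvg; near=> n.
have [dE _ _] : [/\ dstar q n = (K n).+1%:Z, N n ^+ K n < n%:R / (ln (ln n%:R) ^+ 2)
   & n%:R / (ln (ln n%:R) ^+ 2) <= N n ^+ (K n).+1].
  by near: n; exact: dstarP.
by rewrite /gamma_seq dE.
Unshelve. all: by end_near. Qed.

Lemma lambda_n_cvg : (fun n => expR (- Ln n)) @ \oo --> lambda.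
Proof.
apply: cvg_trans lambda_cvg; apply: near_eq_cvg; near=> n.
have [dE _ _] : [/\ dstar q n = (K n).+1%:Z, N n ^+ K n < n%:R / (ln (ln n%:R) ^+ 2)
   & n%:R / (ln (ln n%:R) ^+ 2) <= N n ^+ (K n).+1].
  by near: n; exact: dstarP.
by rewrite /lambda_seq dE.
Unshelve. all: by end_near. Qed.

Lemma Ln_ge0 n : okn n -> 0 <= Ln n.
Proof. by move=> ok; rewrite divr_ge0 // exprn_ge0 // ltW // N_gt0. Qed.

Lemma gamma_n_unit n : 0 <= rho_ n ^+ (K n).+1 <= 1.
Proof. by have /andP[r0 r1] := rho_unit n; rewrite exprn_ge0 //= exprn_ile1. Qed.

Lemma Ln_cvg : 0 < lambda -> Ln @ \oo --> ln lambda^-1.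
Proof.
move=> l0; rewrite lnV ?posrE //.
have -> : Ln = (fun n => - ln (expR (- Ln n))).
  by apply/funext => n; rewrite expRK opprK.
exact: cvgN (cvg_comp _ _ lambda_n_cvg (continuous_ln l0)).
Qed.

(** For [lambda = 0] the exponent, at least 1, squeezes the sequence below [lambda_n]; otherwise
    [Ln] converges. *)
Lemma lambda_gamma_cvg :
  (fun n => expR (- (Ln n * (2 - rho_ n ^+ (K n).+1)))) @ \oo --> lambda `^ (2 - gamma).
Proof.
have /andP[g0 g1] := gamma_itv.
have [l0|l0] := eqVneq lambda 0.
  have -> : lambda `^ (2 - gamma) = 0 by rewrite l0 powR0 // gt_eqF //; lra.
  have lc := lambda_n_cvg; rewrite l0 in lc; apply: (cvg0_le lc); near=> n.
  have ok : okn n by near: n; exact: near_ok.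
  rewrite expR_ge0 /= ler_expR lerN2 -[leLHS]mulr1 ler_wpM2l ?Ln_ge0 //.
  by have /andP[_] := gamma_n_unit n; lra.
have lp : 0 < lambda by rewrite lt_neqAle eq_sym l0; case/andP: lambda_itv.
rewrite /powR (negPf l0); apply: continuous_cvg; first exact: continuous_expR.
have -> : (2 - gamma) * ln lambda = - (ln lambda^-1 * (2 - gamma)) by rewrite lnV ?posrE //; ring.
apply: cvgN; apply: cvgM; first exact: Ln_cvg.
by apply: cvgB; [exact: cvg_cst|exact: gamma_n_cvg].
Unshelve. all: by end_near. Qed.

(** The target [c0] may depend on [n], since Poisson parameters diverge when [lambda = 0]; only its
    limit matters. Leaving out the root costs [1 / n]. *)
Lemma mean_psi F (c0 eps : nat -> R) (l : R) : unit_valued3 F ->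
  (forall n, okn n -> 0 <= c0 n <= 1) -> c0 @ \oo --> l -> eps @ \oo --> (0 : R) ->
  (\forall n \near \oo, forall U : {set vertex n}, (#|~: U| <= 2)%N ->
    En n (fun w => `|Poi3 (q n * #|gb sel1 w U (K n)|%:R - p11 n * #|gcap sel1 sel2 w U (K n)|%:R)
      (q n * #|gb sel2 w U (K n)|%:R - p11 n * #|gcap sel1 sel2 w U (K n)|%:R)
      (p11 n * #|gcap sel1 sel2 w U (K n)|%:R) F - c0 n|) <= eps n) ->
  (fun n => En n (fun w => `|(\sum_(v in VR n) psi sel1 sel2 F w (VT n) v (K n)) / n%:R - l|)) @ \oo
    --> (0 : R).
Proof.
move=> F01 c01 c0l eps0 Heps.
have cl : (fun n => `|c0 n - l|) @ \oo --> (0 : R).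
  by rewrite -(@normr0 _ R); apply: cvg_norm; rewrite -(subrr l); apply: cvgB => //; exact: cvg_cst.
have N2 := Nn2_small alpha_liminf alpha_limsup.
have NK : (fun n => N n ^+ K n / n%:R) @ \oo --> (0 : R) by apply: Nn_Kn_small.
have K2 : (fun n => (K n)%:R ^+ 2 / n%:R) @ \oo --> (0 : R) by apply: Kn2_small.
have eps0' : (fun n => `|eps n|) @ \oo --> (0 : R) by rewrite -(@normr0 _ R); exact: cvg_norm.
pose err n := Num.sqrt (n%:R^-1 + 8 * (((K n)%:R ^+ 2 / n%:R + N n ^+ 2 / n%:R) * (N n ^+ K n / n%:R)) +
  8 * ((N n ^+ 2 / n%:R) * (N n ^+ K n / n%:R)) + `|eps n|).
have err0 : err @ \oo --> (0 : R).
  apply: cvg0_sqrt; apply: cvg0D => //; apply: cvg0D; last by apply: cvg0Z; exact: cvg0M.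
  apply: cvg0D; first exact: invn_small.
  by apply: cvg0Z; apply: cvg0M => //; exact: cvg0D.
apply: (cvg0_le (cvg0D (cvg0D err0 cl) (@invn_small R))); near=> n.
have ok : okn n by near: n; exact: near_ok.
have mu0 := mu_ge0 ok; have n0 := n_gt0 ok; have N0 := N_gt0 ok.
have [_ /andP[q0 q1] N20] := ok.
rewrite Ex_ge0 //=.
have HU : forall U : {set vertex n}, (#|~: U| <= 2)%N ->
    En n (fun w => `|Poi3 (q n * #|gb sel1 w U (K n)|%:R - p11 n * #|gcap sel1 sel2 w U (K n)|%:R)
      (q n * #|gb sel2 w U (K n)|%:R - p11 n * #|gcap sel1 sel2 w U (K n)|%:R)
      (p11 n * #|gcap sel1 sel2 w U (K n)|%:R) F - c0 n|) <= `|eps n|.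
  have H : forall U : {set vertex n}, (#|~: U| <= 2)%N ->
    En n (fun w => `|Poi3 (q n * #|gb sel1 w U (K n)|%:R - p11 n * #|gcap sel1 sel2 w U (K n)|%:R)
      (q n * #|gb sel2 w U (K n)|%:R - p11 n * #|gcap sel1 sel2 w U (K n)|%:R)
      (p11 n * #|gcap sel1 sel2 w U (K n)|%:R) F - c0 n|) <= eps n by near: n.
  by move=> U Uj; apply: (le_trans (H U Uj)); exact: ler_norm.
have N20' : 20 <= #|vertex n|%:R * q n by rewrite NE.
have /andP[c0n c1n] := c01 n ok.
have := @avg_psi R n _ (mu n) mu0 (mu3_sum1 _ _) sel1 sel2 (q n) (prob_sel1 _ _) (prob_sel2 _ _)
  F (c0 n) `|eps n| (K n) F01 (c01 n ok) N20' (normr_ge0 _) HU.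
rewrite NE // natV // => avg.
have avg' : En n (fun w => `|(\sum_(v in VR n) (psi sel1 sel2 F w (VT n) v (K n) - c0 n)) / n%:R|) <= err n.
  apply: (le_trans avg); apply: ler_wsqrtr; rewrite lerD2r; apply: lerD; last first.
    rewrite -mulrA ler_wpM2l // le_eqVlt; apply/orP; left; apply/eqP.
    have -> : q n = N n / n%:R by rewrite /Nn mulrC mulKf // gt_eqF.
    by move: (N n ^+ K n) => y; field; rewrite gt_eqF.
  rewrite lerD2l -!mulrA ler_wpM2l //.
  have -> : (K n)%:R * (N n ^+ (K n).+1 / n%:R ^+ 2) = ((K n)%:R * N n / n%:R) * (N n ^+ K n / n%:R).
    by rewrite exprS; move: (N n ^+ K n) => y; field; rewrite gt_eqF.
  apply: ler_wpM2r; first by rewrite divr_ge0 // ?exprn_ge0 // ltW.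
  rewrite !mulrA -mulrDl; apply: ler_wpM2r; first by rewrite invr_ge0 ltW.
  move: (K n)%:R (N n) => a b; have := sqr_ge0 (a - b); have := sqr_ge0 (a + b).
  by nra.
apply: (@le_trans _ _ (En n (fun w => `|(\sum_(v in VR n) (psi sel1 sel2 F w (VT n) v (K n) - c0 n)) / n%:R| +
   (`|c0 n - l| + n%:R^-1)))); last first.
  by rewrite ExD Ex_cst ?mu3_sum1 // -[leRHS]addrA lerD2r.
apply: ler_Ex => // w.
have cVR : #|VR n|%:R = n%:R - 1 :> R.
  have := cardsD1 (origin n) (VT n); rewrite cardsT inE add1n (cardV ok) => nE.
  have := congr1 (fun k => k%:R : R) nE; rewrite -natr1 => nE'.
  by rewrite nE' addrK.
have -> : (\sum_(v in VR n) psi sel1 sel2 F w (VT n) v (K n)) / n%:R - l =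
  (\sum_(v in VR n) (psi sel1 sel2 F w (VT n) v (K n) - c0 n)) / n%:R + ((c0 n - l) - c0 n / n%:R).
  by rewrite sumrB sumr_const -[c0 n *+ _]mulr_natl cVR; field; rewrite gt_eqF.
apply: (le_trans (ler_normD _ _)); rewrite lerD2l; apply: (le_trans (ler_normB _ _)); rewrite lerD2l.
by rewrite ger0_norm ?divr_ge0 ?(ltW n0) // -[leRHS]mul1r ler_wpM2r ?invr_ge0 ?(ltW n0).
Unshelve. all: by end_near. Qed.

Lemma conc_K : exists2 eta : nat -> R, eta @ \oo --> (0 : R) & \forall n \near \oo,
    forall f (U : {set vertex n}), prob1 (mu n) f = q n -> (#|~: U| <= 2)%N ->
    En n (fun w => `|#|gb f w U (K n)|%:R / N n ^+ K n - 1|) <= eta n.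
Proof. by apply: conc_ball; [apply: Nn_Kn_small|apply: Kn2_small]. Qed.

Lemma conc_cap_K : exists2 zeta : nat -> R, zeta @ \oo --> (0 : R) & \forall n \near \oo,
    forall U : {set vertex n}, (#|~: U| <= 2)%N ->
    En n (fun w => `|#|gcap sel1 sel2 w U (K n)|%:R / N n ^+ K n - rho_ n ^+ K n|) <= zeta n.
Proof.
apply: conc_cap; [by apply: Nn_Kn_small|by apply: Kn2_small|by move=> J; apply: Kn_ge].
Qed.

(** Because [q_n = N / n], a ball of normalised size 1 yields the mean [Ln n], which is
    [log (1 / lambda_n)] for large [n]. *)
Lemma qbE n y : okn n -> q n * y = Ln n * (y / N n ^+ K n).
Proof.
move=> ok; have n0 := n_gt0 ok; have N0 := N_gt0 ok.
have -> : q n = N n / n%:R by rewrite /Nn mulrC mulKf // gt_eqF.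
rewrite /Ln exprS; have : N n ^+ K n != 0 by rewrite expf_neq0 // gt_eqF.
by move: (N n ^+ K n) => z z0; field; rewrite z0 gt_eqF.
Qed.

Lemma gcap_le1 n (w : sample n) U k : #|gcap sel1 sel2 w U k|%:R <= #|gb sel1 w U k|%:R :> R.
Proof. by rewrite ler_nat subset_leq_card // subsetIl. Qed.

Lemma gcap_le2 n (w : sample n) U k : #|gcap sel1 sel2 w U k|%:R <= #|gb sel2 w U k|%:R :> R.
Proof. by rewrite ler_nat subset_leq_card // subsetIr. Qed.

Lemma params_ge0 n (w : sample n) U k : okn n ->
  [/\ 0 <= q n * #|gb sel1 w U k|%:R - p11 n * #|gcap sel1 sel2 w U k|%:R,
      0 <= q n * #|gb sel2 w U k|%:R - p11 n * #|gcap sel1 sel2 w U k|%:R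
    & 0 <= p11 n * #|gcap sel1 sel2 w U k|%:R].
Proof.
move=> ok; have [p0 _ _ p1] := p11_bounds ok.
by split; rewrite ?subr_ge0 ?mulr_ge0 // ler_pM // ?gcap_le1 ?gcap_le2.
Qed.

Lemma expR_Ln_unit n (y : R) : okn n -> 0 <= y -> 0 <= expR (- (Ln n * y)) <= 1.
Proof. by move=> ok y0; rewrite expRN_unit // mulr_ge0 // Ln_ge0. Qed.

Definition missed n f (w : sample n) : R :=
  (\sum_(v in VR n) (v \notin gb f w (VT n) (K n).+1)%:R) / n%:R.
Definition missed2 n (w : sample n) : R :=
  (\sum_(v in VR n) ((v \notin gb sel1 w (VT n) (K n).+1) &&
     (v \notin gb sel2 w (VT n) (K n).+1))%:R) / n%:R.

Lemma missed_cvg f : f = sel1 \/ f = sel2 ->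
  (fun n => En n (fun w => `|missed f w - lambda|)) @ \oo --> (0 : R).
Proof.
move=> f12; have [eta eta0 Heta] := conc_K.
have main (F : nat -> nat -> nat -> R) : unit_valued3 F ->
  (forall n (w : sample n) v, v \in VR n -> psi sel1 sel2 F w (VT n) v (K n) =
     (v \notin gb f w (VT n) (K n).+1)%:R) ->
  (forall n (w : sample n) U, okn n ->
     Poi3 (q n * #|gb sel1 w U (K n)|%:R - p11 n * #|gcap sel1 sel2 w U (K n)|%:R)
      (q n * #|gb sel2 w U (K n)|%:R - p11 n * #|gcap sel1 sel2 w U (K n)|%:R)
      (p11 n * #|gcap sel1 sel2 w U (K n)|%:R) F = expR (- (q n * #|gb f w U (K n)|%:R))) ->
  (fun n => En n (fun w => `|missed f w - lambda|)) @ \oo --> (0 : R).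
  move=> F01 Fpsi FPoi.
  have -> : (fun n => En n (fun w => `|missed f w - lambda|)) =
     (fun n => En n (fun w => `|(\sum_(v in VR n) psi sel1 sel2 F w (VT n) v (K n)) / n%:R - lambda|)).
    apply/funext => n; apply: eq_Ex => w; rewrite /missed.
    by under [in RHS]eq_bigr => v vR do rewrite Fpsi //.
  apply: (@mean_psi F (fun n => expR (- Ln n)) (fun n => 2 * eta n)) => //.
  - by move=> n ok; have := @expR_Ln_unit n 1 ok ler01; rewrite mulr1.
  - exact: lambda_n_cvg.
  - exact: cvg0Z.
  near=> n; have ok : okn n by near: n; exact: near_ok.
  have He : forall f (U : {set vertex n}), prob1 (mu n) f = q n -> (#|~: U| <= 2)%N ->
    En n (fun w => `|#|gb f w U (K n)|%:R / N n ^+ K n - 1|) <= eta n by near: n.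
  move=> U Uj; have pf : prob1 (mu n) f = q n by case: f12 => ->; [exact: prob_sel1|exact: prob_sel2].
  apply: (@le_trans _ _ (En n (fun w => 2 * `|#|gb f w U (K n)|%:R / N n ^+ K n - 1|))); last first.
    by rewrite ExZ ler_wpM2l // He.
  apply: (ler_Ex (mu_ge0 ok)) => w; rewrite FPoi // qbE // -{2}[Ln n]mulr1.
  by apply: expR_lip; rewrite ?Ln_ge0 // divr_ge0 // exprn_ge0 // ltW // N_gt0.
case: f12 => fE; [apply: (main none1 none1_unit)|apply: (main none2 none2_unit)].
- by move=> n w v; rewrite VRP fE => vr; exact: psi_none1.
- move=> n w U ok; have [a0 b0 c0] := @params_ge0 n w U (K n) ok.
  by rewrite Poi3_none1 // subrK fE.
- by move=> n w v; rewrite VRP fE => vr; exact: psi_none2.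
- move=> n w U ok; have [a0 b0 c0] := @params_ge0 n w U (K n) ok.
  by rewrite Poi3_none2 // subrK fE.
Unshelve. all: by end_near. Qed.

(** The ball sizes contribute factors close to 1, the common part a factor close to [rho_n^(K+1)]:
    [rho_n^K] from the balls and one more [rho_n], up to [q_n], from the edge at the vertex
    itself. *)
Lemma scaled_params n (w : sample n) U : okn n ->
  let x1 := #|gb sel1 w U (K n)|%:R / N n ^+ K n in
  let x2 := #|gb sel2 w U (K n)|%:R / N n ^+ K n in
  let y := #|gcap sel1 sel2 w U (K n)|%:R / N n ^+ K n in
  [/\ q n * #|gb sel1 w U (K n)|%:R = Ln n * x1, q n * #|gb sel2 w U (K n)|%:R = Ln n * x2,
      p11 n * #|gcap sel1 sel2 w U (K n)|%:R = Ln n * (p11 n / q n * y)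
    & [/\ 0 <= p11 n / q n * y, p11 n / q n * y <= x1 &
      `|p11 n / q n * y - rho_ n ^+ (K n).+1| <= `|y - rho_ n ^+ K n| + q n]].
Proof.
move=> ok x1 x2 y; have [p0 p1 p2 p3] := p11_bounds ok.
have [_ /andP[q0 q1] _] := ok; have N0 := N_gt0 ok.
have Nk : 0 < N n ^+ K n by rewrite exprn_gt0.
have t0 : 0 <= p11 n / q n by rewrite divr_ge0 // ltW.
have t1 : p11 n / q n <= 1 by rewrite ler_pdivrMr // mul1r.
have y0 : 0 <= y by rewrite divr_ge0 // ltW.
split; [by rewrite qbE|by rewrite qbE| |split].
- by rewrite -(mulrCA (p11 n / q n)) -qbE //; field; rewrite gt_eqF.
- by rewrite mulr_ge0.
- apply: (@le_trans _ _ y); first by rewrite -[leRHS]mul1r ler_wpM2r.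
  by rewrite ler_wpM2r ?invr_ge0 ?(ltW Nk) // gcap_le1.
have /andP[r0 r1] := rho_unit n.
have tr : `|p11 n / q n - rho_ n| <= q n.
  have -> : p11 n / q n - rho_ n = (1 - rho_ n) * q n by rewrite p11E; field; rewrite gt_eqF.
  rewrite ger0_norm; last by rewrite mulr_ge0 ?subr_ge0 // ltW.
  by rewrite -[leRHS]mul1r; apply: ler_wpM2r; [exact: ltW|lra].
have rk : 0 <= rho_ n ^+ K n by rewrite exprn_ge0.
have rk1 : rho_ n ^+ K n <= 1 by rewrite exprn_ile1.
set ta := p11 n / q n in t0 t1 tr *.
have -> : ta * y - rho_ n ^+ (K n).+1 = ta * (y - rho_ n ^+ K n) + (ta - rho_ n) * rho_ n ^+ K n.
  by rewrite exprS; ring.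
have A : `|ta * (y - rho_ n ^+ K n)| <= `|y - rho_ n ^+ K n| by rewrite normrM (ger0_norm t0) ler_piMl.
have B : `|(ta - rho_ n) * rho_ n ^+ K n| <= q n.
  by rewrite normrM (ger0_norm rk); apply: le_trans tr; rewrite ler_piMr.
exact: le_trans (ler_normD _ _) (lerD A B).
Qed.

Lemma missed2_cvg :
  (fun n => En n (fun w => `|missed2 w - lambda `^ (2 - gamma)|)) @ \oo --> (0 : R).
Proof.
have [eta eta0 Heta] := conc_K; have [zeta zeta0 Hzeta] := conc_cap_K.
have -> : (fun n => En n (fun w => `|missed2 w - lambda `^ (2 - gamma)|)) =
   (fun n => En n (fun w => `|(\sum_(v in VR n) psi sel1 sel2 none3 w (VT n) v (K n)) / n%:R - lambda `^ (2 - gamma)|)).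
  apply/funext => n; apply: eq_Ex => w; rewrite /missed2.
  by under [in RHS]eq_bigr => v vR do rewrite psi_none3 -?VRP //.
apply: (@mean_psi none3 (fun n => expR (- (Ln n * (2 - rho_ n ^+ (K n).+1))))
   (fun n => 2 * (eta n + eta n + (zeta n + q n)))).
- exact: none3_unit.
- move=> n ok; apply: expR_Ln_unit => //; have /andP[_] := gamma_n_unit n; lra.
- exact: lambda_gamma_cvg.
- by apply: cvg0Z; apply: cvg0D; apply: cvg0D => //; exact: q_small.
near=> n; have ok : okn n by near: n; exact: near_ok.
have He : forall f (U : {set vertex n}), prob1 (mu n) f = q n -> (#|~: U| <= 2)%N ->
    En n (fun w => `|#|gb f w U (K n)|%:R / N n ^+ K n - 1|) <= eta n by near: n.
have Hz : forall U : {set vertex n}, (#|~: U| <= 2)%N ->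
    En n (fun w => `|#|gcap sel1 sel2 w U (K n)|%:R / N n ^+ K n - rho_ n ^+ K n|) <= zeta n by near: n.
move=> U Uj.
apply: (@le_trans _ _ (En n (fun w => 2 * (`|#|gb sel1 w U (K n)|%:R / N n ^+ K n - 1| +
   `|#|gb sel2 w U (K n)|%:R / N n ^+ K n - 1| +
   (`|#|gcap sel1 sel2 w U (K n)|%:R / N n ^+ K n - rho_ n ^+ K n| + q n))))); last first.
  rewrite ExZ ler_wpM2l // !ExD Ex_cst ?mu3_sum1 //; apply: lerD; last by rewrite lerD2r Hz.
  by apply: lerD; apply: He => //; [exact: prob_sel1|exact: prob_sel2].
apply: (ler_Ex (mu_ge0 ok)) => w; have [a0 b0 c0] := @params_ge0 n w U (K n) ok.
rewrite Poi3_none3 //; have /= [E1 E2 Ec [y0 yx yd]] := @scaled_params n w U ok.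
rewrite E1 E2 Ec.
set x1 := #|gb sel1 w U _|%:R / _ in yx *; set x2 := #|gb sel2 w U _|%:R / _.
set ty := p11 n / q n * _ in y0 yx yd *.
have -> : Ln n * x1 - Ln n * ty + (Ln n * x2 - Ln n * ty) + Ln n * ty = Ln n * (x1 + x2 - ty) by ring.
have x20 : 0 <= x2 by rewrite divr_ge0 // exprn_ge0 // ltW // N_gt0.
have /andP[gn0 gn1] := gamma_n_unit n.
apply: (le_trans (expR_lip (Ln_ge0 ok) _ _)); [lra|lra|].
rewrite ler_wpM2l //.
have -> : x1 + x2 - ty - (2 - rho_ n ^+ (K n).+1) = (x1 - 1) + (x2 - 1) - (ty - rho_ n ^+ (K n).+1) by ring.
apply: (le_trans (ler_normB _ _)); apply: lerD => //; exact: ler_normD.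
Unshelve. all: by end_near. Qed.

Lemma ball_frac f : f = sel1 \/ f = sel2 ->
  (fun n => En n (fun w => #|gb f w (VT n) (K n)|%:R / n%:R)) @ \oo --> (0 : R).
Proof.
move=> f12; have NK : (fun n => N n ^+ K n / n%:R) @ \oo --> (0 : R) by apply: Nn_Kn_small.
apply: (cvg0_le (cvg0Z 2 NK)); near=> n; have ok : okn n by near: n; exact: near_ok.
have pf : prob1 (mu n) f = q n by case: f12 => ->; [exact: prob_sel1|exact: prob_sel2].
have n0 := n_gt0 ok; have mu0 := mu_ge0 ok.
rewrite Ex_ge0 //=.
have N20 : 20 <= #|vertex n|%:R * q n by rewrite NE //; case: ok.
have := Ex_gb_le2 mu0 (mu3_sum1 _ _) (VT n) (K n) pf N20; rewrite NE // => h.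
under eq_Ex do rewrite mulrC.
by rewrite ExZ mulrC mulrA ler_wpM2r // invr_ge0 ltW.
Unshelve. all: by end_near. Qed.

Lemma sum_notin_gb n f (w : sample n) k :
  \sum_(v : vertex n) (v \notin gb f w (VT n) k)%:R = \sum_(v in VR n) (v \notin gb f w (VT n) k)%:R :> R.
Proof.
rewrite (bigD1 (origin n)) //= root_ball mulr0n add0r; apply: eq_bigl => v.
by rewrite VRP.
Qed.

Lemma sum_in_gb n f (w : sample n) k :
  \sum_(v : vertex n) (v \in gb f w (VT n) k)%:R = #|gb f w (VT n) k|%:R :> R.
Proof.
rewrite -sum1_card natr_sum [RHS]big_mkcond; apply: eq_bigr => v _.
by case: (v \in _).
Qed.

Lemma sum_notin2_gb n (w : sample n) k :
  \sum_(v : vertex n) ((v \notin gb sel1 w (VT n) k) && (v \notin gb sel2 w (VT n) k))%:R =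
  \sum_(v in VR n) ((v \notin gb sel1 w (VT n) k) && (v \notin gb sel2 w (VT n) k))%:R :> R.
Proof.
rewrite (bigD1 (origin n)) //= !root_ball mulr0n add0r; apply: eq_bigl => v.
by rewrite VRP.
Qed.

Lemma NI_cvg : (fun n => En n (fun w => `|(NI (dstar q n) w)%:R / n%:R -
   (1 - 2 * lambda + lambda `^ (2 - gamma))|)) @ \oo --> (0 : R).
Proof.
have m1 := @missed_cvg sel1 (or_introl erefl); have m2 := @missed_cvg sel2 (or_intror erefl).
have b1 := @ball_frac sel1 (or_introl erefl); have b2 := @ball_frac sel2 (or_intror erefl).
apply: (cvg0_le (cvg0D (cvg0D (cvg0D m1 m2) missed2_cvg) (cvg0D b1 b2))); near=> n.
have ok : okn n by near: n; exact: near_ok.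
have mu0 := mu_ge0 ok; have n0 := n_gt0 ok.
have [dE _ _] : [/\ dstar q n = (K n).+1%:Z, N n ^+ K n < n%:R / (ln (ln n%:R) ^+ 2)
   & n%:R / (ln (ln n%:R) ^+ 2) <= N n ^+ (K n).+1].
  by near: n; exact: dstarP.
rewrite Ex_ge0 //= -!ExD; apply: ler_Ex => // w.
have NIE : (NI (dstar q n) w)%:R = \sum_(v : vertex n)
   (at_dist (gr sel1 w) (origin n) (K n).+1%:Z v && at_dist (gr sel2 w) (origin n) (K n).+1%:Z v)%:R :> R.
  rewrite /NI dE -sum1_card natr_sum big_mkcond; apply: eq_bigr => v _; rewrite inE.
  by case: (_ && _).
have tot : `|(NI (dstar q n) w)%:R / n%:R - (1 - missed sel1 w - missed sel2 w + missed2 w)| <=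
    #|gb sel1 w (VT n) (K n)|%:R / n%:R + #|gb sel2 w (VT n) (K n)|%:R / n%:R.
  have -> : 1 - missed sel1 w - missed sel2 w + missed2 w =
     (\sum_(v : vertex n) (1 - (v \notin gb sel1 w (VT n) (K n).+1)%:R - (v \notin gb sel2 w (VT n) (K n).+1)%:R +
     ((v \notin gb sel1 w (VT n) (K n).+1) && (v \notin gb sel2 w (VT n) (K n).+1))%:R)) / n%:R.
    rewrite big_split !sumrB /= sum_notin2_gb !sum_notin_gb sumr_const cardT -cardE (cardV ok).
    by rewrite /missed /missed2; field; rewrite gt_eqF.
  rewrite NIE -mulrBl -mulrDl -!sum_in_gb -big_split -sumrB normrM (ger0_norm (_ : 0 <= n%:R^-1)) ?invr_ge0 ?(ltW n0) //=.
  rewrite ler_wpM2r ?invr_ge0 ?(ltW n0) //; apply: (le_trans (ler_norm_sum _ _ _)); apply: ler_sum => v _.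
  exact: both_dist_bound.
set X := _ / n%:R in tot *; set l := lambda `^ _.
have -> : X - (1 - 2 * lambda + l) = (X - (1 - missed sel1 w - missed sel2 w + missed2 w)) +
   ((missed2 w - l) - (missed sel1 w - lambda) - (missed sel2 w - lambda)) by ring.
apply: (le_trans (ler_normD _ _)); rewrite addrC; apply: lerD => //.
apply: (le_trans (ler_normB _ _)).
have := ler_normB (missed2 w - l) (missed sel1 w - lambda).
set a := `|_ - _ - _|; set b := `|missed2 w - l|; set c := `|missed sel1 w - _|; set d := `|missed sel2 w - _|.
by lra.
Unshelve. all: by end_near. Qed.

Definition missed' n f (w : sample n) : R :=
  (\sum_(v in VR n) (v \notin gb f w (VT n) (K n).+2)%:R) / n%:R.

(** That almost no vertex misses a ball of radius [K + 2] is left as a hypothesis; it results from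
    the study of the next level. *)
Lemma Nsame_cvg :
  (forall f, f = sel1 \/ f = sel2 -> (fun n => En n (missed' f)) @ \oo --> (0 : R)) ->
  (fun n => En n (fun w => `|(Nsame w)%:R / n%:R -
   (1 - 2 * lambda + 2 * lambda `^ (2 - gamma))|)) @ \oo --> (0 : R).
Proof.
move=> mm; have m1 := @missed_cvg sel1 (or_introl erefl); have m2 := @missed_cvg sel2 (or_intror erefl).
have b1 := @ball_frac sel1 (or_introl erefl); have b2 := @ball_frac sel2 (or_intror erefl).
have m1' := mm sel1 (or_introl erefl); have m2' := mm sel2 (or_intror erefl).
apply: (cvg0_le (cvg0D (cvg0D (cvg0D m1 m2) (cvg0Z 2 missed2_cvg)) (cvg0D (cvg0D b1 b2) (cvg0D m1' m2')))); near=> n.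
have ok : okn n by near: n; exact: near_ok.
have mu0 := mu_ge0 ok; have n0 := n_gt0 ok.
rewrite Ex_ge0 //= -ExZ -!ExD; apply: ler_Ex => // w.
have NsE : (Nsame w)%:R = \sum_(v : vertex n)
   (gdist (gr sel1 w) (origin n) v == gdist (gr sel2 w) (origin n) v)%:R :> R.
  rewrite /Nsame -sum1_card natr_sum big_mkcond; apply: eq_bigr => v _; rewrite inE.
  by case: (_ == _).
have tot : `|(Nsame w)%:R / n%:R - (1 - missed sel1 w - missed sel2 w + 2 * missed2 w)| <=
    #|gb sel1 w (VT n) (K n)|%:R / n%:R + #|gb sel2 w (VT n) (K n)|%:R / n%:R + (missed' sel1 w + missed' sel2 w).
  have -> : 1 - missed sel1 w - missed sel2 w + 2 * missed2 w =
     (\sum_(v : vertex n) (1 - (v \notin gb sel1 w (VT n) (K n).+1)%:R - (v \notin gb sel2 w (VT n) (K n).+1)%:R +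
     2 * ((v \notin gb sel1 w (VT n) (K n).+1) && (v \notin gb sel2 w (VT n) (K n).+1))%:R)) / n%:R.
    rewrite big_split !sumrB /= -mulr_sumr sum_notin2_gb !sum_notin_gb sumr_const cardT -cardE (cardV ok).
    by rewrite /missed /missed2; field; rewrite gt_eqF.
  rewrite NsE /missed' -!sum_notin_gb -mulrBl -!mulrDl -!sum_in_gb -!big_split -sumrB normrM.
  rewrite (ger0_norm (_ : 0 <= n%:R^-1)) ?invr_ge0 ?(ltW n0) //=.
  rewrite ler_wpM2r ?invr_ge0 ?(ltW n0) //; apply: (le_trans (ler_norm_sum _ _ _)); apply: ler_sum => v _.
  by rewrite [leRHS]addrA; exact: same_dist_bound.
set X := _ / n%:R in tot *; set l := lambda `^ _.
have -> : X - (1 - 2 * lambda + 2 * l) = (X - (1 - missed sel1 w - missed sel2 w + 2 * missed2 w)) +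
   (2 * (missed2 w - l) - (missed sel1 w - lambda) - (missed sel2 w - lambda)) by ring.
apply: (le_trans (ler_normD _ _)); rewrite addrC; apply: lerD => //.
apply: (le_trans (ler_normB _ _)).
have := ler_normB (2 * (missed2 w - l)) (missed sel1 w - lambda); rewrite normrM (ger0_norm (ler0n R 2)).
set a := `|2 * _ - _|; set b := `|missed2 w - l|; set c := `|missed sel1 w - _|; set d := `|missed sel2 w - _|.
by lra.
Unshelve. all: by end_near. Qed.

Lemma p11q_cvg : (fun n => p11 n / q n) @ \oo --> rho.
Proof.
have : (fun n => rho_ n + (1 - rho_ n) * q n) @ \oo --> rho + (1 - rho) * 0.
  apply: cvgD => //; apply: cvgM; last exact: q_small.
  by apply: cvgB => //; exact: cvg_cst.
rewrite mulr0 addr0; apply: cvg_trans; apply: near_eq_cvg; near=> n.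
have ok : okn n by near: n; exact: near_ok.
by have [_ /andP[q0 _] _] := ok; rewrite p11E; field; rewrite gt_eqF.
Unshelve. all: by end_near. Qed.

(** * Limits at one level, with free radius and normalisation *)

Section level.
Variables (k : nat -> nat) (m : nat -> R) (r0 : R).
Hypothesis r0_unit : 0 <= r0 <= 1.
Hypothesis m_gt0 : \forall n \near \oo, 0 < m n.
(** The typical number of neighbours in the ball diverges, so that counts and ratios concentrate. *)
Hypothesis qm_small : (fun n => (q n * m n)^-1) @ \oo --> (0 : R).
Hypothesis k_small : (fun n => (k n)%:R / n%:R) @ \oo --> (0 : R).
Hypothesis size_cvg : forall f, f = sel1 \/ f = sel2 ->
  (fun n => En n (fun w => `|#|gb f w (VT n) (k n)|%:R / m n - 1|)) @ \oo --> (0 : R).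
Hypothesis cap_cvg :
  (fun n => En n (fun w => `|#|gcap sel1 sel2 w (VT n) (k n)|%:R / m n - r0|)) @ \oo --> (0 : R).

Let qm_ge1 : \forall n \near \oo, 1 <= q n * m n.
Proof.
near=> n; have ok : okn n by near: n; exact: near_ok.
have [_ /andP[q0 _] _] := ok; have m0 : 0 < m n by near: n.
have qm0 : 0 < q n * m n by rewrite mulr_gt0.
have : `|(q n * m n)^-1| <= 1 by near: n; move/cvg0P: qm_small; apply.
by rewrite ger0_norm ?invr_ge0 ?(ltW qm0) // invf_le1.
Unshelve. all: by end_near. Qed.

Let sqrt_small : (fun n => (Num.sqrt (q n * m n))^-1) @ \oo --> (0 : R).
Proof.
have := cvg0_sqrt qm_small; apply: cvg_trans; apply: near_eq_cvg; near=> n.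
rewrite sqrtrV //; apply: le_trans ler01 _; near: n; exact: qm_ge1.
Unshelve. all: by end_near. Qed.

Let extra_small f : f = sel1 \/ f = sel2 ->
  (fun n => (k n)%:R / (m n * n%:R) * En n (fun w => #|gb f w (VT n) (k n)|%:R)) @ \oo --> (0 : R).
Proof.
move=> f12; have sc := size_cvg f12.
have b : (fun n => (k n)%:R / n%:R * (1 + En n (fun w => `|#|gb f w (VT n) (k n)|%:R / m n - 1|))) @ \oo --> (0 : R).
  rewrite -(mul0r (1 + 0)); apply: cvgM => //; apply: cvgD => //; exact: cvg_cst.
apply: (cvg0_le b); near=> n; have ok : okn n by near: n; exact: near_ok.
have m0 : 0 < m n by near: n.
have n0 := n_gt0 ok; have mu0 := mu_ge0 ok.
have E0 : 0 <= En n (fun w => #|gb f w (VT n) (k n)|%:R) by apply: Ex_ge0.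
apply/andP; split; first by rewrite mulr_ge0 // divr_ge0 // mulr_ge0 // ltW.
have -> : (k n)%:R / (m n * n%:R) * En n (fun w => #|gb f w (VT n) (k n)|%:R) =
   (k n)%:R / n%:R * ((m n)^-1 * En n (fun w => #|gb f w (VT n) (k n)|%:R)).
  by field; rewrite !gt_eqF.
apply: ler_wpM2l; first by rewrite divr_ge0 // ltW.
rewrite -ExZ -[X in X + _](@Ex_cst _ (edge n) _ _ (mu3_sum1 (q n) (rho_ n))) -ExD; apply: ler_Ex => // w.
by rewrite mulrC; have := ler_norm (#|gb f w (VT n) (k n)|%:R / m n - 1); lra.
Unshelve. all: by end_near. Qed.

Let lev_size_small f : f = sel1 \/ f = sel2 ->
  (fun n => @lev_size R n _ (mu n) (m n) (k n) f) @ \oo --> (0 : R).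
Proof.
move=> f12; have := cvg0D (size_cvg f12) (extra_small f12).
apply: cvg_trans; apply: near_eq_cvg; near=> n; have ok : okn n by near: n; exact: near_ok.
by rewrite /lev_size natV.
Unshelve. all: by end_near. Qed.

Let lev_cap_small :
  (fun n => @lev_cap R n _ (mu n) sel1 sel2 (m n) r0 (k n)) @ \oo --> (0 : R).
Proof.
have := cvg0D (cvg0D cap_cvg (extra_small (or_introl erefl))) (extra_small (or_intror erefl)).
apply: cvg_trans; apply: near_eq_cvg; near=> n; have ok : okn n by near: n; exact: near_ok.
by rewrite /lev_cap natV.
Unshelve. all: by end_near. Qed.

Lemma level_nbr_cvg f : f = sel1 \/ f = sel2 ->
  (fun n => \sum_(v in VR n) En n (fun w =>
     `|#|nbr f w v (gb f w (VT n :\ v)%SET (k n))|%:R / (q n * m n) - 1|) / n%:R) @ \oo --> (0 : R).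
Proof.
move=> f12; apply: (cvg0_le (cvg0D sqrt_small (cvg0Z 2 (lev_size_small f12)))); near=> n.
have ok : okn n by near: n; exact: near_ok.
have [_ /andP[q0 _] _] := ok; have m0 : 0 < m n by near: n.
have qm1 : 1 <= q n * m n by near: n; exact: qm_ge1.
have n0 := n_gt0 ok; have mu0 := mu_ge0 ok.
have pf : prob1 (mu n) f = q n by case: f12 => ->; [exact: prob_sel1|exact: prob_sel2].
apply/andP; split.
  by apply: sumr_ge0 => v _; rewrite divr_ge0 ?(ltW n0) // Ex_ge0.
have := @level_avg_nbr R n _ (mu n) mu0 (mu3_sum1 _ _) sel1 (q n) (prob_sel1 _ _) (m n) (k n) q0 m0 qm1 f pf.
by rewrite natV.
Unshelve. all: by end_near. Qed.

Lemma level_ratio_cvg :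
  (fun n => \sum_(v in VR n) En n (fun w => `|par_ratio sel1 sel2 w v (k n) - rho * r0|) / n%:R)
  @ \oo --> (0 : R).
Proof.
have s1 := lev_size_small (or_introl erefl); have s2 := lev_size_small (or_intror erefl).
have t : (fun n => `|p11 n / q n - rho|) @ \oo --> (0 : R).
  rewrite -(@normr0 _ R); apply: cvg_norm; rewrite -(subrr rho); apply: cvgB; first exact: p11q_cvg.
  exact: cvg_cst.
apply: (cvg0_le (cvg0D (cvg0D (cvg0D (cvg0D (cvg0Z 3 sqrt_small) (cvg0Z 3 s1)) (cvg0Z 2 s2)) lev_cap_small) t)).
near=> n; have ok : okn n by near: n; exact: near_ok.
have [_ /andP[q0 _] _] := ok; have m0 : 0 < m n by near: n.
have qm1 : 1 <= q n * m n by near: n; exact: qm_ge1.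
have n0 := n_gt0 ok; have mu0 := mu_ge0 ok.
apply/andP; split.
  by apply: sumr_ge0 => v _; rewrite divr_ge0 ?(ltW n0) // Ex_ge0.
have := @level_avg_ratio R n _ (mu n) mu0 (mu3_sum1 _ _) sel1 sel2 (q n) (prob_sel1 _ _) (prob_sel2 _ _)
  (m n) r0 (k n) q0 m0 qm1; rewrite natV // => lar.
apply: le_trans (lerD lar (lexx `|p11 n / q n - rho|)).
have tn : \sum_(v in VR n) `|p11 n / q n - rho| / n%:R <= `|p11 n / q n - rho|.
  have := @sum_le_card R n (mem (VR n)) (fun=> `|p11 n / q n - rho| / n%:R) (`|p11 n / q n - rho| / n%:R).
  rewrite natV // [n%:R * _]mulrC divfK ?gt_eqF //; apply; first by rewrite divr_ge0 // ltW.
  by move=> v _.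
apply: (@le_trans _ _ (\sum_(v in VR n) En n (fun w => `|par_ratio sel1 sel2 w v (k n) - p11 n / q n * r0|) / n%:R +
   \sum_(v in VR n) `|p11 n / q n - rho| / n%:R)); last by rewrite lerD2l.
rewrite -big_split /=; apply: ler_sum => v _; rewrite -mulrDl ler_wpM2r ?invr_ge0 ?(ltW n0) //.
rewrite -[X in _ + X](@Ex_cst _ (edge n) _ _ (mu3_sum1 (q n) (rho_ n))) -ExD; apply: ler_Ex => // w.
have -> : par_ratio sel1 sel2 w v (k n) - rho * r0 =
  (par_ratio sel1 sel2 w v (k n) - p11 n / q n * r0) + (p11 n / q n - rho) * r0 by ring.
apply: (le_trans (ler_normD _ _)); rewrite lerD2l normrM -[leRHS]mulr1 ler_wpM2l //.
by case/andP: r0_unit => a b; rewrite ger0_norm.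
Unshelve. all: by end_near. Qed.

End level.

(** One factor [rho_n] less does not change the limit: either [rho_n] tends to 1 or both powers tend
    to 0. *)
Lemma gammaK_cvg : (fun n => rho_ n ^+ K n) @ \oo --> gamma.
Proof.
have [rho1|rho1] := ltP rho 1.
  rewrite gamma_rho_lt1 //; apply: rho_pow_small => // J; by apply: Kn_ge.
have rhoE : rho = 1 by apply/eqP; rewrite eq_le rho1; case/andP: rho_itv => _ ->.
have : (fun n => rho_ n ^+ (K n).+1 * (rho_ n)^-1) @ \oo --> gamma * 1^-1.
  apply: cvgM; first exact: gamma_n_cvg.
  by apply: cvgV; [rewrite oner_eq0|rewrite -rhoE].
rewrite invr1 mulr1; apply: cvg_trans; apply: near_eq_cvg; apply: nearW => n.
by rewrite exprS mulrAC divff ?mul1r // gt_eqF //; case/andP: (rho_01 n).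
Qed.

(** Turns the limit [rho * gamma] produced by the levels with [r0 = gamma] into [gamma]. *)
Lemma rho_gamma : rho * gamma = gamma.
Proof.
have [rho1|rho1] := ltP rho 1; first by rewrite gamma_rho_lt1 // mulr0.
have -> : rho = 1 by apply/eqP; rewrite eq_le rho1; case/andP: rho_itv => _ ->.
by rewrite mul1r.
Qed.

Lemma setC_VT n : (#|~: VT n| <= 2)%N.
Proof. by rewrite finset.setCT cards0. Qed.

Lemma from_conc (k : nat -> nat) : (fun n => N n ^+ k n / n%:R) @ \oo --> (0 : R) ->
  (fun n => (k n)%:R ^+ 2 / n%:R) @ \oo --> (0 : R) ->
  (forall J, \forall n \near \oo, (J <= k n)%N) ->
  (fun n => rho_ n ^+ k n) @ \oo --> gamma ->
  [/\ forall f, f = sel1 \/ f = sel2 ->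
       (fun n => En n (fun w => `|#|gb f w (VT n) (k n)|%:R / N n ^+ k n - 1|)) @ \oo --> (0 : R),
      (fun n => En n (fun w => `|#|gcap sel1 sel2 w (VT n) (k n)|%:R / N n ^+ k n - gamma|)) @ \oo --> (0 : R)
    & (fun n => (k n)%:R / n%:R) @ \oo --> (0 : R)].
Proof.
move=> Nk k2 kJ rk; have [eta eta0 He] := conc_ball Nk k2; have [zeta zeta0 Hz] := conc_cap Nk k2 kJ.
have rg : (fun n => `|rho_ n ^+ k n - gamma|) @ \oo --> (0 : R).
  by rewrite -(@normr0 _ R); apply: cvg_norm; rewrite -(subrr gamma); apply: cvgB => //; exact: cvg_cst.
split.
- move=> f f12; apply: (cvg0_le eta0); near=> n; have ok : okn n by near: n; exact: near_ok.
  have pf : prob1 (mu n) f = q n by case: f12 => ->; [exact: prob_sel1|exact: prob_sel2].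
  have H : forall f (U : {set vertex n}), prob1 (mu n) f = q n -> (#|~: U| <= 2)%N ->
    En n (fun w => `|#|gb f w U (k n)|%:R / N n ^+ k n - 1|) <= eta n by near: n.
  by rewrite (H f (VT n) pf (setC_VT n)) andbT; apply: Ex_ge0 => //; exact: mu_ge0.
- apply: (cvg0_le (cvg0D zeta0 rg)); near=> n; have ok : okn n by near: n; exact: near_ok.
  have mu0 := mu_ge0 ok.
  have H : forall U : {set vertex n}, (#|~: U| <= 2)%N ->
    En n (fun w => `|#|gcap sel1 sel2 w U (k n)|%:R / N n ^+ k n - rho_ n ^+ k n|) <= zeta n by near: n.
  rewrite Ex_ge0 //=; apply: le_trans (lerD (H (VT n) (setC_VT n)) (lexx `|rho_ n ^+ k n - gamma|)).
  rewrite -[X in _ + X](@Ex_cst _ (edge n) _ _ (mu3_sum1 (q n) (rho_ n))) -ExD; apply: ler_Ex => // w.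
  exact: ler_distD.
apply: (cvg0_le k2); apply: nearW => n; rewrite divr_ge0 //= ler_wpM2r ?invr_ge0 //.
by rewrite -natrX ler_nat; case: (k n) => // j; rewrite expnS leq_pmulr.
Unshelve. all: by end_near. Qed.

Lemma K1_small : (fun n => (K n).+1%:R ^+ 2 / n%:R) @ \oo --> (0 : R).
Proof.
have K2 : (fun n => (K n)%:R ^+ 2 / n%:R) @ \oo --> (0 : R) by apply: Kn2_small.
apply: (cvg0_le (cvg0D (cvg0Z 2 K2) (cvg0Z 2 (@invn_small R)))); apply: nearW => n.
rewrite divr_ge0 ?sqr_ge0 //= mulrA -mulrDl ler_wpM2r ?invr_ge0 // -natr1.
by move: (K n)%:R => a; have := sqr_ge0 (a - 1); nra.
Qed.

Lemma K1_ge J : \forall n \near \oo, (J <= (K n).+1)%N.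
Proof.
have h : \forall n \near \oo, (J <= K n)%N by apply: Kn_ge.
by near=> n; apply: leqW; near: n.
Unshelve. all: by end_near. Qed.

Lemma invLn_small : lambda = 0 -> (fun n => (Ln n)^-1) @ \oo --> (0 : R).
Proof.
move=> l0; have lc := lambda_n_cvg; rewrite l0 in lc; apply/cvg0P => e e0; near=> n.
have : `|expR (- Ln n)| <= expR (- e^-1) by near: n; move/cvg0P: lc; apply; exact: expR_gt0.
rewrite ger0_norm ?expR_ge0 // ler_expR lerN2 => eL.
have e'0 : 0 < e^-1 by rewrite invr_gt0.
have L0 : 0 < Ln n by exact: lt_le_trans eL.
by rewrite ger0_norm ?invr_ge0 ?(ltW L0) // -[leRHS]invrK lef_pV2 ?posrE.
Unshelve. all: by end_near. Qed.

Definition level_concl (k : nat -> nat) (m : nat -> R) (r0 : R) : Prop :=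
  (forall f, f = sel1 \/ f = sel2 ->
    (fun n => \sum_(v in VR n) En n (fun w =>
     `|#|nbr f w v (gb f w (VT n :\ v)%SET (k n))|%:R / (q n * m n) - 1|) / n%:R) @ \oo --> (0 : R)) /\
  (fun n => \sum_(v in VR n) En n (fun w => `|par_ratio sel1 sel2 w v (k n) - rho * r0|) / n%:R)
  @ \oo --> (0 : R).

Lemma near_Nk_gt0 (k : nat -> nat) : \forall n \near \oo, 0 < N n ^+ k n.
Proof.
near=> n; have ok : okn n by near: n; exact: near_ok.
by rewrite exprn_gt0 // N_gt0.
Unshelve. all: by end_near. Qed.

(** Here [q_n N^K = Ln n] diverges, so already the ball of radius [K] offers many neighbours to a
    typical vertex. *)
Lemma level0 : lambda = 0 -> level_concl K (fun n => N n ^+ K n) gamma.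
Proof.
move=> l0.
have [sz cp kn] : [/\ forall f, f = sel1 \/ f = sel2 ->
       (fun n => En n (fun w => `|#|gb f w (VT n) (K n)|%:R / N n ^+ K n - 1|)) @ \oo --> (0 : R),
      (fun n => En n (fun w => `|#|gcap sel1 sel2 w (VT n) (K n)|%:R / N n ^+ K n - gamma|)) @ \oo --> (0 : R)
    & (fun n => (K n)%:R / n%:R) @ \oo --> (0 : R)].
  by apply: from_conc; [apply: Nn_Kn_small|apply: Kn2_small|move=> J; apply: Kn_ge|exact: gammaK_cvg].
have qm : (fun n => (q n * N n ^+ K n)^-1) @ \oo --> (0 : R).
  have := invLn_small l0; apply: cvg_trans; apply: near_eq_cvg; near=> n.
  have ok : okn n by near: n; exact: near_ok.
  by rewrite qbE // divff ?mulr1 // expf_neq0 // gt_eqF // N_gt0.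
split; first by move=> f f12; apply: level_nbr_cvg => //; exact: near_Nk_gt0.
exact: (level_ratio_cvg gamma_itv (near_Nk_gt0 K) qm kn sz cp).
Unshelve. all: by end_near. Qed.

(** Here [Ln] tends to 0, that is [N^(K+1) = o(n)], so the moment bounds still apply at radius
    [K + 1]; the defining inequality of [d_n^*] makes [q_n N^(K+1)] diverge. *)
Lemma level1 : lambda = 1 -> level_concl (fun n => (K n).+1) (fun n => N n ^+ (K n).+1) gamma.
Proof.
move=> l1; have L0 : Ln @ \oo --> (0 : R).
  by have := Ln_cvg; rewrite l1 invr1 ln1; apply.
have [sz cp kn] := @from_conc (fun n => (K n).+1) L0 K1_small K1_ge gamma_n_cvg.
have lN : (fun n => (ln (ln n%:R) ^+ 2 : R) / N n) @ \oo --> (0 : R) by apply: lln_Nn_small.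
have qm : (fun n => (q n * N n ^+ (K n).+1)^-1) @ \oo --> (0 : R).
  apply: (cvg0_le lN); near=> n; have ok : okn n by near: n; exact: near_ok.
  have [_ _ h] : [/\ dstar q n = (K n).+1%:Z, N n ^+ K n < n%:R / (ln (ln n%:R) ^+ 2)
     & n%:R / (ln (ln n%:R) ^+ 2) <= N n ^+ (K n).+1] by near: n; exact: dstarP.
  have l1' : 1 <= (ln (ln n%:R) ^+ 2 : R) by near: n; exact: lln_ge1.
  have [_ /andP[q0 _] _] := ok; have N0 := N_gt0 ok; have n0 := n_gt0 ok.
  have lp : 0 < (ln (ln n%:R) ^+ 2 : R) by exact: lt_le_trans l1'.
  have M0 : 0 < N n ^+ (K n).+1 by rewrite exprn_gt0.
  rewrite invr_ge0 mulr_ge0 ?(ltW q0) ?(ltW M0) //=.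
  have -> : ln (ln n%:R) ^+ 2 / N n = (N n / ln (ln n%:R) ^+ 2)^-1 by rewrite invf_div.
  have NL0 : 0 < N n / ln (ln n%:R) ^+ 2 by exact: divr_gt0.
  have qM0 : 0 < q n * N n ^+ (K n).+1 by exact: mulr_gt0.
  rewrite lef_pV2 ?posrE //.
  have -> : N n / ln (ln n%:R) ^+ 2 = q n * (n%:R / ln (ln n%:R) ^+ 2) by rewrite /Nn; ring.
  by rewrite ler_wpM2l // ltW.
split; first by move=> f f12; apply: level_nbr_cvg => //; exact: near_Nk_gt0.
exact: (level_ratio_cvg gamma_itv (near_Nk_gt0 (fun n => (K n).+1)) qm kn sz cp).
Unshelve. all: by end_near. Qed.

Definition r0_mid : R := (1 - 2 * lambda + lambda `^ (2 - gamma)) / (1 - lambda).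

Lemma r0_mid_unit : 0 < lambda < 1 -> 0 <= r0_mid <= 1.
Proof.
move=> /andP[l0 l1]; have /andP[g0 g1] := gamma_itv.
have hi : lambda `^ (2 - gamma) <= lambda.
  rewrite -[leRHS]powRr1 ?(ltW l0) //; apply: ger_powR; first by rewrite l0 ltW.
  lra.
have lo : lambda ^+ 2 <= lambda `^ (2 - gamma).
  rewrite -powR_mulrn ?(ltW l0) //; apply: ger_powR; first by rewrite l0 ltW.
  lra.
have d0 : 0 < 1 - lambda by lra.
by rewrite /r0_mid divr_ge0 ?(ltW d0) //= ?ler_pdivrMr //; nra.
Qed.

Lemma gb_missed n f (w : sample n) : okn n ->
  #|gb f w (VT n) (K n).+1|%:R = n%:R * (1 - missed f w) :> R.
Proof.
move=> ok; have n0 := n_gt0 ok; rewrite -sum_in_gb.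
have -> : \sum_(v : vertex n) (v \in gb f w (VT n) (K n).+1)%:R =
   \sum_(v : vertex n) (1 - (v \notin gb f w (VT n) (K n).+1)%:R) :> R.
  by apply: eq_bigr => v _; case: (v \in _); rewrite /= ?mulr0n ?mulr1n; ring.
rewrite sumrB sum_notin_gb sumr_const cardT -cardE (cardV ok) /missed.
by field; rewrite gt_eqF.
Qed.

Lemma gcap_missed n (w : sample n) : okn n ->
  #|gcap sel1 sel2 w (VT n) (K n).+1|%:R =
  n%:R * (1 - missed sel1 w - missed sel2 w + missed2 w) :> R.
Proof.
move=> ok; have n0 := n_gt0 ok.
have -> : #|gcap sel1 sel2 w (VT n) (K n).+1|%:R = \sum_(v : vertex n)
   (1 - (v \notin gb sel1 w (VT n) (K n).+1)%:R - (v \notin gb sel2 w (VT n) (K n).+1)%:R +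
     ((v \notin gb sel1 w (VT n) (K n).+1) && (v \notin gb sel2 w (VT n) (K n).+1))%:R) :> R.
  rewrite -sum1_card natr_sum big_mkcond; apply: eq_bigr => v _; rewrite inE.
  by case: (v \in _); case: (v \in _); rewrite /= ?mulr0n ?mulr1n; ring.
rewrite big_split !sumrB /= sum_notin2_gb !sum_notin_gb sumr_const cardT -cardE (cardV ok).
by rewrite /missed /missed2; field; rewrite gt_eqF.
Qed.

(** At radius [K + 1] the balls have linear size, out of reach of moment bounds with errors of order
    [N^k / n]. Their sizes are read off from the frequencies of missed vertices. *)
Lemma level_mid : 0 < lambda < 1 ->
  level_concl (fun n => (K n).+1) (fun n => (1 - lambda) * n%:R) r0_mid.
Proof.
move=> l01; have /andP[l0 l1] := l01; have d0 : 0 < 1 - lambda by lra.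
have mp : \forall n \near \oo, 0 < (1 - lambda) * n%:R.
  by near=> n; have ok : okn n by [near: n; exact: near_ok]; rewrite mulr_gt0 // n_gt0.
have qm : (fun n => (q n * ((1 - lambda) * n%:R))^-1) @ \oo --> (0 : R).
  have := cvg0Z (1 - lambda)^-1 (invNn_small alpha_liminf); apply: cvg_trans; apply: near_eq_cvg.
  apply: nearW => n; have -> : q n * ((1 - lambda) * n%:R) = (1 - lambda) * N n by rewrite /Nn; ring.
  by rewrite (@invfM R (1 - lambda) (N n)).
have kn : (fun n => (K n).+1%:R / n%:R) @ \oo --> (0 : R).
  apply: (cvg0_le K1_small); apply: nearW => n; rewrite divr_ge0 //= ler_wpM2r ?invr_ge0 //.
  by rewrite -natrX ler_nat expnS leq_pmulr.
have sz f : f = sel1 \/ f = sel2 -> (fun n => En n (fun w =>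
    `|#|gb f w (VT n) (K n).+1|%:R / ((1 - lambda) * n%:R) - 1|)) @ \oo --> (0 : R).
  move=> f12; have := cvg0Z (1 - lambda)^-1 (missed_cvg f12); apply: cvg_trans; apply: near_eq_cvg.
  near=> n; have ok : okn n by near: n; exact: near_ok.
  rewrite -ExZ; apply: eq_Ex => w; rewrite gb_missed //; have n0 := n_gt0 ok.
  have -> : n%:R * (1 - missed f w) / ((1 - lambda) * n%:R) - 1 = - ((1 - lambda)^-1 * (missed f w - lambda)).
    by field; rewrite !gt_eqF.
  by rewrite normrN normrM ger0_norm // invr_ge0 ltW.
have cp : (fun n => En n (fun w =>
    `|#|gcap sel1 sel2 w (VT n) (K n).+1|%:R / ((1 - lambda) * n%:R) - r0_mid|)) @ \oo --> (0 : R).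
  have m1 := @missed_cvg sel1 (or_introl erefl); have m2 := @missed_cvg sel2 (or_intror erefl).
  apply: (cvg0_le (cvg0Z (1 - lambda)^-1 (cvg0D (cvg0D m1 m2) missed2_cvg))).
  near=> n; have ok : okn n by near: n; exact: near_ok.
  have n0 := n_gt0 ok; have mu0 := mu_ge0 ok; rewrite Ex_ge0 //= -!ExD -ExZ; apply: ler_Ex => // w.
  rewrite gcap_missed //; set l := lambda `^ _.
  have -> : n%:R * (1 - missed sel1 w - missed sel2 w + missed2 w) / ((1 - lambda) * n%:R) - r0_mid =
    (1 - lambda)^-1 * ((missed2 w - l) - (missed sel1 w - lambda) - (missed sel2 w - lambda)).
    by rewrite /r0_mid -/l; field; rewrite !gt_eqF.
  rewrite normrM ger0_norm ?invr_ge0 ?(ltW d0) // ler_wpM2l ?invr_ge0 ?(ltW d0) //.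
  apply: (le_trans (ler_normB _ _)).
  have := ler_normB (missed2 w - l) (missed sel1 w - lambda).
  set a := `|_ - _ - _|; set b := `|missed2 w - l|; set c := `|missed sel1 w - _|; set d := `|missed sel2 w - _|.
  by lra.
split; first by move=> f f12; apply: level_nbr_cvg.
exact: (level_ratio_cvg (r0_mid_unit l01) mp qm kn sz cp).
Unshelve. all: by end_near. Qed.

(** Missing the ball of radius [K + 2] means having no neighbour in that of radius [K + 1], a
    relative deviation of 1 from the typical count. *)
Lemma missed'_of_level m r0 : (\forall n \near \oo, 0 < m n) ->
  level_concl (fun n => (K n).+1) m r0 ->
  forall f, f = sel1 \/ f = sel2 -> (fun n => En n (missed' f)) @ \oo --> (0 : R).
Proof.
move=> mp [lev _] f f12; apply: (cvg0_le (lev f f12)); near=> n.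
have ok : okn n by near: n; exact: near_ok.
have n0 := n_gt0 ok; have mu0 := mu_ge0 ok; apply/andP; split.
  by apply: Ex_ge0 => // w; rewrite divr_ge0 ?(ltW n0) // sumr_ge0.
rewrite /missed'; under eq_Ex do rewrite mulr_suml.
rewrite Ex_sum; apply: ler_sum => v; rewrite VRP => vr.
under eq_Ex do rewrite mulrC.
rewrite ExZ mulrC ler_wpM2r ?invr_ge0 ?(ltW n0) //; apply: ler_Ex => // w.
case: (boolP (v \in gb f w (VT n) (K n).+2)) => [vB|vN]; first by rewrite mulr0n.
have /eqP -> : #|nbr f w v (gb f w (VT n :\ v)%SET (K n).+1)| == 0%N by rewrite Y_eq0.
by rewrite mul0r sub0r normrN1 mulr1n.
Unshelve. all: by end_near. Qed.

Lemma missed'_cvg f : f = sel1 \/ f = sel2 -> (fun n => En n (missed' f)) @ \oo --> (0 : R).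
Proof.
have [l0|l0] := eqVneq lambda 0.
  (* For [lambda = 0] already the ball of radius [K + 1] misses almost no vertex. *)
  move=> f12; have m := missed_cvg f12; apply: (cvg0_le m); near=> n.
  have ok : okn n by near: n; exact: near_ok.
  have n0 := n_gt0 ok; have mu0 := mu_ge0 ok; apply/andP; split.
    by apply: Ex_ge0 => // w; rewrite divr_ge0 ?(ltW n0) // sumr_ge0.
  apply: ler_Ex => // w; rewrite l0 subr0; apply: le_trans (ler_norm _).
  rewrite ler_wpM2r ?invr_ge0 ?(ltW n0) //; apply: ler_sum => v _; rewrite ler_nat.
  by case: (boolP (v \in gb f w _ (K n).+1)) => vB; [rewrite (mem_gb_leq (leqnSn _) vB)|case: (_ \notin _)].
have [l1|l1] := eqVneq lambda 1.
  exact: (missed'_of_level (near_Nk_gt0 (fun n => (K n).+1)) (level1 l1)).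
have l01 : 0 < lambda < 1.
  by case/andP: lambda_itv => a b; rewrite !lt_neqAle eq_sym l0 l1 a b.
apply: (missed'_of_level _ (level_mid l01)).
near=> n; have ok : okn n by near: n; exact: near_ok.
by rewrite mulr_gt0 ?n_gt0 // subr_gt0; case/andP: l01.
Unshelve. all: by end_near. Qed.

Lemma cvg_dist0 (X : nat -> R) l : X @ \oo --> l -> (fun n => `|X n - l|) @ \oo --> (0 : R).
Proof.
move=> Xl; rewrite -(@normr0 _ R); apply: cvg_norm; rewrite -(subrr l); apply: cvgB => //.
exact: cvg_cst.
Qed.

Lemma tildeR_phi n (w : sample n) : okn n ->
  tildeR (G1 w) (G2 w) (origin n) = (\sum_(v in VR n) (phi sel1 sel2 w v : R)) / n%:R.
Proof.
move=> ok; rewrite tildeRE /tildeR_formula natV // mulrC; congr (_ / _).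
by apply: eq_bigl => v; rewrite VRP.
Qed.

Lemma Ex_avg n (F : sample n -> vertex n -> R) :
  En n (fun w => (\sum_(v in VR n) F w v) / n%:R) = \sum_(v in VR n) En n (F^~ v) / n%:R.
Proof.
under eq_Ex do rewrite mulr_suml.
rewrite Ex_sum; apply: eq_bigr => v _.
by under eq_Ex do rewrite mulrC; rewrite ExZ mulrC.
Qed.

Lemma sum_VR_cst n (c : R) : okn n -> \sum_(v in VR n) c = n%:R * c - c.
Proof.
move=> ok; have e : n%:R = #|VR n|%:R + 1 :> R.
  by rewrite natr1 -(natV ok) -cardsT (cardsD1 (origin n)) finset.in_setT.
rewrite sumr_const e -[in LHS]mulr_natl; ring.
Qed.

Lemma sum_in_gb_le n f (w : sample n) k :
  \sum_(v in VR n) (v \in gb f w (VT n) k)%:R <= #|gb f w (VT n) k|%:R :> R.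
Proof.
rewrite -sum_in_gb [leLHS]big_mkcond; apply: ler_sum => v _.
by case: ifP => // _; case: (v \in _).
Qed.

(** [k] will be [K] for [lambda = 0] and [K + 1] for [lambda = 1]; almost all vertices are then at
    distance [k + 1], and one level determines the limit. *)
Lemma tildeR_endpoint (k : nat -> nat) :
  (forall f, f = sel1 \/ f = sel2 ->
    (fun n => En n (fun w => #|gb f w (VT n) (k n)|%:R / n%:R)) @ \oo --> (0 : R)) ->
  (forall f, f = sel1 \/ f = sel2 -> (fun n => En n (fun w =>
    (\sum_(v in VR n) (v \notin gb f w (VT n) (k n).+1)%:R) / n%:R)) @ \oo --> (0 : R)) ->
  (fun n => \sum_(v in VR n) En n (fun w => `|par_ratio sel1 sel2 w v (k n) - rho * gamma|) / n%:R)
    @ \oo --> (0 : R) ->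
  (fun n => En n (fun w => `|tildeR (G1 w) (G2 w) (origin n) - gamma|)) @ \oo --> (0 : R).
Proof.
move=> b m r; have s1 : sel1 = sel1 \/ sel1 = sel2 by left.
have s2 : sel2 = sel1 \/ sel2 = sel2 by right.
apply: (cvg0_le (cvg0D (cvg0D (cvg0D (cvg0D (cvg0D (b _ s1) (b _ s2)) (m _ s1)) (m _ s2)) r)
  (@invn_small R))); near=> n.
have ok : okn n by near: n; exact: near_ok.
have n0 := n_gt0 ok; have mu0 := mu_ge0 ok; rewrite Ex_ge0 //=.
rewrite -[X in _ <= _ + X](@Ex_cst _ (edge n) _ _ (mu3_sum1 (q n) (rho_ n))) -Ex_avg -!ExD.
apply: ler_Ex => // w; rewrite tildeR_phi //.
have -> : (\sum_(v in VR n) phi sel1 sel2 w v) / n%:R - gamma =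
   (\sum_(v in VR n) (phi sel1 sel2 w v - gamma)) / n%:R - gamma / n%:R :> R.
  by rewrite sumrB (sum_VR_cst _ ok); field; rewrite gt_eqF.
have /andP[g0 g1] := gamma_itv.
apply: (le_trans (ler_normB _ _)); apply: lerD; last first.
  by rewrite ger0_norm ?divr_ge0 ?(ltW n0) // -[leRHS]mul1r ler_wpM2r ?invr_ge0 ?(ltW n0).
rewrite normrM (@ger0_norm _ n%:R^-1) ?invr_ge0 ?(ltW n0) // -!mulrDl.
apply: ler_wpM2r; first by rewrite invr_ge0 ltW.
apply: (le_trans (ler_norm_sum _ _ _)).
apply: (@le_trans _ _ (\sum_(v in VR n) ((v \in gb sel1 w (VT n) (k n))%:R + (v \in gb sel2 w (VT n) (k n))%:R +
   (v \notin gb sel1 w (VT n) (k n).+1)%:R + (v \notin gb sel2 w (VT n) (k n).+1)%:R +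
   `|par_ratio sel1 sel2 w v (k n) - rho * gamma|))).
  by apply: ler_sum => v; rewrite VRP => vr; rewrite rho_gamma; apply: phi_bound.
by rewrite !big_split /= !lerD2r; apply: lerD; exact: sum_in_gb_le.
Unshelve. all: by end_near. Qed.

Lemma tildeR_endpoints : lambda = 0 \/ lambda = 1 ->
  (fun n => En n (fun w => `|tildeR (G1 w) (G2 w) (origin n) - gamma|)) @ \oo --> (0 : R).
Proof.
case=> [l0|l1].
  have [_ r] := level0 l0; apply: (@tildeR_endpoint K) => //; first exact: ball_frac.
  move=> f f12; apply: (cvg0_le (missed_cvg f12)); near=> n.
  have ok : okn n by near: n; exact: near_ok.
  have n0 := n_gt0 ok; have mu0 := mu_ge0 ok; apply/andP; split.
    by apply: Ex_ge0 => // w; rewrite divr_ge0 ?(ltW n0) // sumr_ge0.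
  by apply: ler_Ex => // w; rewrite l0 subr0; exact: ler_norm.
have [_ r] := level1 l1; apply: (@tildeR_endpoint (fun n => (K n).+1)) => //; last exact: missed'_cvg.
move=> f f12; apply: (cvg0_le (missed_cvg f12)); near=> n.
have ok : okn n by near: n; exact: near_ok.
have n0 := n_gt0 ok; have mu0 := mu_ge0 ok; apply/andP; split.
  by apply: Ex_ge0 => // w; rewrite divr_ge0 ?(ltW n0).
apply: ler_Ex => // w; rewrite gb_missed // l1 distrC mulrC mulKf ?gt_eqF //; exact: ler_norm.
Unshelve. all: by end_near. Qed.

Definition mid_ratio : R :=
  Poi3 ((1 - gamma) * ln lambda^-1) ((1 - gamma) * ln lambda^-1) (gamma * ln lambda^-1) ratio3.

Lemma ln_inv_ge0 : 0 < lambda -> 0 <= ln lambda^-1.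
Proof.
move=> l0; have /andP[_ l1] := lambda_itv.
by apply: ln_ge0; rewrite invf_ge1.
Qed.

(** As [lambda > 0] keeps [Ln] bounded, the Lipschitz bound in the Poisson parameters suffices, and
    the target can be the limit itself. *)
Lemma mean_ratio : 0 < lambda ->
  (fun n => En n (fun w => `|(\sum_(v in VR n) par_ratio sel1 sel2 w v (K n)) / n%:R - mid_ratio|))
    @ \oo --> (0 : R).
Proof.
move=> l0; have [eta eta0 Heta] := conc_K; have [zeta zeta0 Hzeta] := conc_cap_K.
have Lam0 := ln_inv_ge0 l0; have /andP[g0 g1] := gamma_itv.
have a0 : 0 <= (1 - gamma) * ln lambda^-1 by rewrite mulr_ge0 // subr_ge0.
have c0 : 0 <= gamma * ln lambda^-1 by rewrite mulr_ge0.
have -> : (fun n => En n (fun w => `|(\sum_(v in VR n) par_ratio sel1 sel2 w v (K n)) / n%:R - mid_ratio|)) =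
   (fun n => En n (fun w => `|(\sum_(v in VR n) psi sel1 sel2 ratio3 w (VT n) v (K n)) / n%:R - mid_ratio|)).
  apply/funext => n; apply: eq_Ex => w.
  by under [in RHS]eq_bigr => v vR do rewrite psi_ratio3.
have Lg : (fun n => Ln n * rho_ n ^+ (K n).+1) @ \oo --> gamma * ln lambda^-1.
  by rewrite mulrC; apply: cvgM; [exact: Ln_cvg|exact: gamma_n_cvg].
have Lg1 : (fun n => Ln n * (1 - rho_ n ^+ (K n).+1)) @ \oo --> (1 - gamma) * ln lambda^-1.
  rewrite mulrC; apply: cvgM; first exact: Ln_cvg.
  by apply: cvgB; [exact: cvg_cst|exact: gamma_n_cvg].
apply: (@mean_psi ratio3 (fun=> mid_ratio) (fun n => Ln n * (eta n + eta n + 3 * (zeta n + q n)) +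
   (2 * `|Ln n * (1 - rho_ n ^+ (K n).+1) - (1 - gamma) * ln lambda^-1| +
    `|Ln n * rho_ n ^+ (K n).+1 - gamma * ln lambda^-1|))).
- exact: ratio3_unit.
- by move=> n _; apply: Poi3_unit => //; exact: ratio3_unit.
- exact: cvg_cst.
- apply: cvg0D; last by apply: cvg0D; [apply: cvg0Z; exact: cvg_dist0|exact: cvg_dist0].
  rewrite -(mulr0 (ln lambda^-1)); apply: cvgM; first exact: Ln_cvg.
  apply: cvg0D; first exact: cvg0D.
  by apply: cvg0Z; apply: cvg0D => //; exact: q_small.
near=> n; have ok : okn n by near: n; exact: near_ok.
have He : forall f (U : {set vertex n}), prob1 (mu n) f = q n -> (#|~: U| <= 2)%N ->
    En n (fun w => `|#|gb f w U (K n)|%:R / N n ^+ K n - 1|) <= eta n by near: n.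
have Hz : forall U : {set vertex n}, (#|~: U| <= 2)%N ->
    En n (fun w => `|#|gcap sel1 sel2 w U (K n)|%:R / N n ^+ K n - rho_ n ^+ K n|) <= zeta n by near: n.
move=> U Uj; set e1 := `|Ln n * (1 - _) - _|; set e2 := `|Ln n * _ - _|.
have L0 := Ln_ge0 ok.
apply: (@le_trans _ _ (En n (fun w => Ln n * (`|#|gb sel1 w U (K n)|%:R / N n ^+ K n - 1| +
   `|#|gb sel2 w U (K n)|%:R / N n ^+ K n - 1| +
   3 * (`|#|gcap sel1 sel2 w U (K n)|%:R / N n ^+ K n - rho_ n ^+ K n| + q n)) + (2 * e1 + e2)))); last first.
  rewrite ExD Ex_cst ?mu3_sum1 // lerD2r ExZ ler_wpM2l // !ExD ExZ ExD Ex_cst ?mu3_sum1 //.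
  apply: lerD; last by rewrite ler_wpM2l // lerD2r Hz.
  by apply: lerD; apply: He => //; [exact: prob_sel1|exact: prob_sel2].
apply: (ler_Ex (mu_ge0 ok)) => w; have [a0' b0' c0'] := @params_ge0 n w U (K n) ok.
apply: (le_trans (Poi3_lip a0' b0' c0' a0 a0 c0 ratio3_unit)).
have /= [E1 E2 Ec [_ _ yd]] := @scaled_params n w U ok.
rewrite E1 E2 Ec {E1 E2 Ec a0' b0' c0'}.
set x1 := #|gb sel1 w U _|%:R / _; set x2 := #|gb sel2 w U _|%:R / _.
set ty := p11 n / q n * _ in yd *; set d := `|_ / _ - rho_ n ^+ K n| in yd *.
set gn := rho_ n ^+ (K n).+1 in e1 e2 yd *.
have step x : `|Ln n * x - Ln n * ty - (1 - gamma) * ln lambda^-1| <=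
    Ln n * (`|x - 1| + `|ty - gn|) + e1.
  have -> : Ln n * x - Ln n * ty - (1 - gamma) * ln lambda^-1 =
    Ln n * ((x - 1) - (ty - gn)) + (Ln n * (1 - gn) - (1 - gamma) * ln lambda^-1) by ring.
  apply: (le_trans (ler_normD _ _)); rewrite lerD2r normrM (ger0_norm L0) ler_wpM2l //.
  exact: ler_normB.
have stepc : `|Ln n * ty - gamma * ln lambda^-1| <= Ln n * `|ty - gn| + e2.
  have -> : Ln n * ty - gamma * ln lambda^-1 =
    Ln n * (ty - gn) + (Ln n * gn - gamma * ln lambda^-1) by ring.
  by apply: (le_trans (ler_normD _ _)); rewrite lerD2r normrM (ger0_norm L0).
apply: (le_trans (lerD (lerD (step x1) (step x2)) stepc)).
have := ler_wpM2l L0 yd; clear; set A := `|ty - gn|; set B := `|x1 - 1|; set C := `|x2 - 1|.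
by move: (Ln n) (q n) => l qq; lra.
Unshelve. all: by end_near. Qed.

(** A vertex has boundedly many neighbours on average in the ball of radius [K], against about
    [(1 - lambda) N] at radius [K + 1]. *)
Lemma nbr_K_small f : 0 < lambda < 1 -> f = sel1 \/ f = sel2 ->
  (fun n => \sum_(v in VR n) En n (fun w =>
     #|nbr f w v (gb f w (VT n :\ v)%SET (K n))|%:R / (q n * ((1 - lambda) * n%:R))) / n%:R)
    @ \oo --> (0 : R).
Proof.
move=> /andP[l0 l1] f12; have d0 : 0 < 1 - lambda by rewrite subr_gt0.
have NK : (fun n => N n ^+ K n / n%:R) @ \oo --> (0 : R) by apply: Nn_Kn_small.
apply: (cvg0_le (cvg0Z (2 / (1 - lambda)) NK)); near=> n.
have ok : okn n by near: n; exact: near_ok.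
have [_ /andP[q0 _] N20] := ok.
have pf : prob1 (mu n) f = q n by case: f12 => ->; [exact: prob_sel1|exact: prob_sel2].
have n0 := n_gt0 ok; have mu0 := mu_ge0 ok; have N0 := N_gt0 ok.
have M0 : 0 < q n * ((1 - lambda) * n%:R) by apply: mulr_gt0 => //; exact: mulr_gt0.
apply/andP; split.
  by apply: sumr_ge0 => v _; rewrite divr_ge0 ?(ltW n0) // Ex_ge0 // => w; rewrite divr_ge0 // ltW.
set c := _ * (_ / _); have c0 : 0 <= c.
  by rewrite /c mulr_ge0 // divr_ge0 // ?(ltW d0) ?(ltW n0) // exprn_ge0 // ltW.
have -> : c = #|vertex n|%:R * (c / n%:R) by rewrite natV // mulrC divfK // gt_eqF.
apply: sum_le_card; first by rewrite divr_ge0 // ltW.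
move=> v; rewrite VRP => vr; rewrite ler_wpM2r ?invr_ge0 ?(ltW n0) //.
under eq_Ex do rewrite mulrC.
rewrite ExZ Ex_nbr_gb ?mu3_sum1 // pf.
have N20' : 20 <= #|vertex n|%:R * q n by rewrite NE.
have := Ex_gb_le2 mu0 (mu3_sum1 (q n) (rho_ n)) (VT n :\ v)%SET (K n) pf N20'; rewrite NE // => h.
apply: (@le_trans _ _ ((q n * ((1 - lambda) * n%:R))^-1 * (q n * (2 * N n ^+ K n)))).
  by rewrite ler_wpM2l ?invr_ge0 ?(ltW M0) // ler_wpM2l // ltW.
by rewrite le_eqVlt; apply/orP; left; apply/eqP; rewrite /c; move: (N n) => NN; field; rewrite !gt_eqF.
Unshelve. all: by end_near. Qed.

Lemma tildeR_mid : 0 < lambda < 1 ->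
  (fun n => En n (fun w => `|tildeR (G1 w) (G2 w) (origin n) -
     (mid_ratio + rho * r0_mid * lambda `^ (2 - gamma))|)) @ \oo --> (0 : R).
Proof.
move=> l01; have /andP[l0 l1] := l01; have d0 : 0 < 1 - lambda by rewrite subr_gt0.
have [lev levr] := level_mid l01.
have s1 : sel1 = sel1 \/ sel1 = sel2 by left.
have s2 : sel2 = sel1 \/ sel2 = sel2 by right.
have c01 : 0 <= rho * r0_mid <= 1.
  have /andP[a b] := r0_mid_unit l01; have /andP[c d] := rho_itv.
  by rewrite mulr_ge0 //= mulr_ile1.
apply: (cvg0_le (cvg0D (cvg0D (cvg0D (ball_frac s1) (ball_frac s2))
  (cvg0D (cvg0D (cvg0D (lev _ s1) (lev _ s2)) levr) (cvg0D (nbr_K_small l01 s1) (nbr_K_small l01 s2))))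
  (cvg0D (mean_ratio l0) missed2_cvg))); near=> n.
have ok : okn n by near: n; exact: near_ok.
have [_ /andP[q0 _] _] := ok.
have n0 := n_gt0 ok; have mu0 := mu_ge0 ok; rewrite Ex_ge0 //=.
have M0 : 0 < q n * ((1 - lambda) * n%:R) by apply: mulr_gt0 => //; exact: mulr_gt0.
rewrite -!Ex_avg -!ExD; apply: ler_Ex => // w; rewrite tildeR_phi //.
set c := rho * r0_mid; set l := lambda `^ _.
set m := q n * ((1 - lambda) * n%:R).
set X := (\sum_(v in VR n) (phi sel1 sel2 w v - (par_ratio sel1 sel2 w v (K n) +
   c * ((v \notin gb sel1 w (VT n) (K n).+1) && (v \notin gb sel2 w (VT n) (K n).+1))%:R)) : R).
have -> : (\sum_(v in VR n) phi sel1 sel2 w v) / n%:R - (mid_ratio + c * l) =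
  X / n%:R + (((\sum_(v in VR n) par_ratio sel1 sel2 w v (K n)) / n%:R - mid_ratio) + c * (missed2 w - l)).
  by rewrite /X sumrB big_split /= -mulr_sumr /missed2; ring.
apply: (le_trans (ler_normD _ _)); apply: lerD; last first.
  apply: (le_trans (ler_normD _ _)); rewrite lerD2l normrM.
  by case/andP: c01 => c0 c1; rewrite (ger0_norm c0) ler_piMl.
rewrite normrM (@ger0_norm _ n%:R^-1) ?invr_ge0 ?(ltW n0) // -!mulrDl.
apply: ler_wpM2r; first by rewrite invr_ge0 ltW.
apply: (le_trans (ler_norm_sum _ _ _)).
apply: le_trans (lerD (lerD (sum_in_gb_le sel1 w (K n)) (sum_in_gb_le sel2 w (K n))) (lexx _)).
rewrite -!big_split /=; apply: ler_sum => v; rewrite VRP => vr.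
exact: (phi_mid_bound sel1 sel2 w (K n) vr c01 M0).
Unshelve. all: by end_near. Qed.

Lemma Poi_zero (f : nat -> R) : unit_valued f -> Poi 0 f = f 0%N.
Proof.
by move=> f01; have := Poi_head (lexx 0) f01; rewrite normr_le0 subr_eq0 => /eqP.
Qed.

Lemma expRN_ln_inv c : 0 < lambda -> expR (- (c * ln lambda^-1)) = lambda `^ c.
Proof. by move=> l0; rewrite lnV ?posrE // mulrN opprK /powR gt_eqF. Qed.

(** The common count has parameter 0. The boundary values of [gamma] are treated apart because
    [gPoissonE] asks for positive parameters. *)
Lemma mid_ratio_gamma0 : 0 < lambda -> gamma = 0 -> mid_ratio = 0.
Proof.
move=> l0 g0; have L0 := ln_inv_ge0 l0; rewrite /mid_ratio g0 subr0 mul1r mul0r /Poi3.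
have z : 0 <= (0 : R) <= 1 by rewrite lexx ler01.
transitivity (Poi (ln lambda^-1) (fun=> Poi (ln lambda^-1) (fun=> 0 : R))).
  apply: eq_Poi => i; apply: eq_Poi => j; rewrite Poi_zero; last by move=> k; exact: ratio3_unit.
  by rewrite /ratio3 mul0r.
by rewrite !Poi_cst // Poi_cst.
Qed.

(** No neighbour is counted for one graph only, so the ratio is the indicator of a positive common
    count. *)
Lemma mid_ratio_gamma1 : 0 < lambda -> gamma = 1 -> mid_ratio = 1 - lambda.
Proof.
move=> l0 g1; have L0 := ln_inv_ge0 l0; rewrite /mid_ratio g1 subrr mul1r mul0r /Poi3.
have r01 i j : unit_valued (@ratio3 R i j) by move=> k; exact: ratio3_unit.
rewrite Poi_zero; last by move=> i; apply: Poi_unit => // j; exact: Poi_unit.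
rewrite Poi_zero; last by move=> j; exact: Poi_unit.
transitivity (Poi (ln lambda^-1) (fun k => (0 < k)%N%:R : R)).
  apply: eq_Poi => -[|k]; rewrite /ratio3; first by rewrite mul0r.
  by rewrite max0n add0n divff // pnatr_eq0.
by rewrite Poi_pos // -[ln _]mul1r expRN_ln_inv // powRr1 // ltW.
Qed.

Lemma mid_ratio_fPoisson : 0 < lambda < 1 -> 0 < gamma < 1 -> mid_ratio = fPoisson lambda gamma.
Proof.
move=> /andP[l0 l1] /andP[g0 g1].
have L0 : 0 < ln lambda^-1 by rewrite ln_gt0 // invf_gt1.
by rewrite /fPoisson -expRN_ln_inv // gPoissonE // mulr_gt0 // subr_gt0.
Qed.

Lemma rho_eq1 : gamma != 0 -> rho = 1.
Proof.
move=> g0; have /andP[_ r1] := rho_itv; apply/eqP; rewrite eq_le r1 leNgt.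
by apply/negP => /gamma_rho_lt1 /eqP; exact/negP.
Qed.

(** One formula covers all of [0 < lambda < 1]; the cases of the statement are its values. *)
Lemma limits_in_probability :
  [/\ cvg_in_prob q rho_ (fun n w => (NI (dstar q n) w)%:R / n%:R)
        (1 - 2 * lambda + lambda `^ (2 - gamma)),
      cvg_in_prob q rho_ (fun n w => (Nsame w)%:R / n%:R)
        (1 - 2 * lambda + 2 * lambda `^ (2 - gamma)),
      0 < lambda < 1 -> cvg_in_prob q rho_ (fun n w => tildeR (G1 w) (G2 w) (origin n))
        (mid_ratio + rho * r0_mid * lambda `^ (2 - gamma))
    & lambda = 0 \/ lambda = 1 ->
      cvg_in_prob q rho_ (fun n w => tildeR (G1 w) (G2 w) (origin n)) gamma].
Proof using All.
have q01 : \forall n \near \oo, 0 <= q n <= 1.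
  by near=> n; have [_ /andP[a b] _] : okn n by [near: n; exact: near_ok]; rewrite (ltW a).
split.
- exact: (cvg_in_prob_L1 q01 rho_unit NI_cvg).
- apply: (cvg_in_prob_L1 q01 rho_unit); apply: Nsame_cvg; exact: missed'_cvg.
- by move=> l01; exact: (cvg_in_prob_L1 q01 rho_unit (tildeR_mid l01)).
- by move=> le; exact: (cvg_in_prob_L1 q01 rho_unit (tildeR_endpoints le)).
Unshelve. all: by end_near. Qed.

End limits.

Theorem theorem1p3 (R : realType) (alpha rho_ : nat -> R)
    (lambda rho gamma : R)
    (alpha_gt0 : forall n, 0 < alpha n)
    (alpha_liminf : (0 < limn_einf (EFin \o alpha))%E)
    (alpha_limsup : (limn_esup (EFin \o alpha) < +oo)%E)
    (rho_01 : forall n, 0 < rho_ n < 1)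
    (lambda_itv : 0 <= lambda <= 1)
    (rho_itv : 0 <= rho <= 1)
    (gamma_itv : 0 <= gamma <= 1)
    (lambda_cvg : lambda_seq (edge_prob alpha) @ \oo --> lambda)
    (rho_cvg : rho_ @ \oo --> rho)
    (gamma_rho_lt1 : rho < 1 -> gamma = 0)
    (gamma_rho_eq1 :
      rho = 1 -> gamma_seq (edge_prob alpha) rho_ @ \oo --> gamma) :
  let q := edge_prob alpha in
  let R_ n (w : sample n) : R := tildeR (G1 w) (G2 w) (origin n) in
  [/\ cvg_in_prob q rho_ (fun n w => (NI (dstar q n) w)%:R / n%:R)
        (1 - 2 * lambda + lambda `^ (2 - gamma)),
      cvg_in_prob q rho_ (fun n w => (Nsame w)%:R / n%:R)
        (1 - 2 * lambda + 2 * lambda `^ (2 - gamma))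
    & [/\ 0 < lambda < 1 -> gamma = 1 -> cvg_in_prob q rho_ R_ 1,
          0 < lambda < 1 -> 0 < gamma < 1 ->
            cvg_in_prob q rho_ R_
              ((1 - 2 * lambda + lambda `^ (2 - gamma)) / (1 - lambda)
                 * lambda `^ (2 - gamma) + fPoisson lambda gamma),
          0 < lambda < 1 -> gamma = 0 ->
            cvg_in_prob q rho_ R_ (rho * (1 - lambda) * lambda ^+ 2)
        & lambda = 0 \/ lambda = 1 -> cvg_in_prob q rho_ R_ gamma]].
Proof.
have [hI hsame hmid hend] := @limits_in_probability R alpha rho_ lambda rho gamma alpha_gt0 alpha_liminf
  alpha_limsup rho_01 lambda_itv rho_itv gamma_itv lambda_cvg rho_cvg gamma_rho_lt1 gamma_rho_eq1.
split=> //; split=> //.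
- move=> l01 g1; have /andP[l0 l1] := l01.
  (* At [gamma = 1] the density [r0_mid] is 1, and the two terms are [1 - lambda] and [lambda]. *)
  have -> : 1 = mid_ratio lambda gamma + rho * r0_mid lambda gamma * lambda `^ (2 - gamma) :> R.
    rewrite (mid_ratio_gamma1 lambda_itv) // (rho_eq1 rho_itv gamma_rho_lt1) ?g1 ?oner_eq0 // /r0_mid.
    have -> : 2 - 1 = 1 :> R by ring.
    by rewrite powRr1 ?(ltW l0) //; field; rewrite subr_eq0 gt_eqF.
  exact: hmid.
- move=> l01 g01; have /andP[g0 _] := g01.
  have -> : (1 - 2 * lambda + lambda `^ (2 - gamma)) / (1 - lambda) * lambda `^ (2 - gamma) +
      fPoisson lambda gamma = mid_ratio lambda gamma + rho * r0_mid lambda gamma * lambda `^ (2 - gamma).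
    by rewrite (mid_ratio_fPoisson l01 g01) (rho_eq1 rho_itv gamma_rho_lt1) ?gt_eqF // mul1r addrC.
  exact: hmid.
- move=> l01 g0; have /andP[l0 l1] := l01.
  (* At [gamma = 0] the Poisson term is 0 and the density is [(1 - lambda)^2 / (1 - lambda)]. *)
  have -> : rho * (1 - lambda) * lambda ^+ 2 =
      mid_ratio lambda gamma + rho * r0_mid lambda gamma * lambda `^ (2 - gamma).
    rewrite (mid_ratio_gamma0 lambda_itv) // /r0_mid g0 subr0 powR_mulrn ?(ltW l0) //.
    by field; rewrite subr_eq0 gt_eqF.
  exact: hmid.
Qed.
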